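(* Let $G$ be a centered Gaussian measure on $(Z,\mathcal Z)$ with non-atomic control measure $\nu$. Fix $k\ge1$ and integers $n_1,\dots,n_k\ge1$, let $n=n_1+\cdots+n_k$, and let $\pi^*=\{\{1,\dots,n_1\},\{n_1+1,\dots,n_1+n_2\},\dots,\{n_1+\cdots+n_{k-1}+1,\dots,n\}\}\in\mathcal P([n])$. Then, for any vector of functions $(f_1,\dots,f_k)$ such that $f_j\in L^2_s(\nu^{n_j})$, $j=1,\dots,k$, the following relations hold: 1. If $\mathcal M_2([n],\pi^* )=\varnothing$ (in particular, if $n$ is odd), then $\chi(I^G_{n_1}(f_1),\dots,I^G_{n_k}(f_k))=0$. 2. If $\mathcal M_2([n],\pi^* )\neq\varnothing$, then $$\chi\left(I^G_{n_1}(f_1),\dots,I^G_{n_k}(f_k)\right)=\sum_{\sigma\in\mathcal M_2([n],\pi^* )}\int_{Z^{n/2}}f_{\sigma,k}\,d\nu^{n/2},$$ where $f_{\sigma,k}$ is the function of $n/2$ variables obtained by identifying the variables $x_i$ and $x_j$ in the argument of $f_1\otimes_0\cdots\otimes_0f_k$ if and only if $i\sim_\sigma j$. 3. If $\mathcal M^0_2([n],\pi^* )=\varnothing$ (in particular, if $n$ is odd), then $\mathbb E(I^G_{n_1}(f_1)\cdots I^G_{n_k}(f_k))=0$. 4. If $\mathcal M^0_2([n],\pi^* )\neq\varnothing$, then $$\mathbb E\left(I^G_{n_1}(f_1)\cdots I^G_{n_k}(f_k)\right)=\sum_{\sigma\in\mathcal M^0_2([n],\pi^* )}\int_{Z^{n/2}}f_{\sigma,k}\,d\nu^{n/2},$$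 with $f_{\sigma,k}$ obtained by the same identification rule.
   Context: $(Z,\mathcal Z)$ is a Polish space with its Borel $\sigma$-field, $\nu$ a positive, $\sigma$-finite, non-atomic measure, $\mathcal Z_\nu=\{B\in\mathcal Z:\nu(B)<\infty\}$. A centered Gaussian measure with control $\nu$ is a centered jointly Gaussian family $G=\{G(B):B\in\mathcal Z_\nu\}$ with $\mathbb E[G(B)G(C)]=\nu(B\cap C)$. $L^2_s(\nu^m)$ is the space of symmetric real functions in $L^2(Z^m,\nu^m)$. The multiple Wiener-Itô integral $I^G_m:L^2_s(\nu^m)\to L^2(\mathbb P)$ is the unique continuous linear operator such that $I^G_m(\mathbf 1_{\widetilde C})=m!\,G(C_1)\cdots G(C_m)$ for every set $\widetilde C=\bigcup_{w\in\mathfrak S_m}C_{w(1)}\times\cdots\times C_{w(m)}$ with $C_1,\dots,C_m\in\mathcal Z_\nu$ pairwise disjoint ($\mathfrak S_m$ the permutations of $\{1,\dots,m\}$). $[n]=\{1,\dots,n\}$; $\mathcal P([n])$ is the lattice of partitions of $[n]$ ($\sigma\le\pi$ iff each block of $\sigma$ is contained in a block of $\pi$), with meet $\wedge$, join $\vee$, $\hat0$ the partition into singletons, $\hat1=\{[n]\}$; $i\sim_\sigma j$ means $i,j$ are in the same block of $\sigma$. Define $$\mathcal M_2([n],\pi^* )=\{\sigma\in\mathcal P([n]):\sigma\vee\pi^*=\hat1,\ \sigma\wedge\pi^*=\hat0,\ |b|=2\ \forall b\in\sigma\},$$ $$\mathcal M^0_2([n],\pi^* )=\{\sigma\in\mathcal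 P([n]):\sigma\wedge\pi^*=\hat0,\ |b|=2\ \forall b\in\sigma\}.$$ $f_1\otimes_0\cdots\otimes_0f_k(x_1,\dots,x_n)=\prod_{j=1}^kf_j(x_{n_1+\cdots+n_{j-1}+1},\dots,x_{n_1+\cdots+n_j})$. Joint cumulant: for random variables with moments of all orders, $\chi(X_1,\dots,X_k)=(-i)^k\frac{\partial^k}{\partial z_1\cdots\partial z_k}\log\mathbb E[\exp(i\sum_\ell z_\ell X_\ell)]\big|_{z=0}$. *)

(* Defs.v *)
From HB Require Import structures.
From mathcomp Require Import all_boot all_order all_algebra all_fingroup.

Set Implicit Arguments.
Unset Strict Implicit.
Unset Printing Implicit Defensive.

Section Partitions.
Variable n : nat.
Local Notation sys := {set {set 'I_n}}.
Implicit Types s t u : sys.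

Definition is_partition s : bool := partition s [set: 'I_n].

Definition refines s t : bool := [forall b in s, exists c in t, b \subset c].

Definition pbot : sys := [set [set i] | i : 'I_n].
Definition ptop : sys := [set [set: 'I_n]].

Definition pmeet s t : sys := [set b :&: c | b in s, c in t] :\ set0.

Definition same_block s : rel 'I_n := fun i j => j \in pblock s i.

Definition pjoin s t : sys :=
  equivalence_partition
    (connect (fun i j => same_block s i j || same_block t i j)) [set: 'I_n].

Lemma refines_sub s t b : refines s t -> b \in s -> exists2 c, c \in t & b \subset c.
Proof. by move=> /forall_inP h /h /exists_inP. Qed.

Lemma pmeet_is_inf s t : is_partition s -> is_partition t ->
  [/\ is_partition (pmeet s t), refines (pmeet s t) s, refines (pmeet s t) t
    & forall u, is_partition u -> refines u s -> refines u t ->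
        refines u (pmeet s t)].
Proof.
move=> /and3P[/eqP cs ts s0] /and3P[/eqP ct tt t0]; split.
- apply/and3P; split.
  + apply/eqP/setP => i; rewrite inE; apply/bigcupP.
    have : i \in cover s by rewrite cs inE.
    have : i \in cover t by rewrite ct inE.
    move=> /bigcupP[c cT ic] /bigcupP[b bS ib].
    exists (b :&: c); last by rewrite inE ib.
    rewrite !inE; apply/andP; split; last exact: imset2_f.
    by apply/set0Pn; exists i; rewrite inE ib.
  + apply/trivIsetP => A B /setD1P[_ /imset2P[b c bS cT ->]].
    move=> /setD1P[_ /imset2P[b' c' bS' cT' ->]] ne.
    rewrite -setI_eq0; apply/eqP/setP => i; rewrite !inE.
    apply/negP => /andP[/andP[ib ic] /andP[ib' ic']].
    have bb : b = b' by rewrite -(def_pblock ts bS ib) -(def_pblock ts bS' ib').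
    have cc : c = c' by rewrite -(def_pblock tt cT ic) -(def_pblock tt cT' ic').
    by rewrite bb cc eqxx in ne.
  + by rewrite !inE eqxx.
- apply/forall_inP => A /setD1P[_ /imset2P[b c bS cT ->]].
  by apply/exists_inP; exists b => //; exact: subsetIl.
- apply/forall_inP => A /setD1P[_ /imset2P[b c bS cT ->]].
  by apply/exists_inP; exists c => //; exact: subsetIr.
- move=> u /and3P[_ _ u0] us ut; apply/forall_inP => a au.
  have [b bS ab] := refines_sub us au.
  have [c cT ac] := refines_sub ut au.
  have abc : a \subset b :&: c by rewrite subsetI ab.
  apply/exists_inP; exists (b :&: c) => //.
  rewrite !inE; apply/andP; split; last exact: imset2_f.
  apply: contraNneq u0 => bc0; move: abc.
  by rewrite bc0 subset0 => /eqP <-.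
Qed.

Lemma same_blockP s i j : is_partition s ->
  reflect (exists2 b, b \in s & (i \in b) && (j \in b)) (same_block s i j).
Proof.
move=> /and3P[/eqP cs ts s0]; apply: (iffP idP).
  have ic : i \in cover s by rewrite cs inE.
  move=> ij; exists (pblock s i); first exact: pblock_mem.
  by rewrite mem_pblock ic.
by move=> [b bS /andP[ib jb]]; rewrite /same_block (def_pblock ts bS ib).
Qed.

Lemma pjoin_is_sup s t : is_partition s -> is_partition t ->
  [/\ is_partition (pjoin s t), refines s (pjoin s t), refines t (pjoin s t)
    & forall u, is_partition u -> refines s u -> refines t u ->
        refines (pjoin s t) u].
Proof.
move=> ps pt.
set e := fun i j => same_block s i j || same_block t i j.
have sym_e : symmetric e.
  move=> i j; rewrite /e.
  have sb v : is_partition v -> same_block v i j = same_block v j i.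
    by move=> pv; apply/same_blockP/same_blockP => // -[b bv h]; exists b; rewrite // andbC.
  by rewrite !sb.
have eqR : {in [set: 'I_n] & &, equivalence_rel (connect e)}.
  move=> x y z _ _ _; split; first exact: connect0.
  by move=> xy; apply: (same_connect (sym_connect_sym sym_e)) xy _.
have pj : is_partition (pjoin s t) by exact: equivalence_partitionP.
have le v : is_partition v -> (forall i j, same_block v i j -> e i j) -> refines v (pjoin s t).
  move=> pv h; apply/forall_inP => b bv; apply/exists_inP.
  have /set0Pn[i ib] : b != set0.
    by apply: contraTneq bv => ->; case/and3P: pv.
  exists (pblock (pjoin s t) i).
    by apply: pblock_mem; rewrite (cover_partition pj) inE.
  apply/subsetP => j jb.
  rewrite pblock_equivalence_partition ?inE//.
  by apply/connect1/h/same_blockP => //; exists b => //; rewrite ib.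
split=> //.
- by apply: le => // i j h; rewrite /e h.
- by apply: le => // i j h; rewrite /e h orbT.
- move=> u pu su tu; apply/forall_inP => b bj; apply/exists_inP.
  have /set0Pn[i ib] : b != set0.
    by apply: contraTneq bj => ->; case/and3P: pj.
  have tj : trivIset (pjoin s t) by case/and3P: pj.
  exists (pblock u i).
    by apply: pblock_mem; rewrite (cover_partition pu) inE.
  apply/subsetP => j; rewrite -(def_pblock tj bj ib).
  rewrite pblock_equivalence_partition ?inE// => /connectP[p].
  have tru : trivIset u by case/and3P: pu.
  have eu x y : e x y -> pblock u x = pblock u y.
    case/orP => /same_blockP => [/(_ ps)|/(_ pt)] [c cS /andP[xc yc]].
      have [v vu cv] := refines_sub su cS.
      by rewrite !(def_pblock tru vu) ?(subsetP cv).
    have [v vu cv] := refines_sub tu cS.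
    by rewrite !(def_pblock tru vu) ?(subsetP cv).
  move=> pth ->.
  suff -> : pblock u i = pblock u (last i p).
    by rewrite mem_pblock (cover_partition pu) inE.
  elim: p i {ib} pth => //= x p IH i /andP[eix pth].
  by rewrite (eu _ _ eix) IH.
Qed.

Definition M2_0 (pi : sys) : {set sys} :=
  [set s : sys | [&& is_partition s, pmeet s pi == pbot
                   & [forall b in s, #|b| == 2]]].

Definition M2 (pi : sys) : {set sys} :=
  [set s : sys | [&& is_partition s, pjoin s pi == ptop, pmeet s pi == pbot
                   & [forall b in s, #|b| == 2]]].

End Partitions.

(* tagnat.Rank j sends i : 'I_(n_ j) to the position n_ 0 + ... + n_ (j - 1) + i
   (tagnat.RankEsum), so the blocks are consecutive intervals. *)
Definition pi_star (k : nat) (n_ : 'I_k -> nat) :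
    {set {set 'I_(\sum_(j < k) n_ j)}} :=
  [set [set tagnat.Rank j i | i : 'I_(n_ j)] | j : 'I_k].

From mathcomp Require Import all_classical all_reals all_analysis.
From mathcomp Require Import complex.

Import Order.TTheory GRing.Theory Num.Theory.
Import numFieldNormedType.Exports.

Local Open Scope classical_set_scope.
Local Open Scope ring_scope.

Definition is_metric (R : realType) (Z : Type) (dist : Z -> Z -> R) : Prop :=
  [/\ forall x y, 0 <= dist x y, forall x y, dist x y = 0 <-> x = y,
      forall x y, dist x y = dist y x
    & forall x y z, dist x z <= dist x y + dist y z].

Definition polish (R : realType) (Z : topologicalType) : Prop :=
  (exists D : set Z, countable D /\ dense D) /\
  exists dist : Z -> Z -> R,
    [/\ is_metric dist,
        forall (x : Z) (A : set Z),
          nbhs x A <-> exists2 e : R, 0 < e & [set y | dist x y < e] `<=` A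
      & forall u : nat -> Z,
          (forall e : R, 0 < e -> exists N, forall p q,
             (N <= p)%N -> (N <= q)%N -> dist (u p) (u q) < e) ->
          exists l : Z, u @ \oo --> l].

Definition borel (Z : ptopologicalType) := g_sigma_algebraType (@open Z).
HB.instance Definition _ (Z : ptopologicalType) := Measurable.on (borel Z).

Definition is_atom d (T : measurableType d) (R : realType)
    (mu : {measure set T -> \bar R}) (A : set T) : Prop :=
  [/\ measurable A, (0 < mu A)%E
    & forall B, measurable B -> B `<=` A -> (mu B < mu A)%E -> mu B = 0%E].

Definition nonatomic d (T : measurableType d) (R : realType)
    (mu : {measure set T -> \bar R}) : Prop :=
  forall A, ~ is_atom mu A.

Lemma sigma_finite_prod d1 d2 (T1 : measurableType d1) (T2 : measurableType d2)
    (R : realType) (m1 : {sigma_finite_measure set T1 -> \bar R})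
    (m2 : {sigma_finite_measure set T2 -> \bar R}) :
  sigma_finite setT (m1 \x m2)%E.
Proof.
have /sigma_finiteP[F [TF ndF Foo]] := sigma_finiteT m1.
have /sigma_finiteP[G [TG ndG Goo]] := sigma_finiteT m2.
exists (fun n => F n `*` G n).
  rewrite -setXTT TF TG predeqE => -[x y]; split.
    move=> [/= [n _ Fnx] [k _ Gky]]; exists (maxn n k) => //; split.
    - by move: x Fnx; exact/subsetPset/ndF/leq_maxl.
    - by move: y Gky; exact/subsetPset/ndG/leq_maxr.
  by move=> [n _ []/= ? ?]; split; exists n.
move=> k; have [? ?] := Foo k; have [? ?] := Goo k.
split; first exact: measurableX.
by rewrite product_measure1E// lte_mul_pinfty// ge0_fin_numE.
Qed.

Section PowerMeasure.
Context d (T : measurableType d) (R : realType).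

Section ConsMeasure.
Variables (nu : {sigma_finite_measure set T -> \bar R}) (m : nat).
Variable mu : {sigma_finite_measure set (m.-tuple T) -> \bar R}.

Definition cons_pair (p : T * m.-tuple T) : m.+1.-tuple T :=
  [tuple of p.1 :: p.2].

Lemma measurable_cons_pair : measurable_fun [set: T * m.-tuple T] cons_pair.
Proof. exact: measurable_cons. Qed.

Definition cons_measure : set (m.+1.-tuple T) -> \bar R :=
  pushforward (nu \x mu)%E cons_pair.

Let cons_measure0 : cons_measure set0 = 0%E.
Proof. by rewrite /cons_measure /pushforward preimage_set0 measure0. Qed.

Let cons_measure_ge0 A : (0 <= cons_measure A)%E.
Proof. by rewrite /cons_measure /pushforward measure_ge0. Qed.

Let cons_measure_sigma_additive : semi_sigma_additive cons_measure.
Proof.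
have mcons A : measurable A -> measurable (cons_pair @^-1` A).
  by move=> mA; rewrite -[X in measurable X]setTI; exact: measurable_cons_pair.
move=> F mF tF mUF; rewrite /cons_measure /pushforward preimage_bigcup.
apply: measure_semi_sigma_additive.
- by move=> n; exact: mcons.
- apply/trivIsetP => /= i j _ _ ij; rewrite -preimage_setI.
  by move/trivIsetP : tF => /(_ _ _ _ _ ij) ->//; rewrite preimage_set0.
- by rewrite -preimage_bigcup; exact: mcons.
Qed.

HB.instance Definition _ := isMeasure.Build _ _ _ cons_measure
  cons_measure0 cons_measure_ge0 cons_measure_sigma_additive.

Let cons_measure_sigma_finite : sigma_finite setT cons_measure.
Proof.
have [F FT Ffin] := sigma_finite_prod nu mu.
pose uncons (x : m.+1.-tuple T) : T * m.-tuple T :=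
  (tnth x ord0, [tuple of behead x]).
have unconsK : cancel uncons cons_pair.
  by move=> x; rewrite /uncons /cons_pair /=; apply/esym/tuple_eta.
have consK : cancel cons_pair uncons.
  move=> [a x]; rewrite /uncons /cons_pair /=; congr pair; exact/val_inj.
have muncons : measurable_fun setT uncons.
  apply/measurable_fun_pairP; split.
    exact: (measurable_tnth ord0).
  exact: measurable_behead.
exists (fun n => uncons @^-1` F n).
  by rewrite -preimage_bigcup -FT preimage_setT.
move=> n; have [mFn Fnoo] := Ffin n; split.
  by rewrite -[X in measurable X]setTI; exact: muncons.
rewrite /cons_measure /pushforward -comp_preimage.
by rewrite (_ : uncons \o cons_pair = id) //; apply/funext => x; exact: consK.
Qed.

HB.instance Definition _ := Measure_isSigmaFinite.Build _ _ _ cons_measure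
  cons_measure_sigma_finite.

End ConsMeasure.

Variable nu : {sigma_finite_measure set T -> \bar R}.

Fixpoint power_measure (m : nat) :
    {sigma_finite_measure set (m.-tuple T) -> \bar R} :=
  if m is m'.+1 then cons_measure nu (power_measure m')
  else \d_([tuple] : 0.-tuple T).

Lemma power_measureE m (A : 'I_m -> set T) :
  (forall i, measurable (A i)) ->
  power_measure m [set x | forall i, A i (tnth x i)] = (\prod_(i < m) nu (A i))%E.
Proof.
elim: m A => [|m IH] A mA.
  rewrite big_ord0 /= diracE (_ : _ \in _) // inE => -[] //.
rewrite big_ord_recl -IH // /= /cons_measure /pushforward.
rewrite (_ : _ @^-1` _ = A ord0 `*` [set x | forall i, A (lift ord0 i) (tnth x i)]).
  rewrite product_measure1E //.
  rewrite (_ : [set x | _] = \bigcap_(i in [set: 'I_m]) ((fun x => tnth x i) @^-1` A (lift ord0 i))).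
    apply: fin_bigcap_measurable => // i _.
    rewrite -[X in measurable X]setTI; exact: measurable_tnth.
  by apply/seteqP; split => x /= h i; [move=> _|]; apply: h.
apply/seteqP; split => -[a x] /=.
  move=> h; split; first exact: (h ord0).
  by move=> i; have := h (lift ord0 i); rewrite tnthS.
move=> [h0 h] i; case: (unliftP ord0 i) => [j|] ->; last by [].
by rewrite tnthS.
Qed.

End PowerMeasure.

Definition finite_sets d (T : measurableType d) (R : realType)
    (nu : {measure set T -> \bar R}) : set (set T) :=
  [set B | measurable B /\ (nu B < +oo)%E].

(* normal_prob m 0 is not the Dirac mass at m, whence the case analysis. *)
Definition gaussian_law (R : realType) (m s : R) (A : set R) : \bar R :=
  if s == 0 then \d_m A else normal_prob m s A.

Definition centered_gaussian d (T : measurableType d) (R : realType)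
    (P : probability T R) (X : T -> R) : Prop :=
  measurable_fun setT X /\
  exists2 s : R, 0 <= s
    & forall A, measurable A -> P (X @^-1` A) = gaussian_law 0 s A.

(* Joint Gaussianity of a family: every finite linear combination is Gaussian. *)
Definition gaussian_measure d (T : measurableType d) (R : realType)
    (P : probability T R) d' (Z : measurableType d')
    (nu : {measure set Z -> \bar R}) (G : set Z -> T -> R) : Prop :=
  (forall (m : nat) (B : 'I_m -> set Z) (a : 'I_m -> R),
     (forall i, finite_sets nu (B i)) ->
     centered_gaussian P (fun w => \sum_(i < m) a i * G (B i) w)) /\
  (forall B C, finite_sets nu B -> finite_sets nu C ->
     'E_P[(fun w => G B w * G C w)%R] = nu (B `&` C))%E.

Section WienerIto.
Context d (T : measurableType d) (R : realType) (P : probability T R).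
Context d' (Z : measurableType d') (nu : {sigma_finite_measure set Z -> \bar R}).

Definition permute m (w : 'S_m) (x : m.-tuple Z) : m.-tuple Z :=
  [tuple tnth x (w i) | i < m].

(* Elements of L^2 are represented by functions, so symmetry is only required
   almost everywhere. *)
Definition sym_L2 m : set (m.-tuple Z -> R) :=
  [set f | f \in Lfun (power_measure nu m) 2%:E /\
     forall w : 'S_m, f \o permute w = f %[ae power_measure nu m]].

Definition sym_box m (C : 'I_m -> set Z) : set (m.-tuple Z) :=
  \bigcup_(w in [set: 'S_m]) [set x | forall i, C (w i) (tnth x i)].

(* I represents an operator between spaces of classes, so its values are only
   determined almost surely; continuity, applied to constant sequences, makes I
   compatible with almost everywhere equality of its argument. *)
Definition multiple_integral (G : set Z -> T -> R) m
    (I : (m.-tuple Z -> R) -> (T -> R)) : Prop :=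
  [/\ forall f, sym_L2 f -> I f \in Lfun P 2%:E,
      forall (a : R) f g, sym_L2 f -> sym_L2 g ->
        I (fun x => a * f x + g x) = (fun t => a * I f t + I g t) %[ae P],
      forall (u : nat -> m.-tuple Z -> R) f,
        (forall p, sym_L2 (u p)) -> sym_L2 f ->
        ('N[power_measure nu m]_2%:E[EFin \o (u p \- f)%R] @[p --> \oo] --> 0)%E ->
        ('N[P]_2%:E[EFin \o (I (u p) \- I f)%R] @[p --> \oo] --> 0)%E
    & forall C : 'I_m -> set Z,
        (forall i, finite_sets nu (C i)) -> trivIset setT C ->
        I \1_(sym_box C) = (fun t => m`!%:R * \prod_(i < m) G (C i) t) %[ae P]].

End WienerIto.

Section Cumulant.
Context d (T : measurableType d) (R : realType) (P : probability T R).
Local Open Scope complex_scope.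

(* Principal argument, with values in ]-pi, pi]. *)
Definition carg (z : R[i]) : R :=
  let: x +i* y := z in
  if 0 < x then atan (y / x)
  else if 0 < y then pi / 2 - atan (x / y)
  else if y < 0 then - (pi / 2) - atan (x / y)
  else pi.

Definition clog (z : R[i]) : R[i] := ln (complex.Re `|z|) +i* carg z.

Definition cexpectation (Y : T -> R[i]) : R[i] :=
  fine 'E_P[fun t => complex.Re (Y t)] +i* fine 'E_P[fun t => complex.Im (Y t)].

Definition char_fun k (X : 'I_k -> T -> R) (z : 'rV[R]_k) : R[i] :=
  cexpectation (fun t =>
    let s := \sum_(l < k) z 0 l * X l t in cos s +i* sin s).

Definition partial k (l : 'I_k) (g : 'rV[R]_k -> R[i]) (z : 'rV[R]_k) : R[i] :=
  'D_(delta_mx 0 l) (fun x => complex.Re (g x) : R^o) z +i*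
  'D_(delta_mx 0 l) (fun x => complex.Im (g x) : R^o) z.

Definition joint_cumulant k (X : 'I_k -> T -> R) : R[i] :=
  (- 'i%C) ^+ k *
  foldr (@partial k) (fun z => clog (char_fun X z)) (enum 'I_k) 0.

End Cumulant.

Section Identification.
Context (R : realType) (Z : pointedType) (k : nat) (n_ : 'I_k -> nat).
Local Notation n := (\sum_(j < k) n_ j)%N.

Definition tensor0 (f : forall j, (n_ j).-tuple Z -> R) (x : n.-tuple Z) : R :=
  \prod_(j < k) f j [tuple tnth x (tagnat.Rank j i) | i < n_ j].

(* The n/2 blocks of s are numbered by enum s; the variable x_i becomes the
   variable of the block of i. The default point is not reached when s is a
   partition into pairs. *)
Definition identify (s : {set {set 'I_n}}) (y : (n./2).-tuple Z) : n.-tuple Z :=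
  [tuple nth point y (index (finset.pblock s i) (enum s)) | i < n].

Definition f_sigma (f : forall j, (n_ j).-tuple Z -> R)
    (s : {set {set 'I_n}}) (y : (n./2).-tuple Z) : R :=
  tensor0 f (identify s y).

End Identification.

(* Main.v *)
(* Both identities are multilinear in (f_1, ..., f_k) and continuous for the L^2
   norms, so it suffices to check them on indicators of symmetrized boxes with
   pairwise disjoint sides, where the integrals are products of Gaussian
   variables.  There Wick's formula gives the moments, and grouping a pairing by
   the connected component of a fixed block gives the cumulants.

   Density of these indicators uses that the diagonals are null (nu is
   non-atomic) and that their complement is a countable union of boxes with
   disjoint sides.  Continuity of the contractions is an iterated Cauchy-Schwarz
   inequality; continuity of the moments needs all moments of I_m(f), which come
   from the moment formula for 2p copies of f in the span of the boxes.

   Wick's formula and the moment-cumulant relation are read off the derivatives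
   of the functions E[X_B cos(a + z.X)].  For a centered normal variable,
   E[cos(a + t X)] is computed by integration by parts, as the solution of a
   linear differential equation in t. *)
Require Import Defs.
From HB Require Import structures.
From mathcomp Require Import all_boot all_order all_algebra all_fingroup.

Set Implicit Arguments.
Unset Strict Implicit.
Unset Printing Implicit Defensive.

Import Order.TTheory GRing.Theory Num.Theory.

Local Open Scope ring_scope.

(** * Pairings and cumulants *)

(** Moments and cumulants share one argument. Both are functionals of the family of joint moments
    indexed by sets of variables, linear in each variable and continuous; what separates them is the
    set of pairings that they produce from a kernel. The cumulant is therefore not written as a sum
    over set partitions but through a recursion on the block of a distinguished variable l. Sorting
    pairings by the component of l gives this recursion, and so does differentiating the logarithm
    of the characteristic function, so no Moebius inversion is needed.

    Wick's formula itself puts no restriction on the pairs. The condition that the meet with the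
    block partition be trivial appears because a pair inside one block couples two disjoint sides,
    whose intersection has measure zero.

    The obstacle is integrability: a product of k integrals is not integrable on the sole ground
    that each factor is in L2. On the span of the boxes the formula bounds every even moment by a
    power of the L2 norm; this bound is carried to L2 limits before any convergence of joint moments
    is used. *)

Section Pairings.
Variable T : finType.
Implicit Types (A B b c : {set T}) (s : {set {set T}}).

Definition pairings A : {set {set {set T}}} :=
  [set s | partition s A && [forall b in s, #|b| == 2]].

Lemma pairingsP s A : reflect
  [/\ forall b, b \in s -> b \subset A, forall b, b \in s -> #|b| = 2,
      forall t, t \in A -> exists2 b, b \in s & t \in b
    & forall b c t, b \in s -> c \in s -> t \in b -> t \in c -> b = c]
  (s \in pairings A).
Proof.
rewrite inE; apply: (iffP andP) => [[/and3P[/eqP cs ts s0] /forall_inP h2]|].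
  split => [b bs|b /h2/eqP//|t tA|b c t bs cs' tb tc].
  - by rewrite -cs; apply: bigcup_sup bs.
  - by move: tA; rewrite -cs => /bigcupP[b]; exists b.
  - by rewrite -(def_pblock ts bs tb) -(def_pblock ts cs' tc).
move=> [sA s2 sc su]; split; last by apply/forall_inP => b /s2 ->.
apply/and3P; split.
- apply/eqP/setP => t; apply/bigcupP/idP => [[b /sA/subsetP bA /bA//]|/sc[b]].
  by exists b.
- apply/trivIsetP => b c bs cs; apply: contraR => /pred0Pn[t /andP[/= tb tc]].
  by apply/eqP; apply: su tc.
- by apply/negP => /s2; rewrite cards0.
Qed.

Lemma pairing_neq0 s A b : s \in pairings A -> b \in s -> exists t, t \in b.
Proof. by move=> /pairingsP[_ h _ _] /h h2; apply/set0Pn; rewrite -card_gt0 h2. Qed.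

Lemma pairings_restrict s A B : s \in pairings A -> B \subset A ->
  (forall b t, b \in s -> t \in b -> t \in B -> b \subset B) ->
  [set b in s | b \subset B] \in pairings B.
Proof.
move=> /pairingsP[h1 h2 h3 h4] BA sat; apply/pairingsP; split.
- by move=> b; rewrite inE => /andP[].
- by move=> b; rewrite inE => /andP[/h2].
- move=> t tB; have [b bs tb] := h3 t (subsetP BA _ tB).
  by exists b; rewrite // inE bs (sat b t).
- by move=> b c t; rewrite !inE => /andP[bs _] /andP[cs _]; apply: h4.
Qed.

Section Sums.
Variables (R : comNzRingType) (K : {set T} -> R).

(** The hafnian of [K] on [A], with [K] read on two-element subsets. *)
Definition pair_sum A := \sum_(s in pairings A) \prod_(b in s) K b.

Lemma pair_sum0 : pair_sum set0 = 1.
Proof.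
rewrite /pair_sum (_ : pairings set0 = [set set0]) ?big_set1 ?big_set0//.
apply/setP => s; rewrite in_set1; apply/pairingsP/eqP => [[h1 h2 _ _]|->].
  apply/setP => b; rewrite !inE; apply/negP => bs.
  by have := h2 _ bs; have := h1 _ bs; rewrite subset0 => /eqP ->; rewrite cards0.
by split => [b|b|t|b c t]; rewrite inE.
Qed.

(** Expansion of the hafnian along [l]: pairings are sorted by the partner [j] of [l], and deleting
    the pair [[set l; j]] is a bijection onto the pairings of [A :\ j]. Wick's formula has the same
    shape, which is how the two get identified. *)
Lemma pair_sumU1 l A : l \notin A ->
  pair_sum (l |: A) = \sum_(j in A) K [set l; j] * pair_sum (A :\ j).
Proof.
move=> lA.
(* The partner of [l] in [s]; [pP] shows that the default [l] is not reached on pairings of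
   [l |: A]. *)
pose p s := odflt l [pick j | (j \in A) && ([set l; j] \in s)].
have pP s : s \in pairings (l |: A) -> (p s \in A) /\ ([set l; p s] \in s).
  move=> /pairingsP[h1 h2 h3 h4]; rewrite /p; case: pickP => [j /andP[]//|no].
  have [b bs lb] := h3 l (setU11 _ _).
  have /eqP/cards2P[x [y [xy be]]] := h2 _ bs.
  wlog lx : x y xy be / l = x.
    move=> W; move: (lb); rewrite be !inE => /orP[]/eqP.
      exact: W xy be.
    by apply: (W y x) => //; rewrite ?(eq_sym y)// setUC.
  have yA : y \in A.
    have : y \in l |: A by apply: (subsetP (h1 _ bs)); rewrite be !inE eqxx orbT.
    by rewrite !inE lx eq_sym (negbTE xy).
  by have := no y; rewrite yA lx -be bs.
rewrite /pair_sum (partition_big p (mem A)) => [|s /pP[]//].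
apply: eq_bigr => j jA'; have {jA'} jA : j \in A := jA'; rewrite big_distrr/=.
have lj : l != j by apply: contraNneq lA => ->.
have pE s : s \in pairings (l |: A) -> (p s == j) = ([set l; j] \in s).
  move=> sP; have [p1 p2] := pP _ sP; apply/eqP/idP => [<-//|js].
  have /pairingsP[h1 h2 h3 h4] := sP.
  have e : [set l; j] = [set l; p s] by apply: (h4 _ _ l) => //; rewrite !inE eqxx.
  have : j \in [set l; p s] by rewrite -e !inE eqxx orbT.
  by rewrite !inE eq_sym (negbTE lj) => /eqP.
rewrite (reindex_onto (fun s => [set l; j] |: s) (fun s => s :\ [set l; j])); last first.
  by move=> s /andP[sP]; rewrite pE// => js; rewrite setD1K.
have key s : ((([set l; j] |: s \in pairings (l |: A)) && (p ([set l; j] |: s) == j))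
    && (([set l; j] |: s) :\ [set l; j] == s)) = (s \in pairings (A :\ j)).
  apply/idP/idP.
    move=> /andP[/andP[sP _] /eqP e].
    have ns : [set l; j] \notin s by rewrite -e !inE eqxx.
    have /pairingsP[h1 h2 h3 h4] := sP.
    have dis b x : b \in s -> x \in b -> (x != l) && (x != j).
      move=> bs xb; rewrite -negb_or; apply: contra ns => /orP xlj.
      rewrite -(h4 b [set l; j] x)// ?inE ?bs ?eqxx ?orbT//.
      by apply/orP.
    apply/pairingsP; split.
    - move=> b bs; apply/subsetP => x xb; have /andP[xl xj] := dis _ _ bs xb.
      have := h1 b; rewrite !inE bs orbT => /(_ isT)/subsetP/(_ _ xb).
      by rewrite !inE (negbTE xl) xj.
    - by move=> b bs; apply: h2; rewrite inE bs orbT.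
    - move=> t; rewrite !inE => /andP[tj tA].
      have [|b] := h3 t; first by rewrite !inE tA orbT.
      rewrite !inE => /orP[/eqP ->|bs tb]; last by exists b.
      by rewrite !inE (negbTE tj) orbF => /eqP tl; rewrite -tl tA in lA.
    - by move=> b c t bs cs; apply: h4; rewrite inE ?bs ?cs orbT.
  move=> sP; have /pairingsP[h1 h2 h3 h4] := sP.
  have dis b x : b \in s -> x \in b -> (x != l) && (x != j).
    move=> bs xb; have := subsetP (h1 _ bs) _ xb; rewrite !inE => /andP[-> xA].
    by rewrite andbT; apply: contraNneq lA => <-.
  have ns : [set l; j] \notin s.
    by apply/negP => js; have := dis _ l js; rewrite !inE eqxx => /(_ isT).
  have sP' : [set l; j] |: s \in pairings (l |: A).
    apply/pairingsP; split.
    - move=> b; rewrite !inE => /orP[/eqP ->|/h1 bA].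
        by apply/subsetP => x; rewrite !inE => /orP[]/eqP ->; rewrite ?eqxx ?jA ?orbT.
      by apply: subset_trans bA _; rewrite (subset_trans (subD1set _ _))// subsetUr.
    - by move=> b; rewrite !inE => /orP[/eqP ->|/h2//]; rewrite cards2 lj.
    - move=> t; rewrite !inE => /orP[/eqP ->|tA].
        by exists [set l; j]; rewrite !inE eqxx.
      have [->|tj] := eqVneq t j; first by exists [set l; j]; rewrite !inE eqxx ?orbT.
      have [|b bs tb] := h3 t; first by rewrite !inE tj.
      by exists b => //; rewrite !inE bs orbT.
    - move=> b c t; rewrite !inE => /orP[/eqP ->|bs] /orP[/eqP ->|cs] tb tc //.
      + have := dis _ _ cs tc; move: tb; rewrite !inE => /orP[]/eqP -> //;
        by rewrite eqxx ?andbF.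
      + have := dis _ _ bs tb; move: tc; rewrite !inE => /orP[]/eqP -> //;
        by rewrite eqxx ?andbF.
      + exact: (h4 _ _ t).
  by rewrite sP' pE// setU11 setU1K//= eqxx.
apply: eq_big => [s|s]; first exact: key.
rewrite key => sP; rewrite big_setU1//=.
have /pairingsP[h1 _ _ _] := sP.
by apply/negP => /h1/subsetP/(_ l); rewrite !inE eqxx (negbTE lA) andbF => /(_ isT).
Qed.

Variables (I : finType) (bl : T -> I).
Implicit Types (X Y : {set I}) (l : I).

Definition blocks X : {set T} := [set t | bl t \in X].

Definition linked s : rel I :=
  fun i j => [exists b in s, (i \in bl @: b) && (j \in bl @: b)].

Definition component s l : {set I} := [set j | connect (linked s) l j].

(** Contribution of the connected diagrams: the pairings whose graph on the blocks in [X] is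
    connected. It turns out to be the cumulant. *)
Definition conn_sum l X :=
  \sum_(s in pairings (blocks X) | component s l == X) \prod_(b in s) K b.

Lemma component_closed s l X : l \in X ->
  (forall b, b \in s -> (exists2 t, t \in b & bl t \in X) -> b \subset blocks X) ->
  component s l \subset X.
Proof.
move=> lX h; apply/subsetP => j; rewrite inE => /connectP[q + ->].
elim: q l lX => //= i q IH l lX /andP[/exists_inP[b bs /andP[/imsetP[t tb tl] /imsetP[u ub ui]]]].
apply: IH; have := h _ bs; rewrite tl in lX.
move=> /(_ (ex_intro2 _ _ t tb lX))/subsetP/(_ _ ub).
by rewrite ui inE.
Qed.

Lemma component_sub s s' l : s \subset s' -> component s l \subset component s' l.
Proof.
move=> ss; apply/subsetP => j; rewrite !inE; apply: connect_sub => x y.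
move=> /exists_inP[b bs h]; apply/connect1/exists_inP; exists b => //.
exact: (subsetP ss).
Qed.

(** A pairing splits uniquely into its pairs over the component [Y] of [l] and its pairs over the
    rest; the first part is connected, the second arbitrary. The outcome has the form of the
    moment-cumulant relation at [l]. *)
Lemma pair_sum_component l X : l \in X ->
  pair_sum (blocks X) =
  \sum_(Y : {set I} | (l \in Y) && (Y \subset X))
     conn_sum l Y * pair_sum (blocks (X :\: Y)).
Proof.
move=> lX; rewrite /pair_sum.
rewrite (partition_big (fun s => component s l)
    (fun Y => (l \in Y) && (Y \subset X))) /=; last first.
  move=> s /pairingsP[h1 _ _ _]; rewrite inE connect0 /=.
  by apply: component_closed => // b /h1.
apply: eq_bigr => Y /andP[lY YX].
rewrite /conn_sum big_distrlr/= pair_big/=.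
pose P (s12 : {set {set T}} * {set {set T}}) := (s12.1 \in pairings (blocks Y)) &&
  (component s12.1 l == Y) && (s12.2 \in pairings (blocks (X :\: Y))).
(* [f] glues the two parts and [g] cuts a pairing along [Y]; [fP] and [gP] show that they are
   inverse to each other. *)
pose f (s12 : {set {set T}} * {set {set T}}) := s12.1 :|: s12.2.
pose g (s : {set {set T}}) := ([set b in s | b \subset blocks Y],
   [set b in s | b \subset blocks (X :\: Y)]).
have disj s1 s2 b c t : s1 \in pairings (blocks Y) ->
    s2 \in pairings (blocks (X :\: Y)) -> b \in s1 -> c \in s2 -> t \in b -> t \in c -> False.
  move=> /pairingsP[h1 _ _ _] /pairingsP[h2 _ _ _] bs cs tb tc.
  have := subsetP (h1 _ bs) _ tb; have := subsetP (h2 _ cs) _ tc.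
  by rewrite !inE => /andP[/negbTE ->].
have fP (s12 : {set {set T}} * {set {set T}}) : P s12 -> [/\ f s12 \in pairings (blocks X),
    component (f s12) l == Y & g (f s12) = s12].
  case: s12 => s1 s2 /andP[/andP[/= s1P /eqP s1c] s2P].
  have /pairingsP[a1 a2 a3 a4] := s1P; have /pairingsP[b1 b2 b3 b4] := s2P.
  split.
  - apply/pairingsP; split.
    + move=> b; rewrite inE => /orP[/a1|/b1] /subsetP h; apply/subsetP => x /h.
        by rewrite !inE; apply: (subsetP YX).
      by rewrite !inE => /andP[].
    + by move=> b; rewrite inE => /orP[/a2|/b2].
    + move=> t; rewrite inE => tX; have [tY|tY] := boolP (bl t \in Y).
        have [|b bs tb] := a3 t; first by rewrite inE.
        by exists b; rewrite // inE bs.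
      have [|b bs tb] := b3 t; first by rewrite !inE tY.
      by exists b; rewrite // inE bs orbT.
    + move=> b c t; rewrite !inE => /orP[bs|bs] /orP[cs|cs] tb tc.
      * exact: (a4 _ _ t).
      * by have := disj _ _ _ _ _ s1P s2P bs cs tb tc.
      * by have := disj _ _ _ _ _ s1P s2P cs bs tc tb.
      * exact: (b4 _ _ t).
  - rewrite eqEsubset; apply/andP; split; last first.
      by rewrite -{1}s1c; apply: component_sub; rewrite subsetUl.
    apply: component_closed => // b; rewrite inE => /orP[/a1//|bs] [t tb tY].
    by have := subsetP (b1 _ bs) _ tb; rewrite !inE tY.
  - congr pair; apply/setP => b; rewrite !inE; apply/idP/idP.
    + move=> /andP[/orP[//|bs] /subsetP bY].
      have [t tb] := pairing_neq0 s2P bs.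
      have := bY _ tb; have := subsetP (b1 _ bs) _ tb.
      by rewrite !inE => /andP[/negbTE ->].
    + by move=> bs; rewrite bs (a1 _ bs).
    + move=> /andP[/orP[bs|//] /subsetP bY].
      have [t tb] := pairing_neq0 s1P bs.
      have := bY _ tb; have := subsetP (a1 _ bs) _ tb.
      by rewrite !inE => ->.
    + by move=> bs; rewrite bs (b1 _ bs) orbT.
have gP s : s \in pairings (blocks X) -> component s l = Y ->
    P (g s) /\ f (g s) = s.
  move=> sP sc; have /pairingsP[a1 a2 a3 a4] := sP.
  have inY b t : b \in s -> t \in b -> bl t \in Y -> b \subset blocks Y.
    move=> bs tb tY; apply/subsetP => u ub; rewrite inE; move: tY.
    rewrite -sc !inE => /connect_trans; apply; apply: connect1.
    by apply/exists_inP; exists b => //; rewrite !imset_f.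
  (* A pair with one end over the component has its other end over it too, so no pair straddles
     [Y]. *)
  have dich b : b \in s -> (b \subset blocks Y) || (b \subset blocks (X :\: Y)).
    move=> bs; have [//|/subsetPn[u ub]] := boolP (b \subset blocks Y).
    rewrite inE => uY; apply/subsetP => t tb; rewrite !inE.
    have := subsetP (a1 _ bs) _ tb; rewrite inE => ->; rewrite andbT.
    apply: contra uY => tY.
    by have := subsetP (inY _ _ bs tb tY) _ ub; rewrite inE.
  split; last first.
    apply/setP => b; rewrite !inE -andb_orr.
    by have [bs|//] := boolP (b \in s); rewrite dich.
  apply/andP; split; [apply/andP; split|]; rewrite /=.
  - apply: pairings_restrict sP _ _ => [|b t bs tb]; last by rewrite inE; exact: inY.
    by apply/subsetP => t; rewrite !inE; exact: (subsetP YX).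
  - rewrite eqEsubset; apply/andP; split.
      by apply: component_closed => // b; rewrite inE => /andP[].
    apply/subsetP => j; rewrite -{1}sc !inE => /connectP[q + ->].
    suff H : forall i0, i0 \in Y -> path (linked s) i0 q ->
        connect (linked [set b in s | b \subset blocks Y]) i0 (last i0 q) by exact: H.
    elim: q => //= i q IH i0 i0Y.
    move=> /andP[/exists_inP[b bs /andP[/imsetP[t tb tl] /imsetP[u ub ui]]] pq].
    have bY : b \subset blocks Y by apply: (inY _ t) => //; rewrite -tl.
    have iY : i \in Y by have := subsetP bY _ ub; rewrite inE -ui.
    apply: (@connect_trans _ _ i); last exact: IH.
    apply: connect1; apply/exists_inP; exists b; rewrite ?inE ?bs//.
    by rewrite tl ui !imset_f.
  - apply: pairings_restrict sP _ _ => [|b t bs tb].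
      by apply/subsetP => t; rewrite !inE => /andP[].
    rewrite !inE => /andP[tY _]; have /orP[|//] := dich _ bs.
    by move=> /subsetP/(_ _ tb); rewrite inE (negbTE tY).
rewrite (reindex_onto f g) /=; last by move=> s /andP[sP /eqP/(gP _ sP)[]].
apply: eq_big => [s12|s12].
  apply/idP/idP; last by move=> /fP[-> -> /= ->]; rewrite eqxx.
  by move=> /andP[/andP[sP /eqP sc] /eqP ge]; have [] := gP _ sP sc; rewrite ge.
move=> /andP[/andP[sP /eqP sc] /eqP ge]; have [] := gP _ sP sc.
rewrite ge => /andP[/andP[s1P _] s2P] _.
rewrite /f (eq_bigl [predU s12.1 & s12.2]); last by move=> b; rewrite !inE.
rewrite bigU//= -setI_eq0; apply/eqP/setP => b; rewrite !inE.
apply/negP => /andP[bs bs2].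
have [t tb] := pairing_neq0 s1P bs.
exact: (disj _ _ _ _ _ s1P s2P bs bs2 tb tb).
Qed.

End Sums.
End Pairings.

(** * The moment-cumulant recursion *)

Section CumulantRecursion.
Variables (I : finType) (l : I).
Implicit Types (A B : {set I}).

Section Def.
Variables (R : comNzRingType) (m : {set I} -> R).

(* The moment-cumulant relation, organised by the block containing l and solved
   for its top term. *)
Fixpoint cum_rec n A : R :=
  if n is n'.+1 then
    m A - \sum_(B : {set I} | (l \in B) && (B \proper A)) cum_rec n' B * m (A :\: B)
  else 0.

(** The recursion on proper subsets is not structural, whence the fuel; [#|I|.+1] exceeds the
    cardinal of every subset. *)
Definition cum A := cum_rec #|I|.+1 A.

Lemma cum_rec_stable n n' A : (#|A| < n)%N -> (#|A| < n')%N -> cum_rec n A = cum_rec n' A.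
Proof.
elim: n n' A => //= n IH [|n'] //= A An An'; congr (_ - _).
apply: eq_bigr => B /andP[_ BA]; congr (_ * _).
by apply: IH; apply: leq_trans (proper_card BA) _.
Qed.

Lemma cumE A :
  cum A = m A - \sum_(B : {set I} | (l \in B) && (B \proper A)) cum B * m (A :\: B).
Proof.
rewrite {1}/cum /=; congr (_ - _); apply: eq_bigr => B /andP[_ BA]; congr (_ * _).
rewrite /cum; apply: cum_rec_stable; last by rewrite ltnS max_card.
by apply: leq_trans (proper_card BA) _; rewrite max_card.
Qed.

End Def.

Lemma card_ind (P : {set I} -> Prop) :
  (forall A, (forall B, B \proper A -> P B) -> P A) -> forall A, P A.
Proof.
move=> h A; have [n] := ubnP #|A|; elim: n A => // n IH A An.
by apply: h => B /proper_card BA; apply: IH; apply: leq_trans BA _.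
Qed.

(** With [m set0 = 1] the term [B = A] of the relation is [c A] itself, so the relation determines
    [c] by induction on [A]. *)
Lemma cum_unique (R : comNzRingType) (m c : {set I} -> R) : m set0 = 1 ->
  (forall A, l \in A -> m A =
     \sum_(B : {set I} | (l \in B) && (B \subset A)) c B * m (A :\: B)) ->
  forall A, l \in A -> cum m A = c A.
Proof.
move=> m0 h; elim/card_ind => A IH lA; rewrite cumE (h _ lA).
rewrite (bigD1 A) ?lA//= setDv m0 mulr1 (eq_bigl (fun B => (l \in B) && (B \proper A))).
  apply/eqP; rewrite subr_eq; apply/eqP; congr (_ + _).
  by apply: eq_bigr => B /andP[lB BA]; rewrite IH.
by move=> B; rewrite -andbA properEneq [(_ != _) && _]andbC.
Qed.

Lemma eq_cum (R : comNzRingType) (m m' : {set I} -> R) A :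
  (forall B, B \subset A -> m B = m' B) -> cum m A = cum m' A.
Proof.
elim/card_ind: A => A IH h; rewrite !cumE h//; congr (_ - _).
apply: eq_bigr => B /andP[_ BA]; rewrite IH// ?h ?subsetDl//.
by move=> C CB; apply: h; apply: subset_trans CB (proper_sub BA).
Qed.

(** [w] is multiplicative along splittings, so every product in the recursion carries the same
    factor [w A]. This serves for powers of i, where [w] depends on the cardinal, and for constants
    attached to the variables. *)
Lemma cum_scale (R : comNzRingType) (m w : {set I} -> R) A :
  (forall B C : {set I}, B \subset C -> w C = w B * w (C :\: B)) ->
  cum (fun B => w B * m B) A = w A * cum m A.
Proof.
move=> wM; elim/card_ind: A => A IH; rewrite !cumE mulrBr; congr (_ - _).
rewrite big_distrr; apply: eq_bigr => B /andP[_ BA] /=; rewrite IH//.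
by rewrite mulrACA -wM// proper_sub.
Qed.

Lemma cum_morph (R S : comNzRingType) (f : {rmorphism R -> S}) (m : {set I} -> R) A :
  cum (f \o m) A = f (cum m A).
Proof.
elim/card_ind: A => A IH; rewrite !cumE rmorphB rmorph_sum; congr (_ - _).
by apply: eq_bigr => B /andP[_ BA]; rewrite IH// rmorphM.
Qed.

(** In each product [cum B * m (A :\: B)] the index [j] occurs in exactly one factor, so the
    cumulant is linear in the variable [j] although it is not linear in [m]. *)
Lemma cum_linear (R : comNzRingType) (a : R) (m1 m2 m3 : {set I} -> R) j :
  (forall B, j \notin B -> m1 B = m3 B) -> (forall B, j \notin B -> m2 B = m3 B) ->
  (forall B, j \in B -> m3 B = a * m1 B + m2 B) ->
  forall A, j \in A -> cum m3 A = a * cum m1 A + cum m2 A.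
Proof.
move=> h1 h2 h3; elim/card_ind => A IH jA; rewrite !cumE h3//.
rewrite mulrBr addrACA -opprD; congr (_ - _).
rewrite big_distrr -big_split; apply: eq_bigr => B /andP[_ BA] /=.
have [jB|jB] := boolP (j \in B).
  rewrite IH// (h1 (A :\: B)) ?(h2 (A :\: B)) ?inE ?jB//.
  by rewrite mulrDl mulrA.
rewrite h3 ?inE ?jB// (eq_cum (m := m1) (m' := m3)); last first.
  by move=> C CB; apply: h1; apply: contra jB; apply: (subsetP CB).
rewrite (eq_cum (m := m2) (m' := m3)); last first.
  by move=> C CB; apply: h2; apply: contra jB; apply: (subsetP CB).
by rewrite mulrDr mulrCA.
Qed.

Lemma cum1 (R : comNzRingType) (m : {set I} -> R) : cum m [set l] = m [set l].
Proof.
rewrite cumE big1 ?subr0// => B /andP[lB /proper_card]; rewrite cards1 ltnS leqn0 cards_eq0.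
by move=> /eqP B0; rewrite B0 inE in lB.
Qed.

(** The proper subsets of [j |: A] are sorted by whether they contain [j]; [A] itself, not proper in
    [A], gives the isolated term with [m [set j]]. The remaining sum has the form that the product
    rule yields in [cderiv_cum]. *)
Lemma cum_setU1 (R : comNzRingType) (m : {set I} -> R) j A : l \in A -> j \notin A ->
  cum m (j |: A) = m (j |: A) - cum m A * m [set j] -
    \sum_(B : {set I} | (l \in B) && (B \proper A))
      (cum m (j |: B) * m (A :\: B) + cum m B * m (j |: (A :\: B))).
Proof.
move=> lA jA; rewrite cumE -addrA -opprD; congr (_ - _).
rewrite (bigID (fun B : {set I} => j \in B)) /= addrC (bigD1 A) /=; last first.
  by rewrite lA jA andbT properE subsetU1 subUset sub1set (negbTE jA).
have -> : (j |: A) :\: A = [set j].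
  by rewrite setDUl setDv setU0; apply/setDidPl; rewrite disjoints1.
rewrite -addrA; congr (_ + _); rewrite big_split /= addrC; congr (_ + _).
  rewrite (reindex_onto (fun B => j |: B) (fun B => B :\ j)) /=; last first.
    by move=> B /andP[_ jB]; rewrite setD1K.
  have key B : (((l \in j |: B) && (j |: B \proper j |: A)) && (j \in j |: B)) &&
      ((j |: B) :\ j == B) = (l \in B) && (B \proper A).
    have lj : l != j by apply: contraNneq jA => <-.
    apply/idP/idP.
      move=> /andP[/andP[/andP[lB pB] _] /eqP e].
      have jB : j \notin B by rewrite -e !inE eqxx.
      move: lB; rewrite !inE (negbTE lj) /= => ->; rewrite properEneq /=.
      apply/andP; split; first by apply: contraTneq pB => ->; rewrite properxx.
      apply/subsetP => x xB; have := subsetP (proper_sub pB) x.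
      by rewrite !inE xB orbT => /(_ isT)/orP[/eqP xj|//]; rewrite -xj xB in jB.
    move=> /andP[lB pB]; have jB : j \notin B by apply: contra jA; apply: (subsetP (proper_sub pB)).
    rewrite setU1K// eqxx setU11 !inE lB orbT /= !andbT properEneq setUS ?proper_sub// andbT.
    apply: contraTneq pB => e.
    have -> : B = A by rewrite -(setU1K jB) e setU1K.
    by rewrite properxx.
  apply: eq_big => B; first exact: key.
  rewrite key => /andP[lB pB]; congr (_ * m _); apply/setP => x; rewrite !inE.
  by case: eqP => // ->; rewrite (negbTE jA) andbF.
apply: eq_big => B.
  apply/idP/idP.
    move=> /andP[/andP[/andP[lB pB] jB] BA]; rewrite lB properEneq BA /=.
    apply/subsetP => x xB; have := subsetP (proper_sub pB) x xB.
    by rewrite !inE => /orP[/eqP xj|//]; rewrite -xj xB in jB.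
  move=> /andP[lB pB]; have jB : j \notin B by apply: contra jA; apply: (subsetP (proper_sub pB)).
  rewrite lB jB /= andbT (proper_sub_trans pB) ?subsetUr//=.
  by apply: contraTneq pB => ->; rewrite properxx.
move=> /andP[/andP[/andP[lB pB] jB] BA]; congr (_ * m _); apply/setP => x; rewrite !inE.
by case: eqP => // ->; rewrite jB.
Qed.

End CumulantRecursion.

(** * Blocks of consecutive indices *)

Section ConsecutiveBlocks.
Variables (k : nat) (n_ : 'I_k -> nat).
Local Notation n := (\sum_(j < k) n_ j)%N.
Implicit Types (s : {set {set 'I_n}}) (b c : {set 'I_n}) (p q t : 'I_n).

Definition block_of t : 'I_k := tagnat.sig1 t.

Definition ragged (A : Type) (F : forall j, 'I_(n_ j) -> A) t : A :=
  F (tag (tagnat.sig t)) (tagged (tagnat.sig t)).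

Lemma ragged_Rank (A : Type) (F : forall j, 'I_(n_ j) -> A) j i :
  ragged F (tagnat.Rank j i) = F j i.
Proof. by rewrite /ragged /tagnat.Rank tagnat.rankK. Qed.

Lemma block_of_Rank j i : block_of (tagnat.Rank j i) = j.
Proof. exact: tagnat.Rank1K. Qed.

Lemma RankP t : exists j i, t = @tagnat.Rank k n_ j i.
Proof. by exists (tagnat.sig1 t), (tagnat.sig2 t); rewrite tagnat.sig2K. Qed.

Lemma Rank_inj j : injective (@tagnat.Rank k n_ j).
Proof.
move=> i i' /(congr1 val)/eqP; rewrite tagnat.eq_Rank eqxx /= => /eqP e.
exact/val_inj.
Qed.

Lemma prod_ragged (R : comNzRingType) (F : forall j, 'I_(n_ j) -> R) (B : {set 'I_k}) :
  \prod_(t in blocks block_of B) ragged F t = \prod_(j in B) \prod_(i < n_ j) F j i.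
Proof.
rewrite sig_big_dep /= (reindex (@tagnat.sig k n_)) /=; last first.
  exact/onW_bij/tagnat.sig_bij.
by apply: eq_bigl => t; rewrite inE andbT.
Qed.

Definition crossing s :=
  [forall b in s, forall p in b, forall q in b, (block_of p == block_of q) ==> (p == q)].

Lemma crossingP s : reflect
  (forall b p q, b \in s -> p \in b -> q \in b -> block_of p = block_of q -> p = q)
  (crossing s).
Proof.
apply: (iffP forall_inP) => [h b p q bs pb qb /eqP e|h b bs].
  by have /forall_inP/(_ p pb)/forall_inP/(_ q qb)/implyP/(_ e)/eqP := h b bs.
apply/forall_inP => p pb; apply/forall_inP => q qb; apply/implyP => /eqP e.
exact/eqP/(h b).
Qed.

Lemma pi_starP c : reflect (exists j, c = [set t | block_of t == j]) (c \in pi_star n_).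
Proof.
have E j : [set tagnat.Rank j i | i : 'I_(n_ j)] = [set t | block_of t == j].
  apply/setP => t; rewrite inE; apply/imsetP/eqP => [[i _ ->]|<-]; first exact: block_of_Rank.
  by exists (tagnat.sig2 t); rewrite // tagnat.sig2K.
apply: (iffP imsetP) => [[j _ ->]|[j ->]]; exists j => //; exact/esym.
Qed.

(** The cells of the meet are the nonempty intersections of a member of [s] with a block; they are
    all singletons when no member of [s] holds two positions of one block. *)
Lemma pmeet_pi_star s : is_partition s -> (pmeet s (pi_star n_) == pbot n) = crossing s.
Proof.
move=> sP; apply/eqP/crossingP => [e b p q bs pb qb pq|h].
  pose c := [set t | block_of t == block_of p].
  have : b :&: c \in pmeet s (pi_star n_).
    rewrite !inE; apply/andP; split.
      by apply/set0Pn; exists p; rewrite !inE pb eqxx.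
    by apply: imset2_f => //; apply/pi_starP; exists (block_of p).
  rewrite e => /imsetP[i _ /setP bci].
  have := bci p; have := bci q; rewrite !inE pb qb pq eqxx /=.
  by move=> /esym/eqP -> /esym/eqP ->.
have cell b c p : b \in s -> c \in pi_star n_ -> p \in b -> p \in c -> b :&: c = [set p].
  move=> bs /pi_starP[j ->] pb; rewrite inE => /eqP pj.
  apply/setP => q; rewrite !inE; apply/andP/eqP => [[qb /eqP qj]|-> ]; last by rewrite pb pj.
  by apply: (h b) => //; rewrite qj.
apply/setP => a; apply/idP/imsetP => [|[p _ ->]].
  move=> /setD1P[/set0Pn[p pa] /imset2P[b c bs cs E]]; move: pa; rewrite E.
  by move=> /setIP[pb pc]; exists p => //; apply: cell.
have [b bs pb] : exists2 b, b \in s & p \in b.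
  by have : p \in cover s; [rewrite (cover_partition sP) inE|move=> /bigcupP[b]; exists b].
have cs : [set t | block_of t == block_of p] \in pi_star n_ by apply/pi_starP; exists (block_of p).
rewrite -(cell _ _ p bs cs pb); last by rewrite inE.
apply/setD1P; split; last exact: imset2_f.
by apply/set0Pn; exists p; rewrite !inE pb /=.
Qed.

Lemma M2_0E s : (s \in M2_0 (pi_star n_)) = (s \in pairings setT) && crossing s.
Proof.
rewrite !inE -/(is_partition s) /is_partition; case sP: (partition s _) => //=.
by rewrite pmeet_pi_star// andbC.
Qed.

Lemma pi_star_partition : (forall j, (0 < n_ j)%N) -> is_partition (pi_star n_).
Proof.
move=> n0; apply/and3P; split.
- apply/eqP/setP => t; rewrite [RHS]inE; apply/bigcupP.
  exists [set u | block_of u == block_of t]; last by rewrite inE.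
  by apply/pi_starP; exists (block_of t).
- apply/trivIsetP => a b /pi_starP[i ->] /pi_starP[j ->]; apply: contraR.
  move=> /pred0Pn[t] /=; rewrite !inE => /andP[/eqP -> /eqP ->]; exact/eqP.
- apply/negP => /pi_starP[j]; move/setP/(_ (tagnat.Rank j (Ordinal (n0 j)))).
  by rewrite !inE block_of_Rank eqxx.
Qed.

(** Positions of one block are already joined by [pi_star], so connectivity of positions projects to
    connectivity of blocks ([up]) and lifts back ([down]). Every block holds a position, so all
    blocks are seen. *)
Lemma pjoin_pi_star s l : (forall j, (0 < n_ j)%N) -> is_partition s ->
  (pjoin s (pi_star n_) == ptop n) = (component block_of s l == setT).
Proof.
move=> n0 sP; have piP := pi_star_partition n0.
set e := fun i j => same_block s i j || same_block (pi_star n_) i j.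
have sym_e : symmetric e.
  move=> i j; rewrite /e.
  have sb v : is_partition v -> same_block v i j = same_block v j i.
    by move=> pv; apply/same_blockP/same_blockP => // -[b bv h]; exists b; rewrite // andbC.
  by rewrite !sb.
have eqR : {in [set: 'I_n] & &, equivalence_rel (connect e)}.
  move=> x y z _ _ _; split; first exact: connect0.
  by move=> xy; apply: (same_connect (sym_connect_sym sym_e)) xy _.
have same_pi p q : same_block (pi_star n_) p q = (block_of p == block_of q).
  apply/same_blockP/eqP => // [[b /pi_starP[j ->]]|pq].
    by rewrite !inE => /andP[/eqP -> /eqP ->].
  exists [set t | block_of t == block_of q]; last by rewrite !inE pq eqxx.
  by apply/pi_starP; exists (block_of q).
have up p q : connect e p q -> connect (linked block_of s) (block_of p) (block_of q).
  move=> /connectP[r rp ->]; elim: r p rp => //= x r IH p /andP[epx xr].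
  apply: connect_trans (IH _ xr); case/orP: epx => [/same_blockP|]; last first.
    by rewrite same_pi => /eqP ->.
  move=> /(_ sP)[b bs /andP[pb xb]]; apply/connect1/exists_inP; exists b => //.
  by rewrite !imset_f.
have down i j : connect (linked block_of s) i j ->
    forall p q, block_of p = i -> block_of q = j -> connect e p q.
  move=> /connectP[r rp ->]; elim: r i rp => [|x r IH] i /=.
    by move=> _ p q pi qi; apply/connect1; rewrite /e same_pi pi qi eqxx orbT.
  move=> /andP[/exists_inP[b bs /andP[/imsetP[t tb ti] /imsetP[u ub ux]]] xr] p q pi qi.
  apply: (connect_trans (y := t)).
    by apply/connect1; rewrite /e same_pi pi ti eqxx orbT.
  apply: (connect_trans (y := u)); last exact: (IH x).
  by apply/connect1/orP; left; apply/same_blockP => //; exists b; rewrite // tb.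
pose p0 := tagnat.Rank l (Ordinal (n0 l)).
have bp0 : block_of p0 = l by exact: block_of_Rank.
have pjE p q : (q \in pblock (pjoin s (pi_star n_)) p) = connect e p q.
  by rewrite pblock_equivalence_partition ?inE.
have [pjP _ _ _] := pjoin_is_sup sP piP.
have triv : trivIset (pjoin s (pi_star n_)) by case/and3P: pjP.
apply/eqP/eqP => h.
  apply/setP => j; rewrite !inE -bp0 -(block_of_Rank (Ordinal (n0 j))); apply: up.
  rewrite -pjE h (def_pblock (B := setT)) ?inE//; first by rewrite -h.
have all_e p q : connect e p q.
  have H r : connect e p0 r.
    apply: (down l (block_of r)) => //.
    by have : block_of r \in component block_of s l; [rewrite h inE|rewrite inE].
  by apply: connect_trans (H q); rewrite (sym_connect_sym sym_e) H.
have ptopE c : c \in pjoin s (pi_star n_) -> c = setT.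
  move=> cj; have /set0Pn[p pc] : c != set0 by apply: contraTneq cj => ->; case/and3P: pjP.
  by apply/setP => q; rewrite inE -(def_pblock triv cj pc) pjE all_e.
apply/setP => c; rewrite inE; apply/idP/eqP => [/ptopE//|->].
have p0j : pblock (pjoin s (pi_star n_)) p0 \in pjoin s (pi_star n_).
  by apply: pblock_mem; rewrite (cover_partition pjP) inE.
by rewrite -(ptopE _ p0j).
Qed.

Lemma M2E l s : (forall j, (0 < n_ j)%N) -> (s \in M2 (pi_star n_)) =
  [&& s \in pairings setT, crossing s & component block_of s l == setT].
Proof.
move=> n0; rewrite !inE -/(is_partition s) /is_partition; case sP: (partition s _) => //=.
rewrite (pjoin_pi_star l)// pmeet_pi_star//.
by case: (component _ _ _ == _); case: crossing; rewrite ?andbF ?andbT.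
Qed.

Lemma card_pairing s : s \in pairings setT -> n = (#|s| * 2)%N.
Proof.
rewrite inE => /andP[sP /forall_inP s2].
by rewrite -(card_uniform_partition (fun b bs => eqP (s2 b bs)) sP) cardsT card_ord.
Qed.

Lemma pairings_odd : odd n -> pairings [set: 'I_n] = set0.
Proof.
move=> on; apply/setP => s; rewrite [RHS]inE; apply/negP => /card_pairing e.
by move: on; rewrite e muln2 odd_double.
Qed.

Section Kernels.
Variables (R : comNzRingType) (K : {set 'I_n} -> R).
Hypothesis K_diag : forall p q, p != q -> block_of p = block_of q -> K [set p; q] = 0.

Lemma prod_not_crossing s : s \in pairings setT -> ~~ crossing s ->
  \prod_(b in s) K b = 0.
Proof.
move=> /pairingsP[_ s2 _ _] /forall_inPn[b bs /forall_inPn[p pb /forall_inPn[q qb]]].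
rewrite negb_imply => /andP[/eqP e pq].
have b2 : b = [set p; q].
  apply/esym/eqP; rewrite eqEcard s2// cards2 pq andbT.
  by apply/subsetP => x; rewrite !inE => /orP[]/eqP ->.
by rewrite (bigD1 b)//= b2 K_diag// mul0r.
Qed.

Lemma pair_sum_M2_0 : pair_sum K setT = \sum_(s in M2_0 (pi_star n_)) \prod_(b in s) K b.
Proof.
rewrite /pair_sum (bigID crossing) /= [X in _ + X]big1 ?addr0.
  by apply: eq_bigl => s; rewrite M2_0E.
by move=> s /andP[sP st]; apply: prod_not_crossing.
Qed.

(** [conn_sum] satisfies the recursion that defines the cumulant, by [pair_sum_component], hence
    equals it. On the full set it runs over the connected pairings, and those that are not crossing
    vanish with the kernel. *)
Lemma cum_pair_sum_M2 l : (forall j, (0 < n_ j)%N) ->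
  cum l (fun B => pair_sum K (blocks block_of B)) setT =
  \sum_(s in M2 (pi_star n_)) \prod_(b in s) K b.
Proof.
move=> n0; rewrite (@cum_unique _ l _ _ (fun B => conn_sum K block_of l B)) ?inE//.
- rewrite /conn_sum (bigID crossing) /= [X in _ + X]big1 ?addr0.
    apply: eq_bigl => s; rewrite (M2E l)// -andbA [(component _ _ _ == _) && _]andbC.
    by congr (_ && _); congr (_ \in pairings _); apply/setP => t; rewrite !inE.
  move=> s /andP[/andP[sP _] st]; apply: prod_not_crossing => //.
  by rewrite (_ : setT = blocks block_of setT)//; apply/setP => t; rewrite !inE.
- rewrite (_ : blocks _ _ = set0) ?pair_sum0//.
  by apply/setP => t; rewrite !inE.
- by move=> A lA; exact: pair_sum_component.
Qed.

End Kernels.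

End ConsecutiveBlocks.

From mathcomp Require Import all_classical all_reals all_analysis.
From mathcomp Require Import measurable_realfun.
From mathcomp Require Import complex.
From mathcomp Require Import ring lra.

Import numFieldNormedType.Exports.

Local Open Scope classical_set_scope.

(** * Square-integrable functions *)

Lemma ae_forall_count d (T : measurableType d) (R : realType) (mu : {measure set T -> \bar R})
    (I : countType) (Q : I -> T -> Prop) :
  (forall i, {ae mu, forall t, Q i t}) -> {ae mu, forall t, forall i, Q i t}.
Proof.
move=> h; have : {ae mu, forall t, forall n, forall i, pickle i = n -> Q i t}.
  apply: ae_foralln => n.
  have [[i <-]|ni] := pselect (exists i : I, pickle i = n).
    by apply: filterS (h i) => t Qt i' /(pcan_inj pickleK) ->.
  by apply/aeW => t i e; exfalso; apply: ni; exists i.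
by apply: filterS => t ht i; exact: (ht _ i erefl).
Qed.

Section SquareIntegrable.
Context d (T : measurableType d) (R : realType) (mu : {measure set T -> \bar R}).
Implicit Types f g h : T -> R.

Definition L1 f := mu.-integrable setT (EFin \o f).
Definition L2 f := measurable_fun setT f /\ L1 (fun x => f x ^+ 2).

Lemma L1_measurable f : L1 f -> measurable_fun setT f.
Proof. by move=> /integrableP[/measurable_EFinP]. Qed.

Lemma eq_L1 f g : f =1 g -> L1 f -> L1 g.
Proof. by move=> /funext ->. Qed.

Lemma L1_le f g : measurable_fun setT f -> L1 g -> (forall x, `|f x| <= g x) -> L1 f.
Proof.
move=> mf ig fg; apply: (le_integrable measurableT _ _ ig).
  exact/measurable_EFinP.
by move=> x _ /=; rewrite lee_fin (le_trans (fg x))// ler_norm.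
Qed.

Lemma L1D f g : L1 f -> L1 g -> L1 (fun x => f x + g x).
Proof.
move=> hf hg; have := integrableD measurableT hf hg.
by apply: eq_integrable => // x _; rewrite /= EFinD.
Qed.

Lemma L1Z (a : R) f : L1 f -> L1 (fun x => a * f x).
Proof.
move=> hf; have := integrableZl measurableT a hf.
by apply: eq_integrable => // x _; rewrite /= EFinM.
Qed.

Lemma L1N f : L1 f -> L1 (fun x => - f x).
Proof. by move=> /(L1Z (-1)); apply: eq_L1 => x; rewrite mulN1r. Qed.

Lemma L1B f g : L1 f -> L1 g -> L1 (fun x => f x - g x).
Proof. by move=> hf /L1N; exact: L1D. Qed.

Lemma L1_norm f : L1 f -> L1 (fun x => `|f x|).
Proof. by move=> hf; have := integrable_abse hf. Qed.

Lemma L1_0 : L1 (fun=> 0).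
Proof. exact: integrable0. Qed.

Lemma L1_sum (I : Type) (s : seq I) (P : pred I) (F : I -> T -> R) :
  (forall i, P i -> L1 (F i)) -> L1 (fun x => \sum_(i <- s | P i) F i x).
Proof.
move=> hF; elim: s => [|i s IH].
  by apply: (eq_L1 _ L1_0) => x; rewrite big_nil.
case: (boolP (P i)) => Pi.
  by apply: (eq_L1 _ (L1D (hF _ Pi) IH)) => x; rewrite big_cons Pi.
by apply: (eq_L1 _ IH) => x; rewrite big_cons (negbTE Pi).
Qed.

Lemma Rint_sum (I : Type) (s : seq I) (P : pred I) (F : I -> T -> R) :
  (forall i, P i -> L1 (F i)) ->
  \int[mu]_x (\sum_(i <- s | P i) F i x) = \sum_(i <- s | P i) \int[mu]_x F i x.
Proof.
move=> hF; elim: s => [|i s IH].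
  under eq_Rintegral do rewrite big_nil.
  by rewrite big_nil Rintegral_cst// mul0r.
rewrite big_cons; under eq_Rintegral do rewrite big_cons.
case: ifPn => // Pi; rewrite RintegralD ?IH//; [exact: hF|exact: L1_sum].
Qed.

Lemma RintZ (a : R) f : L1 f -> \int[mu]_x (a * f x) = a * \int[mu]_x f x.
Proof. exact: RintegralZl. Qed.

Lemma RintD f g : L1 f -> L1 g ->
  \int[mu]_x (f x + g x) = \int[mu]_x f x + \int[mu]_x g x.
Proof. exact: RintegralD. Qed.

Lemma RintB f g : L1 f -> L1 g ->
  \int[mu]_x (f x - g x) = \int[mu]_x f x - \int[mu]_x g x.
Proof. exact: RintegralB. Qed.

Lemma le_Rint f g : L1 f -> L1 g -> (forall x, f x <= g x) ->
  \int[mu]_x f x <= \int[mu]_x g x.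
Proof. by move=> hf hg fg; apply: le_Rintegral => // x _; exact: fg. Qed.

Lemma Rint_ge0 f : (forall x, 0 <= f x) -> 0 <= \int[mu]_x f x.
Proof. by move=> h; apply: Rintegral_ge0. Qed.

Lemma integral_Rint f : L1 f -> (\int[mu]_x (f x)%:E = (\int[mu]_x f x)%:E)%E.
Proof. by move=> hf; rewrite fineK//; exact: integrable_fin_num. Qed.

Lemma ae_eq_Rint f g : measurable_fun setT f -> measurable_fun setT g ->
  f = g %[ae mu] -> \int[mu]_x f x = \int[mu]_x g x.
Proof.
move=> mf mg fg; congr fine; apply: ae_eq_integral => //; try exact/measurable_EFinP.
by move: fg; apply: filterS => x h /= /h ->.
Qed.

Lemma ae_eq_L1 f g : measurable_fun setT g -> f = g %[ae mu] -> L1 f -> L1 g.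
Proof.
move=> mg fg hf; apply/integrableP; split; first exact/measurable_EFinP.
have mf := L1_measurable hf; have /integrableP[_] := hf; apply: le_lt_trans.
rewrite le_eqVlt; apply/orP; left; apply/eqP; apply: ae_eq_integral => //.
- by apply: measurableT_comp => //; exact/measurable_EFinP.
- by apply: measurableT_comp => //; exact/measurable_EFinP.
- by move: fg; apply: filterS => x h /= /h ->.
Qed.

Lemma L2_measurable f : L2 f -> measurable_fun setT f. Proof. by case. Qed.
Lemma L2_sqr f : L2 f -> L1 (fun x => f x ^+ 2). Proof. by case. Qed.

Lemma L2M f g : L2 f -> L2 g -> L1 (fun x => f x * g x).
Proof.
move=> [mf hf] [mg hg]; apply: (@L1_le _ (fun x => f x ^+ 2 + g x ^+ 2)).
- exact: measurable_funM.
- exact: L1D.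
- move=> x; rewrite ler_norml; apply/andP; split; nra.
Qed.

Lemma L2_lin (a : R) f g : L2 f -> L2 g -> L2 (fun x => a * f x + g x).
Proof.
move=> hf hg; have [mf sf] := hf; have [mg sg] := hg; split.
  by apply: measurable_funD => //; apply: measurable_funM.
apply: (@eq_L1 (fun x => a ^+ 2 * f x ^+ 2 + (2 * a) * (f x * g x) + g x ^+ 2)).
  by move=> x; ring.
by apply: L1D => //; apply: L1D; apply: L1Z => //; exact: L2M.
Qed.

Lemma L2_0 : L2 (fun=> 0).
Proof. by split => //; apply: (eq_L1 _ L1_0) => x; rewrite expr0n. Qed.

Lemma L2Z (a : R) f : L2 f -> L2 (fun x => a * f x).
Proof.
move=> hf; have := L2_lin a hf L2_0.
by under eq_fun do rewrite addr0.
Qed.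

Lemma L2D f g : L2 f -> L2 g -> L2 (fun x => f x + g x).
Proof.
move=> hf hg; have := L2_lin 1 hf hg.
by under eq_fun do rewrite mul1r.
Qed.

Lemma L2B f g : L2 f -> L2 g -> L2 (fun x => f x - g x).
Proof.
move=> hf hg; have := L2_lin (-1) hg hf.
by under eq_fun do rewrite mulN1r addrC.
Qed.

Lemma L2_sum (I : Type) (s : seq I) (P : pred I) (F : I -> T -> R) :
  (forall i, P i -> L2 (F i)) -> L2 (fun x => \sum_(i <- s | P i) F i x).
Proof.
move=> hF; elim: s => [|i s IH].
  have := L2_0; congr L2; by apply/funext => x; rewrite big_nil.
case: (boolP (P i)) => Pi.
  have := L2D (hF _ Pi) IH; congr L2; by apply/funext => x; rewrite big_cons Pi.
move: IH; congr L2; by apply/funext => x; rewrite big_cons (negbTE Pi).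
Qed.

Definition nrm2 f := \int[mu]_x (f x ^+ 2).

Lemma nrm2_ge0 f : 0 <= nrm2 f.
Proof. by apply: Rint_ge0 => x; exact: sqr_ge0. Qed.

(** The quadratic polynomial in t given by the integral of (t f + g)^2 is nonnegative; it is
    evaluated at its minimiser when its leading coefficient is positive. *)
Lemma cauchy_schwarz f g : L2 f -> L2 g ->
  (\int[mu]_x (f x * g x)) ^+ 2 <= nrm2 f * nrm2 g.
Proof.
move=> hf hg; set b := \int[mu]_x _.
have hfg := L2M hf hg; have sf := L2_sqr hf; have sg := L2_sqr hg.
have key t : 0 <= t ^+ 2 * nrm2 f + (2 * t) * b + nrm2 g.
  rewrite -!RintZ// -!RintD//; try (by apply: L1Z); last first.
    by apply: L1D; apply: L1Z.
  by apply: Rint_ge0 => x; rewrite (_ : _ + _ = (t * f x + g x) ^+ 2) ?sqr_ge0//; ring.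
have a0 := nrm2_ge0 f.
have [a0'|an0] := eqVneq (nrm2 f) 0.
  have [->|bn0] := eqVneq b 0; first by rewrite expr0n a0' mul0r.
  (* With leading coefficient 0 the polynomial is affine, and this [t] would give it the value
     -1. *)
  have := key (- (nrm2 g + 1) / (2 * b)); rewrite a0' mulr0 add0r.
  by rewrite (_ : _ * b = - (nrm2 g + 1)); [lra|field].
have ap : 0 < nrm2 f by rewrite lt_neqAle eq_sym an0.
have := key (- b / nrm2 f).
rewrite (_ : _ + _ = (nrm2 f * nrm2 g - b ^+ 2) / nrm2 f); last by field.
by rewrite pmulr_lge0 ?invr_gt0// subr_ge0.
Qed.

Lemma nrm2D_le f g : L2 f -> L2 g ->
  nrm2 (fun x => f x + g x) <= 2 * nrm2 f + 2 * nrm2 g.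
Proof.
move=> hf hg; have [mf sf] := hf; have [mg sg] := hg.
rewrite /nrm2 -!RintZ// -RintD//; try exact: L1Z.
apply: le_Rint; first exact: L2_sqr (L2D hf hg).
  by apply: L1D; apply: L1Z.
by move=> x; have := sqr_ge0 (f x - g x); nra.
Qed.

Lemma nrm2Z (a : R) f : L2 f -> nrm2 (fun x => a * f x) = a ^+ 2 * nrm2 f.
Proof.
move=> hf; rewrite /nrm2 -RintZ; last exact: L2_sqr.
by apply: eq_Rintegral => x _; rewrite exprMn.
Qed.

Lemma Lfun2P f : f \in Lfun mu 2%:E <-> L2 f.
Proof.
split=> [hf|[mf hf]].
  split; last exact: Lfun2_integrable_sqr.
  by move: hf; rewrite inE => /andP[]; rewrite inE.
rewrite inE; apply/andP; split; rewrite inE//= /finite_norm unlock.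
apply: poweR_lty; have /integrableP[_] := hf; apply: le_lt_trans.
rewrite le_eqVlt; apply/orP; left; apply/eqP; apply: eq_integral => x _ /=.
by rewrite powR_mulrn// -normrX.
Qed.

Lemma Lnorm2E f : L2 f -> ('N[mu]_2%:E[EFin \o f] = (Num.sqrt (nrm2 f))%:E)%E.
Proof.
move=> [mf hf]; rewrite unlock /=.
rewrite (_ : \int[mu]_x _ = (nrm2 f)%:E)%E; last first.
  rewrite -integral_Rint//; apply: eq_integral => x _ /=.
  by rewrite powR_mulrn// -normrX ger0_norm ?sqr_ge0.
by rewrite poweR_EFin powR12_sqrt// nrm2_ge0.
Qed.

Lemma Lnorm2_cvg0 (u : nat -> T -> R) : (forall p, L2 (u p)) ->
  ('N[mu]_2%:E[EFin \o u p] @[p --> \oo] --> 0)%E <->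
  nrm2 (u p) @[p --> \oo] --> 0.
Proof.
move=> hu; rewrite (_ : (fun p => _) = EFin \o (fun p => Num.sqrt (nrm2 (u p)))); last first.
  by apply/funext => p; rewrite Lnorm2E.
split=> h.
  have {h}h : Num.sqrt (nrm2 (u p)) @[p --> \oo] --> 0.
    exact: (fine_cvg h).
  rewrite (_ : (fun p => _) = (fun p => Num.sqrt (nrm2 (u p)) * Num.sqrt (nrm2 (u p)))).
    by rewrite -[X in _ --> X](mulr0 0); exact: cvgM.
  by apply/funext => p; rewrite -expr2 sqr_sqrtr// nrm2_ge0.
have {}h : Num.sqrt (nrm2 (u p)) @[p --> \oo] --> Num.sqrt (0 : R).
  by apply: (cvg_comp _ _ h); exact: sqrt_continuous.
by rewrite sqrtr0 in h; apply: cvg_EFin => //; apply: nearW.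
Qed.

End SquareIntegrable.

(** * Marginal integrals and contractions *)

Lemma emeasurable_prod d (T : measurableType d) (R : realType) (D : set T)
    (I : Type) (s : seq I) (P : pred I) (h : I -> T -> \bar R) :
  (forall i, measurable_fun D (h i)) ->
  measurable_fun D (fun x => \prod_(i <- s | P i) h i x)%E.
Proof.
move=> mh; elim: s => [|i s IH].
  by under eq_fun do rewrite big_nil; exact: measurable_cst.
under eq_fun do rewrite big_cons; case: (P i) => //.
exact: emeasurable_funM.
Qed.

Lemma measurable_sqrte (R : realType) : measurable_fun setT (@sqrte R).
Proof.
have -> : @sqrte R = (fun x : \bar R => if (x <= 0)%E then 0%E else x `^ 2^-1)%E.
  apply/funext => x; case: ifPn => [x0|].
    case: x x0 => [r||] //=; rewrite ?lee_fin// => r0; first by rewrite ler0_sqrtr.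
  by rewrite -ltNge => /ltW/poweR12_sqrt.
apply: measurable_fun_ifT => //.
- apply: measurable_fun_lee => //.
- exact: measurable_poweR.
Qed.

(** Stated for extended nonnegative functions, because the partial integrals to which it is applied
    may be infinite. The proof integrates F G <= s F^2 + t G^2 for well-chosen weights. *)
Lemma cauchy_schwarz_ereal d (T : measurableType d) (R : realType)
    (mu : {measure set T -> \bar R}) (F G : T -> \bar R) :
  measurable_fun setT F -> measurable_fun setT G ->
  (forall x, 0 <= F x)%E -> (forall x, 0 <= G x)%E ->
  (\int[mu]_x (F x * G x) <=
   sqrte (\int[mu]_x (F x * F x)) * sqrte (\int[mu]_x (G x * G x)))%E.
Proof.
move=> mF mG F0 G0.
have mFF : measurable_fun setT (fun x => F x * F x)%E by exact: emeasurable_funM.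
have mGG : measurable_fun setT (fun x => G x * G x)%E by exact: emeasurable_funM.
have mFG : measurable_fun setT (fun x => F x * G x)%E by exact: emeasurable_funM.
(* If the integral of H^2 vanishes then H = 0 almost everywhere, and so is H K, even where K is
   infinite. *)
have null (H K : T -> \bar R) : measurable_fun setT H -> measurable_fun setT K ->
    (forall x, 0 <= H x)%E -> (\int[mu]_x (H x * H x) = 0)%E ->
    (\int[mu]_x (H x * K x) = 0)%E.
  move=> mH mK H0 h.
  have mHH : measurable_fun setT (fun x => H x * H x)%E by exact: emeasurable_funM.
  have : (\int[mu]_x `|H x * H x| = 0)%E.
    by rewrite -h; apply: eq_integral => x _; rewrite gee0_abs ?mule_ge0.
  move=> /(ae_eq_integral_abs mu measurableT mHH) hae.
  rewrite (@ae_eq_integral _ _ _ mu _ (cst 0%E))//.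
  - by rewrite integral0.
  - exact: emeasurable_funM.
  - move: hae; apply: filterS => x /(_ I) /= e _.
    have -> : H x = 0%E.
      move: e; have := H0 x; case: (H x) => [r _||//]; last by rewrite mulyy.
      by rewrite -EFinM => -[] /eqP; rewrite mulf_eq0 orbb => /eqP ->.
    by rewrite mul0e.
have a0 : (0 <= \int[mu]_x (F x * F x))%E by apply: integral_ge0 => x _; exact: mule_ge0.
have b0 : (0 <= \int[mu]_x (G x * G x))%E by apply: integral_ge0 => x _; exact: mule_ge0.
have [az|an] := eqVneq (\int[mu]_x (F x * F x))%E 0%E.
  by rewrite (null F G)// mule_ge0// sqrte_ge0.
have [bz|bn] := eqVneq (\int[mu]_x (G x * G x))%E 0%E.
  under eq_integral do rewrite muleC.
  by rewrite (null G F)// mule_ge0// sqrte_ge0.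
move aE : (\int[mu]_x (F x * F x))%E a0 an => a a0 an.
move bE : (\int[mu]_x (G x * G x))%E b0 bn => b b0 bn.
have sqp (c : \bar R) : (0 <= c)%E -> c != 0%E -> (0 < sqrte c)%E.
  case: c => [c||]//= c0 cn.
  by rewrite lte_fin sqrtr_gt0 lt_neqAle eq_sym -eqe cn -lee_fin.
case: a aE a0 an => [a||]// aE a0 an; last first.
  by rewrite [X in (_ <= X * _)%E]/= gt0_mulye ?leey// sqp.
case: b bE b0 bn => [b||]// bE b0 bn; last first.
  by rewrite [X in (_ <= _ * X)%E]/= gt0_muley ?leey// sqp.
have ap : 0 < a by rewrite lt_neqAle eq_sym -eqe an.
have bp : 0 < b by rewrite lt_neqAle eq_sym -eqe bn.
set al := Num.sqrt a; set be := Num.sqrt b.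
have alp : 0 < al by rewrite sqrtr_gt0.
have bep : 0 < be by rewrite sqrtr_gt0.
have aal : a = al ^+ 2 by rewrite sqr_sqrtr// ltW.
have bbe : b = be ^+ 2 by rewrite sqr_sqrtr// ltW.
(* With [al] and [be] the two L2 norms, 4 s t = 1 gives the pointwise bound and s al^2 + t be^2 = al
   be gives the right integral. *)
pose s := be / al / 2; pose t := al / be / 2.
have s0 : 0 < s by rewrite !divr_gt0.
have t0 : 0 < t by rewrite !divr_gt0.
apply: (@le_trans _ _ (\int[mu]_x (s%:E * (F x * F x) + t%:E * (G x * G x)))%E).
  apply: ge0_le_integral => //.
  - by move=> x _; exact: mule_ge0.
  - by apply: emeasurable_funD; apply: measurable_funeM.
  - move=> x _; move: (F0 x) (G0 x) => /=.
    move: (F x) (G x) => [f| |] [g| |] // f0 g0.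
    + rewrite -!EFinM -EFinD lee_fin; rewrite !lee_fin in g0 f0.
      have := sqr_ge0 (be * f - al * g).
      have -> : (be * f - al * g) ^+ 2 =
         2 * al * be * (s * (f * f) + t * (g * g) - f * g).
        by rewrite /s /t; field; rewrite !gt_eqF.
      by rewrite pmulr_rge0 ?mulr_gt0// subr_ge0.
    + by rewrite mulyy (gt0_muley (x := t%:E)) ?lte_fin// addey ?leey.
    + by rewrite mulyy (gt0_muley (x := s%:E)) ?lte_fin// addye ?leey.
    + by rewrite mulyy !gt0_muley ?lte_fin ?leey.
rewrite ge0_integralD//; first last.
- exact: measurable_funeM.
- by move=> x _; apply: mule_ge0; [rewrite lee_fin ltW|exact: mule_ge0].
- exact: measurable_funeM.
- by move=> x _; apply: mule_ge0; [rewrite lee_fin ltW|exact: mule_ge0].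
rewrite !ge0_integralZl ?lee_fin ?(ltW s0) ?(ltW t0)//;
  try (by move=> x _; exact: mule_ge0).
rewrite aE bE -!EFinM -EFinD lee_fin aal bbe.
rewrite (_ : _ + _ = al * be); last by rewrite /s /t; field; rewrite !gt_eqF.
by rewrite !sqrtr_sqr !gtr0_norm.
Qed.

Section Marginals.
Context d (T : measurableType d) (R : realType).
Variables (nu : {sigma_finite_measure set T -> \bar R}) (p : nat).
Implicit Types (q r : 'I_p) (x z : T) (y : p.-tuple T) (h : p.-tuple T -> \bar R).
Implicit Types l : seq 'I_p.

Definition upd q x y : p.-tuple T := [tuple if i == q then x else tnth y i | i < p].

Lemma tnth_upd q x y i : tnth (upd q x y) i = if i == q then x else tnth y i.
Proof. by rewrite tnth_mktuple. Qed.

Lemma updC q r x z y : q != r -> upd q x (upd r z y) = upd r z (upd q x y).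
Proof.
move=> qr; apply: eq_from_tnth => i; rewrite !tnth_upd.
by case: eqP => // ->; rewrite (negbTE qr).
Qed.

Lemma upd_upd q x z y : upd q x (upd q z y) = upd q x y.
Proof. by apply: eq_from_tnth => i; rewrite !tnth_upd; case: eqP. Qed.

Lemma measurable_upd d' (S : measurableType d') (f : S -> T) (g : S -> p.-tuple T) q :
  measurable_fun setT f -> measurable_fun setT g ->
  measurable_fun setT (fun s => upd q (f s) (g s)).
Proof.
move=> mf mg; apply/measurable_fun_tnthP => i.
rewrite (_ : _ \o _ = if i == q then f else fun s => tnth (g s) i); last first.
  by apply/funext => s /=; rewrite tnth_upd; case: eqP.
case: eqP => // _.
by apply: (measurableT_comp (measurable_tnth i)).
Qed.

(** The integrated variable stays as a dummy coordinate, so all partial integrals are functions on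
    the same power and compose in any order. *)
Definition marg q h : p.-tuple T -> \bar R := fun y => (\int[nu]_x h (upd q x y))%E.
Definition margs l h := foldr marg h l.

Lemma marg_ge0 q h : (forall y, 0 <= h y)%E -> forall y, (0 <= marg q h y)%E.
Proof. by move=> h0 y; apply: integral_ge0 => x _. Qed.

Lemma measurable_marg q h : measurable_fun setT h -> (forall y, 0 <= h y)%E ->
  measurable_fun setT (marg q h).
Proof.
move=> mh h0; apply: (measurable_fun_fubini_tonelli_G
  (fun z : T * p.-tuple T => h (upd q z.1 z.2))) => //.
by apply: (measurableT_comp mh); exact: measurable_upd.
Qed.

Lemma margC q r h : measurable_fun setT h -> (forall y, 0 <= h y)%E ->
  marg q (marg r h) = marg r (marg q h).
Proof.
move=> mh h0; have [->//|qr] := eqVneq q r; apply/funext => y; rewrite /marg.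
pose g (z : T * T) := h (upd r z.2 (upd q z.1 y)).
have mg : measurable_fun setT g.
  apply: (measurableT_comp mh); apply: measurable_upd => //.
  exact: measurable_upd.
transitivity (\int[nu]_z \int[nu]_x g (x, z))%E.
  by apply: (fubini_tonelli g mg) => z; exact: h0.
apply: eq_integral => z _; apply: eq_integral => x _.
by rewrite /g updC// eq_sym.
Qed.

Lemma margs_ge0 l h : (forall y, 0 <= h y)%E -> forall y, (0 <= margs l h y)%E.
Proof. by move=> h0; elim: l => //= q l IH; exact: marg_ge0. Qed.

Lemma measurable_margs l h : measurable_fun setT h -> (forall y, 0 <= h y)%E ->
  measurable_fun setT (margs l h).
Proof.
by move=> mh h0; elim: l => //= q l IH; apply: measurable_marg => //; exact: margs_ge0.
Qed.

Lemma margs_perm l l' h : measurable_fun setT h -> (forall y, 0 <= h y)%E ->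
  perm_eq l l' -> margs l h = margs l' h.
Proof.
move=> mh h0 ll'.
apply: (catCA_perm_ind (P := fun l' => margs l h = margs l' h) _ ll') => // l1 l2 l3 ->.
rewrite /margs !foldr_cat -/(margs l3 h).
have mg := measurable_margs l3 mh h0; have g0 := margs_ge0 l3 h0.
move: (margs l3 h) mg g0 => g mg g0; rewrite -!/(margs _ _).
elim: l2 => //= q l2 <-.
have mg2 := measurable_margs l2 mg g0; have g20 := margs_ge0 l2 g0.
move: (margs l2 g) mg2 g20 => g2 mg2 g20.
elim: l1 => //= r l1 ->; apply: margC; [exact: measurable_margs|exact: margs_ge0].
Qed.

Lemma le_marg q h h' : measurable_fun setT h -> measurable_fun setT h' ->
  (forall y, 0 <= h y)%E -> (forall y, h y <= h' y)%E ->
  forall y, (marg q h y <= marg q h' y)%E.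
Proof.
move=> mh mh' h0 hh' y; apply: ge0_le_integral => //.
- by apply: (measurableT_comp mh); exact: measurable_upd.
- by apply: (measurableT_comp mh'); exact: measurable_upd.
Qed.

Definition indep q h := forall x y, h (upd q x y) = h y.

Lemma margs_indep q l h : indep q h -> indep q (margs l h).
Proof.
move=> hq; elim: l => //= r l IH x y; rewrite /marg.
apply: eq_integral => z _; have [->|rq] := eqVneq r q; first by rewrite upd_upd.
by rewrite updC// IH.
Qed.

Lemma margs_upd q x l h y : q \notin l ->
  margs l h (upd q x y) = margs l (fun y => h (upd q x y)) y.
Proof.
elim: l y => //= r l IH y; rewrite inE negb_or => /andP[qr ql].
by apply: eq_integral => z _; rewrite updC 1?eq_sym// IH.
Qed.

Variables (k : nat) (S : 'I_k -> pred 'I_p) (h : 'I_k -> p.-tuple T -> \bar R).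
Hypothesis mh : forall j, measurable_fun setT (h j).
Hypothesis h0 : forall j y, (0 <= h j y)%E.
Hypothesis hS : forall j q, ~~ S j q -> indep q (h j).
Hypothesis S2 : forall q, exists a b,
  [/\ a != b, S a q, S b q & forall j, j != a -> j != b -> ~~ S j q].

(* Integrating out one variable q at a time: exactly two factors depend on q, so
   the Cauchy-Schwarz inequality in q alone keeps the product form. *)
Lemma margs_prod_le l y :
  (margs l (fun y => \prod_(j < k) h j y) y <=
   \prod_(j < k) sqrte (margs [seq q <- l | S j q] (fun y => h j y * h j y) y))%E.
Proof.
pose H j l := margs [seq q <- l | S j q] (fun y => h j y * h j y)%E.
have H0 j l' y' : (0 <= H j l' y')%E by apply: margs_ge0 => z; exact: mule_ge0.
have mH j l' : measurable_fun setT (H j l').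
  by apply: measurable_margs => [|z]; [exact: emeasurable_funM|exact: mule_ge0].
have mprod : measurable_fun setT (fun y => \prod_(j < k) h j y)%E.
  exact: emeasurable_prod.
rewrite -/(H _ l _); elim: l y => [|q l IH] y.
  rewrite le_eqVlt; apply/orP; left; apply/eqP; apply: eq_bigr => j _.
  by rewrite /H /= -expe2 sqrte_sqr gee0_abs.
have [a [b [ab Sa Sb Sn]]] := S2 q.
have msq j : measurable_fun setT (fun y => sqrte (H j l y)).
  exact: (measurableT_comp (@measurable_sqrte R)).
apply: (@le_trans _ _ (marg q (fun y => \prod_(j < k) sqrte (H j l y))%E y)).
  apply: le_marg => //.
  - by apply: measurable_margs => // z; apply: prode_ge0 => j _; exact: h0.
  - exact: emeasurable_prod.
  - by apply: margs_ge0 => z; apply: prode_ge0 => j _; exact: h0.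
have bE (F : 'I_k -> \bar R) : (\prod_(j < k) F j = (F a * F b) *
    \prod_(j < k | (j != a) && (j != b)) F j)%E.
  by rewrite (bigD1 a)//= (bigD1 b) 1?eq_sym//= muleA.
rewrite /marg bE; under eq_integral do rewrite bE.
rewrite (eq_integral (fun x => (sqrte (H a l (upd q x y)) * sqrte (H b l (upd q x y))) *
    \prod_(j < k | (j != a) && (j != b)) sqrte (H j (q :: l) y))%E); last first.
  move=> x _; congr (_ * _)%E; apply: eq_bigr => j /andP[ja jb].
  rewrite /H /= (negbTE (Sn _ ja jb)) margs_indep// => u v.
  by rewrite hS// Sn.
have mu2 j : measurable_fun setT (fun x => sqrte (H j l (upd q x y))).
  by apply: (measurableT_comp (msq j)); exact: measurable_upd.
rewrite ge0_integralZr//; first last.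
- by apply: prode_ge0 => j _; exact: sqrte_ge0.
- by move=> x _; rewrite mule_ge0 ?sqrte_ge0.
- exact: emeasurable_funM.
rewrite lee_wpmul2r//; first by apply: prode_ge0 => j _; exact: sqrte_ge0.
apply: le_trans (cauchy_schwarz_ereal nu (mu2 a) (mu2 b) _ _) _;
  try by move=> x; exact: sqrte_ge0.
have e j : S j q -> (\int[nu]_x (sqrte (H j l (upd q x y)) * sqrte (H j l (upd q x y))) =
    H j (q :: l) y)%E.
  move=> Sj; rewrite /H /= Sj; apply: eq_integral => x _.
  by rewrite -expe2 sqr_sqrte//; exact: H0.
by rewrite !e.
Qed.

End Marginals.

(** * Coordinate maps between powers and the contraction inequality *)

Section Pullback.
Context d (T : measurableType d) (R : realType).
Variable nu : {sigma_finite_measure set T -> \bar R}.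

Definition pull p m (e : 'I_m -> 'I_p) (y : p.-tuple T) : m.-tuple T :=
  [tuple tnth y (e i) | i < m].

Lemma measurable_pull p m (e : 'I_m -> 'I_p) : measurable_fun setT (pull e).
Proof.
apply/measurable_fun_tnthP => i; rewrite (_ : _ \o _ = fun y => tnth y (e i)).
  exact: measurable_tnth.
by apply/funext => y /=; rewrite tnth_mktuple.
Qed.

Lemma integral_power_measureS m (F : m.+1.-tuple T -> \bar R) :
  measurable_fun setT F -> (forall y, 0 <= F y)%E ->
  (\int[power_measure nu m.+1]_y F y =
   \int[nu]_x \int[power_measure nu m]_y F (cons_pair (x, y)))%E.
Proof.
move=> mF F0.
have mc := @measurable_cons_pair d T m.
rewrite (eq_measure_integral (pushforward (nu \x power_measure nu m)%E (@cons_pair d T m)))//.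
rewrite ge0_integral_pushforward// preimage_setT fubini_tonelli1//.
  exact: measurableT_comp.
by move=> z; exact: F0.
Qed.

(** Injectivity keeps the coordinates in the image of [e] distinct, so integrating them out one by
    one is the iterated integral that defines the power measure; the induction peels off the first
    one. *)
Lemma margs_pull p m (e : 'I_m -> 'I_p) (F : m.-tuple T -> \bar R) y :
  injective e -> measurable_fun setT F -> (forall y, 0 <= F y)%E ->
  margs nu (map e (enum 'I_m)) (F \o pull e) y = (\int[power_measure nu m]_z F z)%E.
Proof.
elim: m e F y => [|m IH] e F y ie mF F0.
  rewrite /= (_ : enum 'I_0 = [::]) /=; last by apply: size0nil; rewrite size_enum_ord.
  rewrite integral_dirac// diracE mem_set// mul1e.
  by congr F; rewrite [LHS]tuple0 [RHS]tuple0.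
rewrite integral_power_measureS// enum_ordSl /= -map_comp.
apply: eq_integral => x _.
have ie' : injective (e \o lift ord0) by apply: inj_comp => //; exact: lift_inj.
rewrite margs_upd; last first.
  apply/mapP => -[i _] /ie /eqP; rewrite -val_eqE /=.
  by rewrite /bump.
rewrite -(IH (e \o lift ord0) (fun z => F (cons_pair (x, z))) y ie')//; last first.
  apply: (measurableT_comp mF); apply: (measurableT_comp (@measurable_cons_pair _ _ _)).
  exact: measurable_pair1.
congr (margs _ _ _ _); apply/funext => z /=; congr F.
apply: eq_from_tnth => i; rewrite tnth_mktuple tnth_upd.
case: (unliftP ord0 i) => [j|] ->.
  rewrite tnthS tnth_mktuple /= ifF//; apply/eqP => /ie /eqP.
  by rewrite -val_eqE.
by rewrite eqxx.
Qed.

Lemma integral_margs p (h : p.-tuple T -> \bar R) y :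
  measurable_fun setT h -> (forall y, 0 <= h y)%E ->
  (\int[power_measure nu p]_z h z)%E = margs nu (enum 'I_p) h y.
Proof.
move=> mh h0; rewrite -(@margs_pull p p id h y)// map_id; congr (margs _ _ _ _).
by apply/funext => z /=; congr h; apply: eq_from_tnth => i; rewrite tnth_mktuple.
Qed.

Lemma integral_pull_perm p (w : 'I_p -> 'I_p) (F : p.-tuple T -> \bar R) (x0 : T) :
  injective w -> measurable_fun setT F -> (forall y, 0 <= F y)%E ->
  (\int[power_measure nu p]_z F (pull w z) = \int[power_measure nu p]_z F z)%E.
Proof.
move=> iw mF F0; pose y := [tuple x0 | i < p].
rewrite -[RHS](margs_pull y iw)// [LHS](@integral_margs p (F \o pull w) y)//; first last.
- by move=> z; exact: F0.
- exact: (measurableT_comp mF (measurable_pull w)).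
congr (_ y); apply: margs_perm.
- exact: (measurableT_comp mF (measurable_pull w)).
- by move=> z; exact: F0.
apply: uniq_perm => [||i]; [exact: enum_uniq|by rewrite map_inj_uniq// enum_uniq|].
rewrite mem_enum; apply/esym/mapP; have [v _ wv] := injF_bij iw.
by exists (v i); rewrite ?mem_enum// wv.
Qed.

(** By Tonelli the coordinate [a] may be integrated before all others, and the sections of the
    diagonal along it are points. *)
Lemma diagonal_null p (a b : 'I_p) (x0 : T) : a != b ->
  (forall x, measurable [set x] /\ nu [set x] = 0%E) ->
  measurable [set y : p.-tuple T | tnth y a = tnth y b] ->
  power_measure nu p [set y | tnth y a = tnth y b] = 0%E.
Proof.
move=> ab n0 mD; set D := [set y | _] in mD *.
pose y := [tuple x0 | i < p].
have m1 : measurable_fun setT (EFin \o \1_D : p.-tuple T -> \bar R).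
  by apply/measurable_EFinP.
have p1 z : (0 <= (EFin \o \1_D : p.-tuple T -> \bar R) z)%E by rewrite lee_fin.
rewrite -(setIT D) -integral_indic// [LHS](@integral_margs p (EFin \o \1_D) y)//.
(* [foldr] applies the last entry of the list first, hence [a] is moved to the end. *)
have pe : perm_eq (enum 'I_p) (rcons (rem a (enum 'I_p)) a).
  by rewrite perm_sym perm_rcons perm_sym perm_to_rem ?mem_enum.
rewrite (margs_perm _ m1 p1 pe) /margs foldr_rcons.
have -> : marg nu a (EFin \o \1_D) = fun=> 0%E.
  apply/funext => z; have [ms ns] := n0 (tnth z b).
  rewrite /marg -ns -(setIT [set tnth z b]) -integral_indic//; apply: eq_integral => x _ /=; congr EFin.
  rewrite !indicE; congr (nat_of_bool _)%:R; apply/idP/idP; rewrite !inE /D /= !tnth_upd eqxx;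
  by rewrite eq_sym (negbTE ab).
elim: (rem a _) y => //= q l IH z; rewrite /marg.
by under eq_integral do rewrite IH; rewrite integral0.
Qed.

Variables (p k : nat) (n : 'I_k -> nat) (e : forall j, 'I_(n j) -> 'I_p).
Arguments e : clear implicits.
Hypothesis e_inj : forall j, injective (e j).
Hypothesis e2 : forall q, exists a b,
  [/\ a != b, q \in codom (e a), q \in codom (e b)
    & forall j, j != a -> j != b -> q \notin codom (e j)].
Variable f : forall j, (n j).-tuple T -> R.
Hypothesis fL2 : forall j, L2 (power_measure nu (n j)) (@f j).

(** [e j] lists the variables of [f j] among the [p] integration variables, each shared by exactly
    two factors. The estimate is obtained for absolute values first, so integrability and the bound
    come together. *)
Lemma contraction_bound (x0 : T) :
  L1 (power_measure nu p) (fun y => \prod_(j < k) f (pull (e j) y)) /\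
  `|\int[power_measure nu p]_y \prod_(j < k) f (pull (e j) y)| <=
    \prod_(j < k) Num.sqrt (nrm2 (power_measure nu (n j)) (@f j)).
Proof.
pose h j y := (`|f (pull (e j) y)|)%:E.
have mf j : measurable_fun setT (fun y => f (pull (e j) y)).
  by apply: (measurableT_comp (L2_measurable (fL2 j))); exact: measurable_pull.
have mh j : measurable_fun setT (h j).
  by apply/measurable_EFinP; exact: measurableT_comp.
have h0 j y : (0 <= h j y)%E by rewrite lee_fin.
pose y0 := [tuple x0 | i < p].
have sq j : margs nu [seq q <- enum 'I_p | q \in codom (e j)]
    (fun y => h j y * h j y)%E y0 = (nrm2 (power_measure nu (n j)) (@f j))%:E.
  rewrite -integral_Rint; last exact: L2_sqr.
  have m2 : measurable_fun setT (fun z => ((@f j z) ^+ 2)%:E).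
    by apply/measurable_EFinP/measurable_funX/L2_measurable.
  rewrite -(margs_pull y0 (@e_inj j))//; last by move=> z; rewrite lee_fin sqr_ge0.
  rewrite (_ : (fun y => _) = (fun z => ((@f j z) ^+ 2)%:E) \o pull (e j)); last first.
    by apply/funext => y /=; rewrite -EFinM -expr2 real_normK ?num_real.
  congr (_ y0); apply: margs_perm.
  - exact: (measurableT_comp m2 (measurable_pull (e j))).
  - by move=> z; rewrite lee_fin sqr_ge0.
  apply: uniq_perm => [||i].
  - by rewrite filter_uniq// enum_uniq.
  - by rewrite map_inj_uniq ?enum_uniq//; exact: e_inj.
  rewrite mem_filter mem_enum andbT; apply/codomP/mapP => [[x ->]|[x _ ->]].
    by exists x; rewrite ?mem_enum.
  by exists x.
have hi j q : q \notin codom (e j) -> indep q (h j).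
  move=> qj x y; rewrite /h; congr ((`|f _|)%:E).
  apply: eq_from_tnth => i; rewrite tnth_mktuple [RHS]tnth_mktuple tnth_upd ifF//.
  by apply/eqP => ei; move: qj; rewrite -ei codom_f.
have bound := @margs_prod_le _ _ _ nu p k (fun j q => q \in codom (e j)) h mh h0 hi e2
  (enum 'I_p) y0.
have {}bound : (\int[power_measure nu p]_y (`|\prod_(j < k) f (pull (e j) y)|)%:E <=
    (\prod_(j < k) Num.sqrt (nrm2 (power_measure nu (n j)) (@f j)))%:E)%E.
  rewrite -prodEFin; move: bound; under eq_bigr do rewrite sq /=.
  apply: le_trans; rewrite -integral_margs; first last.
  - by move=> y; apply: prode_ge0.
  - exact: emeasurable_prod.
  rewrite le_eqVlt; apply/orP; left; apply/eqP; apply: eq_integral => y _.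
  by rewrite normr_prod -prodEFin.
have i1 : L1 (power_measure nu p) (fun y => \prod_(j < k) f (pull (e j) y)).
  apply/integrableP; split; last by apply: le_lt_trans bound _; rewrite ltry.
  by apply/measurable_EFinP; apply: measurable_prod => j _.
split => //.
rewrite -lee_fin; apply: le_trans bound.
by rewrite [X in (_ <= X)%E](integral_Rint (L1_norm i1)) lee_fin; exact: le_normr_Rintegral.
Qed.

End Pullback.

(** * Density of symmetrized boxes *)

Lemma cvg_dist_lt (R : realType) (u : nat -> R) (l e : R) : u @ \oo --> l -> 0 < e ->
  exists N, forall n, (N <= n)%N -> `|l - u n| < e.
Proof. by move=> /cvgrPdist_lt/[apply] -[N _ hN]; exists N => n /hN. Qed.

Section LinearSpan.
Context (S : Type) (R : realType).

Inductive lspan (B : set (S -> R)) : (S -> R) -> Prop :=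
| lspan0 : lspan B (fun=> 0)
| lspan_cons a f g : B f -> lspan B g -> lspan B (fun x => a * f x + g x).

Lemma lspan_lin B a f g : lspan B f -> lspan B g -> lspan B (fun x => a * f x + g x).
Proof.
move=> + hg; elim=> [|b f' f'' Bf _ IH].
  by under eq_fun do rewrite mulr0 add0r.
rewrite (_ : (fun x => _) = (fun x => (a * b) * f' x + (a * f'' x + g x))).
  exact: lspan_cons.
by apply/funext => x; ring.
Qed.

Lemma lspan_gen B f : B f -> lspan B f.
Proof.
move=> Bf; rewrite (_ : f = (fun x => 1 * f x + 0)).
  by apply: lspan_cons => //; exact: lspan0.
by apply/funext => x; rewrite mul1r addr0.
Qed.

End LinearSpan.

Section L2Closure.
Context d (T : measurableType d) (R : realType) (mu : {measure set T -> \bar R}).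
Variable B : set (T -> R).
Hypothesis BL2 : forall f, B f -> L2 mu f.

Definition dist2 (f g : T -> R) := nrm2 mu (fun x => f x - g x).

Definition L2closure (f : T -> R) := L2 mu f /\
  forall e, 0 < e -> exists2 u, lspan B u & dist2 u f < e.

Lemma lspan_L2 u : lspan B u -> L2 mu u.
Proof. by elim=> [|a f g /BL2 hf _ hg]; [exact: L2_0|exact: L2_lin]. Qed.

Lemma dist2_triangle f g h : L2 mu f -> L2 mu g -> L2 mu h ->
  dist2 f h <= 2 * dist2 f g + 2 * dist2 g h.
Proof.
move=> hf hg hh; apply: le_trans (nrm2D_le (L2B hf hg) (L2B hg hh)).
rewrite le_eqVlt; apply/orP; left; apply/eqP; congr (nrm2 mu _).
by apply/funext => x; ring.
Qed.

Lemma L2closure_gen f : lspan B f -> L2closure f.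
Proof.
move=> hf; split; first exact: lspan_L2.
move=> e e0; exists f => //; rewrite /dist2 (_ : (fun x => _) = fun=> 0).
  by rewrite /nrm2; under eq_Rintegral do rewrite expr0n; rewrite Rintegral_cst// mul0r.
by apply/funext => x; rewrite subrr.
Qed.

Lemma L2closure_lim f : L2 mu f ->
  (forall e, 0 < e -> exists2 g, L2closure g & dist2 g f < e) -> L2closure f.
Proof.
move=> hf h; split => // e e0; have [|g [hg gc] gf] := h (e / 4); first by lra.
have [|u hu ug] := gc (e / 4); first by lra.
exists u => //; apply: le_lt_trans (dist2_triangle (lspan_L2 hu) hg hf) _; lra.
Qed.

Lemma L2closure_lin a f g : L2closure f -> L2closure g ->
  L2closure (fun x => a * f x + g x).
Proof.
move=> [hf cf] [hg cg]; split; first exact: L2_lin.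
(* The 1 keeps [c] positive when [a] is 0, so that [e] can be divided by it. *)
move=> e e0; pose c := 1 + a ^+ 2.
have c0 : 0 < c by rewrite /c; have := sqr_ge0 a; lra.
have [|u hu uf] := cf (e / (4 * c)); first by rewrite divr_gt0// mulr_gt0.
have [|v hv vg] := cg (e / 4); first by lra.
exists (fun x => a * u x + v x); first exact: lspan_lin.
have lu := L2B (lspan_L2 hu) hf; have lv := L2B (lspan_L2 hv) hg.
have := nrm2D_le (L2Z a lu) lv; rewrite nrm2Z// => h.
have a2 : a ^+ 2 * dist2 u f <= c * dist2 u f.
  by apply: ler_wpM2r; [exact: nrm2_ge0|rewrite /c; lra].
have cu : c * dist2 u f < e / 4.
  have -> : e / 4 = c * (e / (4 * c)) by field; rewrite gt_eqF.
  by rewrite ltr_pM2l.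
rewrite /dist2 (_ : (fun x => _) = (fun x => a * (u x - f x) + (v x - g x))).
  by apply: le_lt_trans h _; rewrite /dist2 in a2 cu vg *; lra.
by apply/funext => x; ring.
Qed.

Lemma L2closure_sum (I : Type) (s : seq I) (P : pred I) (F : I -> T -> R) :
  (forall i, P i -> L2closure (F i)) -> L2closure (fun x => \sum_(i <- s | P i) F i x).
Proof.
move=> hF; elim: s => [|i s IH].
  under eq_fun do rewrite big_nil; apply: L2closure_gen; exact: lspan0.
under eq_fun do rewrite big_cons; case: (boolP (P i)) => // Pi.
have := L2closure_lin 1 (hF _ Pi) IH.
by under eq_fun do rewrite mul1r.
Qed.

Lemma L2closure_ae f g : L2 mu g -> f = g %[ae mu] -> L2closure f -> L2closure g.
Proof.
move=> hg fg cf; apply: L2closure_lim => // e e0; exists f => //.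
have -> : dist2 f g = \int[mu]_x (0 : R).
  apply: ae_eq_Rint => //; last first.
    by move: fg; apply: filterS => x h /h ->; rewrite subrr expr0n.
  apply: measurable_funX; apply: measurable_funB; [exact: (L2_measurable cf.1)|].
  exact: (L2_measurable hg).
by rewrite Rintegral_cst// mul0r.
Qed.

Lemma L2_indic A : measurable A -> (mu A < +oo)%E -> L2 mu (\1_A : T -> R).
Proof.
move=> mA Aoo; split; first exact: measurable_indic.
rewrite (_ : (fun x => _) = \1_A); last first.
  by apply/funext => x; rewrite indicE; case: (x \in A); rewrite ?expr0n ?expr1n.
apply/integrableP; split; first exact/measurable_EFinP/measurable_indic.
rewrite (eq_integral (fun x => (\1_A x)%:E)) ?integral_indic ?setIT// => x _.
by rewrite /= ger0_norm.
Qed.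

Lemma nrm2_indic A : measurable A -> nrm2 mu (\1_A : T -> R) = fine (mu A).
Proof.
move=> mA; rewrite /nrm2 /Rintegral; congr fine.
rewrite -[in RHS](setIT A) -integral_indic//; apply: eq_integral => x _.
by rewrite indicE; case: (x \in A); rewrite ?expr0n ?expr1n.
Qed.

Lemma L2closure_indic_bigcup (F : (set T)^nat) :
  (forall n, measurable (F n)) -> nondecreasing_seq F ->
  (mu (\bigcup_n F n) < +oo)%E -> (forall n, L2closure (\1_(F n))) ->
  L2closure (\1_(\bigcup_n F n)).
Proof.
move=> mF ndF Foo cF; set U := \bigcup_n F n in Foo *.
have mU : measurable U by exact: bigcup_measurable.
apply: L2closure_lim; first exact: L2_indic.
move=> e e0; have FU n : F n `<=` U by exact: bigcup_sup.
have Fnoo n : (mu (F n) < +oo)%E by apply: le_lt_trans Foo; rewrite le_measure ?inE.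
have Ufin : mu U \is a fin_num by rewrite ge0_fin_numE.
have h : mu \o F @ \oo --> (fine (mu U))%:E.
  by rewrite fineK//; exact: nondecreasing_cvg_mu.
have [N /(_ N (leqnn _))] := cvg_dist_lt (fine_cvg h) e0.
rewrite /= => hN; exists (\1_(F N)) => //.
rewrite /dist2 /nrm2 (_ : \int[mu]_x _ = nrm2 mu (\1_(U `\` F N) : T -> R)); last first.
  apply: eq_Rintegral => x _; rewrite !indicE in_setD.
  have [xF|xF] := boolP (x \in F N).
    by rewrite (mem_set (FU N x (set_mem xF))) /= subrr.
  by case: (x \in U); rewrite /= ?sub0r ?sqrrN ?subrr.
rewrite nrm2_indic; last exact: measurableD.
have Ffin : mu (F N) \is a fin_num by rewrite ge0_fin_numE.
rewrite measureD// setIidr// fineB//.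
by apply: le_lt_trans hN; exact: ler_norm.
Qed.

Import HBNNSimple.

(** Simple functions increasing to [f] converge to it in L2, since the squared differences are
    dominated by f^2; it remains that their level sets have finite measure. *)
Lemma L2closure_nnfun (f : T -> R) :
  (forall A, measurable A -> (mu A < +oo)%E -> L2closure (\1_A)) ->
  L2 mu f -> (forall x, 0 <= f x) -> L2closure f.
Proof.
move=> hA hf f0; have [mf sf] := hf.
have mEf : measurable_fun setT (EFin \o f) by exact/measurable_EFinP.
pose s n : {nnsfun T >-> R} := nnsfun_approx measurableT mEf n.
have Ef0 x : (setT : set T) x -> (0 <= (EFin \o f) x)%E by rewrite lee_fin.
have sle n x : s n x <= f x.
  by rewrite -lee_fin /s nnsfun_approxE; exact: (le_approx _ Ef0).
have scvg x : s n x @[n --> \oo] --> f x.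
  exact: (fine_cvg (cvg_nnsfun_approx measurableT mEf Ef0 I)).
have ms n : measurable_fun setT (s n) by exact: measurable_funPT.
have s0 n x : 0 <= s n x by exact: fun_ge0.
have Ls n : L2 mu (s n).
  split=> //; apply: (L1_le _ sf); first exact: measurable_funX.
  by move=> x; rewrite ger0_norm ?sqr_ge0// lerXn2r ?nnegrE.
have cs n : L2closure (s n).
  have /funext sE := fimfunEord (s n).
  rewrite [X in L2closure X](_ : _ = (fun x => s n x))// [X in L2closure X]sE.
  apply: L2closure_sum => i _; set r := _`_i; set A := _ @^-1` _.
  have mA : measurable A by rewrite -[A]setTI; exact: ms.
  have [->|r0] := eqVneq r 0.
    by under eq_fun do rewrite mul0r; apply: L2closure_gen; exact: lspan0.
  (* Chebyshev's inequality: on the level set of a nonzero value [r] the indicator equals r^-2 times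
     the square of the simple function. *)
  have lA : L1 mu (fun x => \1_A x : R).
    have hs : L1 mu (fun x => r ^- 2 * (s n x ^+ 2)) by apply: L1Z; case: (Ls n).
    apply: (L1_le _ hs); first exact: measurable_indic.
    move=> x; rewrite ger0_norm// indicE.
    case: (boolP (x \in A)) => [/set_mem ->|_] /=; first by rewrite mulVf// sqrf_eq0.
    by rewrite mulr_ge0 ?invr_ge0 ?sqr_ge0.
  have Aoo : (mu A < +oo)%E.
    have /integrableP[_] := lA; rewrite (eq_integral (fun x => (\1_A x)%:E)) ?integral_indic ?setIT//.
    by move=> x _; rewrite /= ger0_norm.
  have := L2closure_lin r (hA _ mA Aoo) (L2closure_gen (lspan0 B)).
  by under eq_fun do rewrite addr0.
apply: L2closure_lim => // e e0.
pose D n x := ((s n x - f x) ^+ 2)%:E.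
have mD n : measurable_fun setT (D n).
  by apply/measurable_EFinP; apply: measurable_funX; exact: measurable_funB.
have Dcvg : {ae mu, forall x, setT x -> D n x @[n --> \oo] --> 0%E}.
  apply/aeW => x _; rewrite -[X in _ --> X]/(0%:E); apply: cvg_EFin; first exact: nearW.
  rewrite -[X in _ --> X](mulr0 0) /= -(subrr (f x)).
  by apply: cvgM; apply: cvgB => //; exact: cvg_cst.
have Dle : {ae mu, forall x n, setT x -> (`|D n x| <= (f x ^+ 2)%:E)%E}.
  apply/aeW => x n _; rewrite lee_fin ger0_norm ?sqr_ge0//.
  by have := s0 n x; have := sle n x; have := f0 x; nra.
have [_ _ h] := dominated_convergence measurableT mD (measurable_cst 0%E) Dcvg sf Dle.
rewrite integral0 in h; have [N /(_ N (leqnn _))] := cvg_dist_lt (fine_cvg h) e0.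
rewrite sub0r normrN => hN; exists (s N) => //.
by apply: le_lt_trans hN; exact: ler_norm.
Qed.

End L2Closure.

(** [f] is half the difference of the nonnegative functions |f| + f and |f| - f. *)
Lemma L2closure_all d (T : measurableType d) (R : realType)
    (mu : {measure set T -> \bar R}) (B : set (T -> R)) :
  (forall f, B f -> L2 mu f) ->
  (forall A, measurable A -> (mu A < +oo)%E -> L2closure mu B (\1_A)) ->
  forall f, L2 mu f -> L2closure mu B f.
Proof.
move=> BL2 hA f hf; have [mf sf] := hf.
have hn : L2 mu (fun x => `|f x|).
  split; first exact: measurableT_comp.
  by apply: (eq_L1 _ sf) => x; rewrite real_normK ?num_real.
have h1 : L2closure mu B (fun x => `|f x| + f x).
  apply: L2closure_nnfun => //; first exact: L2D.
  by move=> x; have := ler_norm (- f x); rewrite normrN; lra.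
have h2 : L2closure mu B (fun x => `|f x| - f x).
  apply: L2closure_nnfun => //; first exact: L2B.
  by move=> x; have := ler_norm (f x); lra.
have h0 := L2closure_gen BL2 (lspan0 B).
have := L2closure_lin BL2 (2^-1) h1 (L2closure_lin BL2 (- 2^-1) h2 h0).
by congr L2closure; apply/funext => x; field.
Qed.

(** * Boxes with disjoint sides *)

Section Boxes.
Context d (T : measurableType d) (R : realType).
Variables (nu : {sigma_finite_measure set T -> \bar R}) (m : nat).
Local Notation mu := (power_measure nu m).
Implicit Types C D : 'I_m -> set T.

Definition box C : set (m.-tuple T) := [set x | forall i, C i (tnth x i)].

Definition disjoint_box C := (forall i, finite_sets nu (C i)) /\ trivIset setT C.

Definition box_indics : set (m.-tuple T -> R) :=
  [set f | exists2 C, disjoint_box C & f = \1_(box C)].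

Lemma measurable_box C : (forall i, measurable (C i)) -> measurable (box C).
Proof.
move=> mC.
rewrite (_ : box C = \bigcap_(i in [set: 'I_m]) ((fun x => tnth x i) @^-1` C i)).
  apply: fin_bigcap_measurable => // i _.
  by rewrite -[X in measurable X]setTI; exact: measurable_tnth.
by apply/seteqP; split => x /= h i; [move=> _|]; apply: h.
Qed.

Lemma boxI C D : box C `&` box D = box (fun i => C i `&` D i).
Proof.
by apply/seteqP; split => x /=; [case=> hC hD i|move=> h; split=> i; case: (h i)].
Qed.

Lemma box_fin C : (forall i, finite_sets nu (C i)) -> (mu (box C) < +oo)%E.
Proof.
move=> fC; rewrite power_measureE => [|i]; last by case: (fC i).
have : (\prod_(i < m) nu (C i) \is a fin_num)%E.
  by apply: prode_fin_num => i _; rewrite ge0_fin_numE//; case: (fC i).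
by rewrite ge0_fin_numE// prode_ge0.
Qed.

Lemma box_indics_L2 f : box_indics f -> L2 mu f.
Proof.
move=> [C [fC _] ->]; apply: L2_indic; last exact: box_fin.
by apply: measurable_box => i; case: (fC i).
Qed.

Lemma disjoint_boxI C D : (forall i, measurable (C i)) -> disjoint_box D ->
  disjoint_box (fun i => C i `&` D i).
Proof.
move=> mC [fD tD]; split.
  move=> i; have [mD Doo] := fD i; split; first exact: measurableI.
  by apply: le_lt_trans Doo; rewrite le_measure ?inE//; exact: measurableI.
apply/trivIsetP => i j _ _ ij; move/trivIsetP : tD => /(_ i j I I ij) h.
apply/seteqP; split => x // -[[_ Di] [_ Dj]].
by have : (D i `&` D j) x by []; rewrite h.
Qed.

Lemma measurable_boxes A : measurable A ->
  <<s [set B | exists2 C, (forall i, measurable (C i)) & B = box C] >> A.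
Proof.
move=> mA; apply: (sub_sigma_algebra2 _ mA) => {A mA} A.
rewrite -bigcup_seq => -[i _ [B mB <-]].
exists (fun j => if j == i then B else setT) => [j|].
  by case: eqP.
apply/seteqP; split=> x /=; first by move=> [_ Bx] j; case: eqP => // ->.
by move=> /(_ i); rewrite eqxx.
Qed.

Section BoxIntersection.
Variable D : 'I_m -> set T.
Hypothesis dD : disjoint_box D.

(** A Dynkin-class argument inside one disjoint box [D]: boxes are stable under intersection and
    generate the sigma-field, and cutting a box by [D] makes its sides disjoint. The finite measure
    of [D] makes countable unions converge in L2. *)
Lemma L2closure_box_setI A : measurable A -> L2closure mu box_indics (\1_(A `&` box D)).
Proof.
move=> mA.
have mD : measurable (box D) by apply: measurable_box => i; case: (dD.1 i).
have Doo : (mu (box D) < +oo)%E by apply: box_fin; case: dD.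
pose H := [set A | measurable A /\ L2closure mu box_indics (\1_(A `&` box D))].
suff : <<s [set B | exists2 C, (forall i, measurable (C i)) & B = box C] >> `<=` H.
  by move=> /(_ _ (measurable_boxes mA))[].
rewrite -setI_closed_g_dynkin_g_sigma_algebra; last first.
  move=> _ _ [C mC ->] [C' mC' ->]; rewrite boxI; eexists; last reflexivity.
  by move=> i; exact: measurableI.
apply: smallest_sub; last first.
  move=> _ [C mC ->]; split; first exact: measurable_box.
  apply: (L2closure_gen box_indics_L2); apply: lspan_gen.
  by rewrite boxI; eexists; last reflexivity; exact: disjoint_boxI.
have cD : L2closure mu box_indics (\1_(box D)).
  by apply: (L2closure_gen box_indics_L2); apply: lspan_gen; exists D.
split.
- by split=> //; rewrite setTI.
- move=> A' [mA' cA']; split; first exact: measurableC.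
  have := L2closure_lin box_indics_L2 (-1) cA' cD; congr L2closure.
  apply/funext => x; rewrite !indicE !in_setI in_setC.
  by case: (x \in A'); case: (x \in box D); rewrite /=; ring.
- move=> F tF HF; have mF i : measurable (F i) by case: (HF i).
  split; first exact: bigcup_measurable.
  pose W n := (\big[setU/set0]_(i < n) F i) `&` box D.
  have mW n : measurable (W n).
    by apply: measurableI => //; exact: bigsetU_measurable.
  rewrite (_ : \bigcup_k F k `&` box D = \bigcup_n W n); last first.
    apply/seteqP; split=> x.
      by move=> [[k _ Fk] Dx]; exists k.+1 => //; split => //; rewrite -bigcup_mkord; exists k => /=.
    by move=> [n _ [Fx Dx]]; split => //; exact: bigsetU_bigcup Fx.
  apply: (L2closure_indic_bigcup box_indics_L2) => //.
  + move=> n p np; apply/subsetPset => x [Fx Dx]; split => //.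
    by apply: (subset_bigsetU np).
  + apply: le_lt_trans Doo; rewrite le_measure ?inE//.
      exact: bigcup_measurable.
    by move=> x [n _ []].
  + elim=> [|n IH].
      rewrite (_ : \1_(W 0%N) = fun=> 0); last first.
        apply/funext => x; rewrite indicE memNset//.
        by move=> []; rewrite big_ord0.
      by apply: (L2closure_gen box_indics_L2); exact: lspan0.
    have := L2closure_lin box_indics_L2 1 (HF n).2 IH; congr L2closure.
    apply/funext => x; rewrite mul1r !indicE /W big_ord_recr /= !in_setI in_setU.
    have [/set_mem xn|xn] := boolP (x \in F n).
      rewrite (memNset (A := \big[setU/set0]_(i < n) F i)) ?andbF ?orbT ?addr0//.
      rewrite -bigcup_mkord => -[i /= i_n Fi].
      have e : i = n by apply: tF => //; exists x.
      by rewrite e ltnn in i_n.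
    by rewrite orbF /= add0r.
Qed.

End BoxIntersection.

Variable U : nat -> set T.
Hypothesis mU : forall i, measurable (U i).
Hypothesis U_sep : forall x y, x <> y ->
  exists i j, [/\ U i x, U j y & U i `&` U j = set0].

Lemma separated_set1 (x : T) : measurable [set x].
Proof.
rewrite -[[set x]]setCK; apply: measurableC.
rewrite (_ : ~` [set x] = \bigcup_(j in [set j | ~ U j x]) U j).
  by apply: bigcup_measurable.
apply/seteqP; split=> y /=; last by move=> [j /= Ujx Ujy] e; rewrite e in Ujy.
move=> /nesym/U_sep[i [j [Ux Uy dis]]]; exists j => //= Ujx.
by have : (U i `&` U j) x by []; rewrite dis.
Qed.

Lemma measurable_diagonal (a b : 'I_m) :
  measurable [set y : m.-tuple T | tnth y a = tnth y b].
Proof.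
rewrite -(setCK [set y : m.-tuple T | tnth y a = tnth y b]); apply: measurableC.
pose V i j : set (m.-tuple T) :=
  ((fun y => tnth y a) @^-1` U i) `&` ((fun y => tnth y b) @^-1` U j).
rewrite (_ : ~` _ = \bigcup_i \bigcup_(j in [set j | U i `&` U j = set0]) V i j).
  apply: bigcupT_measurable => i; apply: bigcup_measurable => j _.
  by apply: measurableI; rewrite -(setTI (_ @^-1` _)); exact: measurable_tnth.
apply/seteqP; split=> y /=.
  by move=> /U_sep[i [j [Ux Uy dis]]]; exists i => //; exists j.
move=> [i _ [j /= dis [Ux Uy]]] e; rewrite /preimage /= -e in Uy.
by have : (U i `&` U j) (tnth y a) by []; rewrite dis.
Qed.

Hypothesis nu_set1 : forall x, nu [set x] = 0%E.

Lemma ae_injective : {ae mu, forall y, injective (tnth y)}.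
Proof.
have h (n1 n2 : nat) : {ae mu, forall y : m.-tuple T, forall a b : 'I_m,
    a = n1 :> nat -> b = n2 :> nat -> a != b -> tnth y a <> tnth y b}.
  have [n1m|n1m] := ltnP n1 m; last first.
    by apply/aeW => y a b an; move: (ltn_ord a); rewrite an ltnNge n1m.
  have [n2m|n2m] := ltnP n2 m; last first.
    by apply/aeW => y a b _ bn; move: (ltn_ord b); rewrite bn ltnNge n2m.
  pose a0 := Ordinal n1m; pose b0 := Ordinal n2m.
  have [e|ab] := eqVneq a0 b0.
    apply/aeW => y a b an bn /eqP[]; apply/val_inj.
    by rewrite /= an bn; move/(congr1 val) : e.
  have mD := measurable_diagonal a0 b0.
  exists [set y | tnth y a0 = tnth y b0]; split => //.
    have [->|/set0P[y0 _]] := eqVneq [set y : m.-tuple T | tnth y a0 = tnth y b0] set0.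
      by rewrite measure0.
    apply: (diagonal_null (tnth y0 a0)) => // x.
    by split; [exact: separated_set1|exact: nu_set1].
  move=> y /= hy; apply: contrapT => ny; apply: hy => a b an bn _.
  have ea : a = a0 by apply/val_inj.
  have eb : b = b0 by apply/val_inj.
  by move=> e; apply: ny; rewrite /= -ea -eb.
have : {ae mu, forall y, forall n1 n2 : nat, forall a b : 'I_m,
    a = n1 :> nat -> b = n2 :> nat -> a != b -> tnth y a <> tnth y b}.
  by apply: ae_foralln => n1; apply: ae_foralln => n2; exact: h.
apply: filterS => y hy a b yab; apply: contrapT => /eqP ab.
exact: (hy _ _ a b erefl erefl ab yab).
Qed.

Lemma disjoint_box0 : disjoint_box (fun=> set0).
Proof.
split=> [i|]; first by split; rewrite ?measure0.
by apply/trivIsetP => i j _ _ _; rewrite setI0.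
Qed.

(** A point with distinct coordinates lies in a box whose side [a] is cut out by sets separating its
    coordinate [a] from each other one, and by a set of finite measure. Only countably many such
    boxes exist. *)
Lemma disjoint_box_cover : exists D : nat -> 'I_m -> set T,
  (forall n, disjoint_box (D n)) /\ {ae mu, forall y, (\bigcup_n box (D n)) y}.
Proof.
have /sigma_finiteP[F [TF ndF Foo]] := sigma_finiteT nu.
(* A code consists of the rank in a sigma-finite exhaustion and, for each ordered pair (a, b), the
   separating set assigned to side [a] against side [b]. Codes that are not [valid] receive empty
   sides. *)
pose J := (nat * {ffun 'I_m * 'I_m -> nat})%type.
pose side (j : J) (a : 'I_m) := F j.1 `&`
  \bigcap_(b in [set b | b != a]) U (j.2 (a, b)).
pose valid (j : J) := forall a b : 'I_m, a != b -> U (j.2 (a, b)) `&` U (j.2 (b, a)) = set0.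
pose D n : 'I_m -> set T := if unpickle n is Some j then
  (if `[< valid j >] then side j else fun=> set0) else fun=> set0.
exists D; split=> [n|].
  rewrite /D; case: unpickle => [j|]; last exact: disjoint_box0.
  case: asboolP => [vj|_]; last exact: disjoint_box0.
  have [mF Foo'] := Foo j.1.
  have mb a : measurable (\bigcap_(b in [set b | b != a]) U (j.2 (a, b))).
    by apply: fin_bigcap_measurable => //; exact: finite_finset.
  split=> [a|].
    split; first exact: measurableI.
    apply: le_lt_trans Foo'; apply: le_measure; rewrite ?inE//; last exact: subIsetl.
    exact: measurableI.
  apply/trivIsetP => a b _ _ ab; apply/seteqP; split => // x [[_ Ux] [_ Ux']].
  by rewrite -(vj a b ab); split; [apply: Ux; rewrite /= eq_sym|apply: Ux'].
apply: filterS ae_injective => y yinj.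
have {}yinj a b : a != b -> tnth y a <> tnth y b.
  by move=> /eqP ab /yinj.
have /choice[g hg] : forall ab : 'I_m * 'I_m, exists ij : nat * nat, ab.1 != ab.2 ->
    [/\ U ij.1 (tnth y ab.1), U ij.2 (tnth y ab.2) & U ij.1 `&` U ij.2 = set0].
  move=> [a b] /=; have [_|/yinj/U_sep[i [j h]]] := eqVneq a b; first by exists (0, 0)%N.
  by exists (i, j).
have /choice[N hN] : forall a, exists N, F N (tnth y a).
  by move=> a; have : setT (tnth y a) by []; rewrite TF => -[N _]; exists N.
(* The maximum works because [F] is nondecreasing. The pairs (a, b) and (b, a) read the two halves
   of a single choice, made for the increasing order, so the two sets are disjoint. *)
pose j : J := ((\max_(a < m) N a)%N, [ffun ab : 'I_m * 'I_m => if (ab.1 < ab.2)%N then (g ab).1 else (g (ab.2, ab.1)).2]).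
have vj : valid j.
  move=> a b ab; rewrite /j /= !ffunE /=.
  have [ltab|ltba|/val_inj e] := ltngtP a b; last by rewrite e eqxx in ab.
    by have [_ _] := hg (a, b) ab.
  by rewrite setIC; rewrite eq_sym in ab; have [_ _] := hg (b, a) ab.
exists (pickle j) => //; rewrite /D pickleK; case: asboolP => // _ a; split.
  have : (N a <= \max_(a < m) N a)%N by exact: leq_bigmax.
  by move=> /ndF/subsetPset; apply.
move=> b /= ba; rewrite !ffunE /=; have [ltab|ltba|/val_inj e] := ltngtP a b.
- by rewrite eq_sym in ba; have [] := hg (a, b) ba.
- by have [] := hg (b, a) ba.
- by rewrite e eqxx in ba.
Qed.

(** The boxes cover almost all the space. The part of a set in the first n of them is split into
    pieces lying each in one box, and n then grows. *)
Theorem L2closure_disjoint_boxes f : L2 mu f -> L2closure mu box_indics f.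
Proof.
apply: (L2closure_all box_indics_L2) => A mA Aoo.
have [D [dD aeD]] := disjoint_box_cover.
pose W n := \big[setU/set0]_(i < n) box (D i).
have mD n : measurable (box (D n)) by apply: measurable_box => i; case: ((dD n).1 i).
have mW n : measurable (W n) by exact: bigsetU_measurable.
have cW n : forall B, measurable B -> L2closure mu box_indics (\1_(B `&` W n)).
  elim: n => [|n IH] B mB.
    rewrite (_ : \1_(B `&` W 0%N) = fun=> 0); last first.
      apply/funext => x; rewrite indicE memNset//.
      by move=> []; rewrite /W big_ord0.
    by apply: (L2closure_gen box_indics_L2); exact: lspan0.
  have h1 : L2closure mu box_indics (\1_((B `\` W n) `&` box (D n))).
    by apply: L2closure_box_setI => //; exact: measurableD.
  have := L2closure_lin box_indics_L2 1 h1 (IH B mB).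
  have mE x : (x \in (B `\` W n) `&` box (D n)) = [&& x \in B, x \notin W n & x \in box (D n)].
    by rewrite in_setI in_setD andbA.
  congr L2closure; apply/funext => x; rewrite mul1r !indicE mE.
  have -> : W n.+1 = W n `|` box (D n) by rewrite /W big_ord_recr.
  rewrite !in_setI in_setU.
  by case: (x \in B); case: (x \in box (D n)); case: (x \in W n);
    rewrite /= ?addr0 ?add0r.
have mDD : measurable (\bigcup_n box (D n)) by exact: bigcup_measurable.
have cA : L2closure mu box_indics (\1_(\bigcup_n (A `&` W n))).
  apply: (L2closure_indic_bigcup box_indics_L2) => //.
  - by move=> n; exact: measurableI.
  - move=> n p np; apply/subsetPset => x [Ax Wx]; split => //.
    exact: (@subset_bigsetU _ (fun i => box (D i)) n p np).
  - apply: le_lt_trans Aoo; apply: le_measure; rewrite ?inE//.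
      by apply: bigcup_measurable => n _; exact: measurableI.
    by move=> x [n _ []].
  - by move=> n; exact: cW.
apply: (L2closure_ae box_indics_L2) cA; first exact: L2_indic.
apply: filterS aeD => x [n _ Dx] _; rewrite !indicE; congr (nat_of_bool _)%:R.
apply/idP/idP; rewrite !inE; first by move=> [p _ []].
move=> Ax; exists n.+1 => //; split => //.
exact: (@bigsetU_sup _ n n.+1 (fun i => box (D i)) (ltnSn n) x Dx).
Qed.

End Boxes.

Lemma polish_separating (R : realType) (Z : topologicalType) : polish R Z ->
  exists U : nat -> set Z, (forall i, open (U i)) /\
    forall x y, x <> y -> exists i j, [/\ U i x, U j y & U i `&` U j = set0].
Proof.
move=> [[D [/countable_injP[f finj] dD]] [dist [[d0 d1 dC dT] nb _]]].
have ball_open x e : open [set y | dist x y < e].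
  rewrite openE => y /= xy; rewrite /interior nb; exists (e - dist x y).
    by rewrite subr_gt0.
  by move=> z /= yz; have := dT x y z; lra.
(* [n] codes a centre, through the injection [f] of the dense set into the naturals, and a radius;
   the union runs over at most one centre. *)
pose U n := let ab := odflt (0, 0)%N (unpickle n) in
  \bigcup_(d in [set d | D d /\ f d = ab.1]) [set y | dist d y < ab.2.+1%:R^-1].
have close_ball (x : Z) (b : nat) : exists2 n, U n x & exists d, forall y, U n y -> dist d y < b.+1%:R^-1.
  have [|d [xd Dd]] := dD [set y | dist x y < b.+1%:R^-1] _ (ball_open _ _).
    by exists x => /=; rewrite (d1 x x).2.
  exists (pickle (f d, b)); first by rewrite /U pickleK /=; exists d => //=; rewrite dC.
  exists d => y; rewrite /U pickleK /= => -[d' [/= Dd' fd]].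
  by rewrite (finj d' d)// inE.
exists U; split=> [i|x y xy]; first by apply: bigcup_open => d _; exact: ball_open.
have r0 : 0 < dist x y.
  rewrite lt_neqAle d0 andbT eq_sym; apply/eqP => /d1; exact: xy.
have [b hb] : exists b : nat, b.+1%:R^-1 < dist x y / 4.
  have r4 : 0 < dist x y / 4 by rewrite divr_gt0.
  by have [N _ /(_ N (leqnn N))] := near_infty_natSinv_lt (PosNum r4); exists N.
have [i Ui [d hd]] := close_ball x b; have [j Uj [d' hd']] := close_ball y b.
exists i, j; split => //; apply/seteqP; split => // z [/= /hd dz /hd' d'z].
have := hd _ Ui; have := hd' _ Uj => d'y dx.
(* The four legs from [x] through [d], [z] and [d'] to [y] are each shorter than a quarter of the
   distance from [x] to [y]. *)
have h1 := dT x d y; have h2 := dT d z y; have h3 := dT z d' y.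
rewrite (dC x d) in h1; rewrite (dC z d') in h3.
move: (b.+1%:R^-1) hb dz d'z d'y dx => c hb dz d'z d'y dx.
have : dist x y < dist x y by lra.
by rewrite ltxx.
Qed.

(** * Averaging over permutations *)

Section Symmetrization.
Context d (T : measurableType d) (R : realType).
Variables (nu : {sigma_finite_measure set T -> \bar R}) (m : nat) (x0 : T).
Local Notation mu := (power_measure nu m).

Lemma L2_permute (w : 'S_m) f : L2 mu f ->
  L2 mu (fun x => f (permute w x)) /\ nrm2 mu (fun x => f (permute w x)) = nrm2 mu f.
Proof.
move=> [mf sf]; have mp := @measurable_pull _ T _ _ w.
have mfp : measurable_fun setT (fun x => f (permute w x)) by exact: (measurableT_comp mf mp).
have e : (\int[mu]_x ((f (permute w x)) ^+ 2)%:E = \int[mu]_x ((f x) ^+ 2)%:E)%E.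
  apply: (@integral_pull_perm _ _ _ nu m w (fun x => ((f x) ^+ 2)%:E) x0).
  - exact: perm_inj.
  - by apply/measurable_EFinP; exact: measurable_funX.
  - by move=> y; rewrite lee_fin sqr_ge0.
split; last by rewrite /nrm2 /Rintegral e.
split => //; apply/integrableP; split.
  by apply/measurable_EFinP; exact: measurable_funX.
under eq_integral do rewrite gee0_abs ?lee_fin ?sqr_ge0//.
rewrite e; have /integrableP[_] := sf.
by under eq_integral do rewrite gee0_abs ?lee_fin ?sqr_ge0//.
Qed.

Definition sym_box_indics : set (m.-tuple T -> R) :=
  [set f | exists2 C, disjoint_box nu C & f = \1_(sym_box C)].

Lemma sym_boxP (C : 'I_m -> set T) x :
  sym_box C x <-> exists w : 'S_m, forall i, C i (tnth x (w i)).
Proof.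
split=> [[w _ /= h]|[w h]].
  by exists (w^-1)%g => i; rewrite -{1}(permKV w i).
by exists (w^-1)%g => //= i; rewrite -{2}(permKV w i).
Qed.

(** The sides being disjoint, at most one permutation sends a given point into the box. *)
Lemma sum_box_permute (C : 'I_m -> set T) x : trivIset setT C ->
  \sum_(w : 'S_m) \1_(box C) (permute w x) = \1_(sym_box C) x :> R.
Proof.
move=> tC; rewrite [RHS]indicE.
have bP w : (permute w x \in box C) = `[< forall i, C i (tnth x (w i)) >].
  apply/idP/asboolP; rewrite inE => h i; first by have := h i; rewrite tnth_mktuple.
  by rewrite tnth_mktuple.
have [/set_mem/sym_boxP[w hw]|nx] := boolP (x \in sym_box C).
  rewrite (bigD1 w)//= indicE bP asboolT// big1 ?addr0// => w' w'w.
  rewrite indicE bP asboolF// => hw'; move/eqP: w'w; apply; apply/permP => i.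
  have [i' e] : exists i', w i' = w' i by exists (w^-1 (w' i))%g; rewrite permKV.
  rewrite -e; congr (w _); apply: tC => //; exists (tnth x (w i')); split => //.
  by rewrite e.
apply: big1 => w _; rewrite indicE bP asboolF// => h; move/negP: nx; apply.
by apply/mem_set/sym_boxP; exists w.
Qed.

Lemma symmetrize_lspan u : lspan (@box_indics _ _ _ nu m) u ->
  lspan sym_box_indics (fun x => \sum_(w : 'S_m) u (permute w x)).
Proof.
elim=> [|a f g [C dC ->] _ IH].
  rewrite (_ : (fun _ => _) = fun=> 0); first exact: lspan0.
  by apply/funext => x; rewrite big1.
rewrite (_ : (fun _ => _) = fun x => a * \1_(sym_box C) x + \sum_(w : 'S_m) g (permute w x)).
  by apply: lspan_cons => //; exists C.
by apply/funext => x; rewrite big_split /= -mulr_sumr sum_box_permute//; case: dC.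
Qed.

Lemma sym_L2P f : sym_L2 nu f <->
  L2 mu f /\ {ae mu, forall x, forall w : 'S_m, f (permute w x) = f x}.
Proof.
split=> [[/Lfun2P hf sf]|[hf sf]].
  by split => //; apply: ae_forall_count => w; apply: filterS (sf w) => x /(_ I).
split; first exact/Lfun2P.
by move=> w; apply: filterS sf => x h _; exact: h.
Qed.

Lemma sum_sqr_le (I : finType) (a : I -> R) :
  (\sum_i a i) ^+ 2 <= #|I|%:R * \sum_i a i ^+ 2.
Proof.
set A := \sum_i a i; set N : R := #|I|%:R.
have [N0|Np] := posnP #|I|.
  rewrite /A (big_pred0 _ _ _ _ (fun i => _)) ?expr0n; last first.
    by move=> i; have := card0_eq N0 i; rewrite inE.
  by rewrite mulr_ge0// sumr_ge0// => i _; exact: sqr_ge0.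
have : 0 <= \sum_i (N * a i - A) ^+ 2 by apply: sumr_ge0 => i _; exact: sqr_ge0.
have -> : \sum_i (N * a i - A) ^+ 2 = N * (N * (\sum_i a i ^+ 2) - A ^+ 2).
  have e i : (N * a i - A) ^+ 2 = N ^+ 2 * a i ^+ 2 + (- (2 * N * A) * a i + A ^+ 2).
    by ring.
  under eq_bigr do rewrite e.
  rewrite !big_split /= -!mulr_sumr -/A sumr_const -mulr_natl -/N; ring.
by rewrite pmulr_rge0 ?ltr0n// subr_ge0.
Qed.

Variable U : nat -> set T.
Hypothesis mU : forall i, measurable (U i).
Hypothesis U_sep : forall x y, x <> y ->
  exists i j, [/\ U i x, U j y & U i `&` U j = set0].
Hypothesis nu_set1 : forall x, nu [set x] = 0%E.

(** Averaging over permutations fixes [f] almost everywhere and does not increase the L2 norm, since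
    each permutation preserves the measure; it turns an approximation by boxes into one by
    symmetrized boxes. *)
Theorem sym_box_density f e : sym_L2 nu f -> 0 < e ->
  exists2 u, lspan sym_box_indics u & dist2 mu u f < e.
Proof.
move=> /sym_L2P[hf sf] e0.
have [_ /(_ e e0)[u hu uf]] := L2closure_disjoint_boxes mU U_sep nu_set1 hf.
have Lu := lspan_L2 (@box_indics_L2 _ _ _ nu m) hu.
pose N : R := #|[set: 'S_m]%SET|%:R.
have N0 : 0 < N by rewrite ltr0n; apply/card_gt0P; exists 1%g; rewrite inE.
exists (fun x => N^-1 * \sum_(w : 'S_m) u (permute w x)).
  have := lspan_lin N^-1 (symmetrize_lspan hu) (lspan0 _).
  by under eq_fun do rewrite addr0.
apply: le_lt_trans uf.
have hL := L2B Lu hf.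
have Lw (w : 'S_m) := L2_permute w hL.
have Lsum : L2 mu (fun x => N^-1 * \sum_(w : 'S_m) (u (permute w x) - f (permute w x))).
  by apply: L2Z; apply: L2_sum => w _; exact: (Lw w).1.
have -> : dist2 mu (fun x => N^-1 * \sum_(w : 'S_m) u (permute w x)) f =
    nrm2 mu (fun x => N^-1 * \sum_(w : 'S_m) (u (permute w x) - f (permute w x))).
  have Lu' : L2 mu (fun x => N^-1 * \sum_(w : 'S_m) u (permute w x)).
    by apply: L2Z; apply: L2_sum => w _; exact: (L2_permute w Lu).1.
  apply: ae_eq_Rint.
  - by apply: measurable_funX; exact: (L2_measurable (L2B Lu' hf)).
  - by apply: measurable_funX; exact: (L2_measurable Lsum).
  apply: filterS sf => x hx _; congr (_ ^+ 2).
  rewrite big_split /= mulrDr; congr (_ + _).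
  under [in RHS]eq_bigr do rewrite hx.
  rewrite sumr_const -mulr_natl mulrA -cardsT mulVf ?mul1r//.
  exact: lt0r_neq0.
apply: (@le_trans _ _ (\int[mu]_x (N^-1 * \sum_(w : 'S_m) (u (permute w x) - f (permute w x)) ^+ 2))).
  apply: le_Rint.
  - exact: (L2_sqr Lsum).
  - by apply: L1Z; apply: L1_sum => w _; exact: (L2_sqr (Lw w).1).
  move=> x; rewrite exprMn.
  have := sum_sqr_le (fun w : 'S_m => u (permute w x) - f (permute w x)).
  rewrite -cardsT -/N => h.
  apply: le_trans (ler_wpM2l (sqr_ge0 N^-1) h) _.
  by rewrite expr2 -mulrA (mulrA N^-1 N) mulVf ?lt0r_neq0// mul1r.
rewrite RintZ; last by apply: L1_sum => w _; exact: (L2_sqr (Lw w).1).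
rewrite Rint_sum; last by move=> w _; exact: (L2_sqr (Lw w).1).
under eq_bigr do rewrite -/(nrm2 mu _) (Lw _).2.
by rewrite sumr_const -mulr_natl mulrA -cardsT mulVf ?mul1r// lt0r_neq0.
Qed.

End Symmetrization.

(** * The normal law *)

Section CosineIntegrals.
Context d (T : measurableType d) (R : realType) (mu : {measure set T -> \bar R}).
Implicit Types A X Y : T -> R.

Lemma is_derive_cos_affine (a x c t : R) :
  is_derive t 1 (fun t : R => c * cos (a + t * x)) (c * x * cos (a + t * x + pi / 2)).
Proof.
have h : is_derive t 1 (fun t : R => a + t * x) x.
  by apply: is_derive_eq; rewrite scaler0 !add0r mul1r; exact: mulr1.
have h2 := @is_derive1_comp R cos (fun t : R => a + t * x) t _ _ (is_derive_cos (a + t * x)) h.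
have -> : (fun t : R => c * cos (a + t * x)) = c *: (cos \o (fun t : R => a + t * x)).
  by apply/funext.
apply: (is_derive_eq (is_deriveZ c h2)); rewrite cosDpihalf.
by rewrite -[LHS]/(c * (- sin (a + t * x) * x)); ring.
Qed.

Lemma measurable_cos (A : T -> R) : measurable_fun setT A ->
  measurable_fun setT (fun w => cos (A w)).
Proof.
move=> mA; apply: (measurableT_comp _ mA); apply: continuous_measurable_fun.
exact: continuous_cos.
Qed.

Lemma L1_mul_cos Y A : L1 mu Y -> measurable_fun setT A -> L1 mu (fun w => Y w * cos (A w)).
Proof.
move=> hY mA; apply: (L1_le _ (L1_norm hY)).
  by apply: measurable_funM; [exact: L1_measurable hY|exact: measurable_cos].
by move=> w; rewrite normrM ler_piMr// cos_max.
Qed.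

(** Differentiation under the integral, with |Y X| as dominating function. A shifted cosine instead
    of a sine keeps the form of the integral, so the lemma can be iterated. *)
Lemma is_derive_int_cos Y A X (t : R) : measurable_fun setT A -> measurable_fun setT X ->
  L1 mu Y -> L1 mu (fun w => Y w * X w) ->
  is_derive t 1 (fun t : R => \int[mu]_w (Y w * cos (A w + t * X w)))
    (\int[mu]_w (Y w * X w * cos (A w + t * X w + pi / 2))).
Proof.
move=> mA mX hY hYX.
pose f (t : R) w := Y w * cos (A w + t * X w).
have mtX (u : R) : measurable_fun setT (fun w => A w + u * X w).
  by apply: measurable_funD => //; exact: measurable_funM.
have tI : [set` `]t - 1, t + 1[%R] t by rewrite /= in_itv /=; lra.
have d1 u w : partial1of2 f u w = Y w * X w * cos (A w + u * X w + pi / 2).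
  rewrite partial1of2E; have hd := is_derive_cos_affine (A w) (X w) (Y w) u.
  exact: derive_val.
have intf u : [set` `]t - 1, t + 1[%R] u -> mu.-integrable setT (EFin \o f u).
  by move=> _; apply: L1_mul_cos.
have derf u w : [set` `]t - 1, t + 1[%R] u -> setT w -> derivable (f ^~ w) u 1.
  by move=> _ _; have hd := is_derive_cos_affine (A w) (X w) (Y w) u; exact: ex_derive.
have Gub u w : [set` `]t - 1, t + 1[%R] u -> setT w ->
    `|partial1of2 f u w| <= `|Y w * X w|.
  by move=> _ _; rewrite d1 normrM ler_piMr// cos_max.
apply: DeriveDef.
  exact: (derivable_under_integral measurableT tI intf derf _ (L1_norm hYX) Gub).
rewrite -derive1E.
rewrite (differentiation_under_integral measurableT tI intf derf _ (L1_norm hYX) Gub)//.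
by apply: eq_Rintegral => w _; rewrite d1.
Qed.

End CosineIntegrals.

Lemma ge0_integral_density d (T : measurableType d) (R : realType)
    (mu nu : {measure set T -> \bar R}) (g : T -> R) :
  measurable_fun setT g -> (forall x, 0 <= g x) ->
  (forall A, measurable A -> nu A = \int[mu]_(x in A) (g x)%:E)%E ->
  forall f : T -> \bar R, measurable_fun setT f -> (forall x, 0 <= f x)%E ->
  (\int[nu]_x f x = \int[mu]_x (f x * (g x)%:E))%E.
Proof.
Import HBNNSimple.
move=> mg g0 nuE f mf f0.
have mEg : measurable_fun setT (EFin \o g) by exact/measurable_EFinP.
pose h := nnsfun_approx measurableT mf.
have mh n : measurable_fun setT (EFin \o h n).
  by apply/measurable_EFinP; exact: measurable_funPT.
have h0 n x : (0 <= (EFin \o h n) x)%E by rewrite lee_fin.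
have simple (s : {nnsfun T >-> R}) :
    (\int[nu]_x (s x)%:E = \int[mu]_x ((s x)%:E * (g x)%:E))%E.
  have ms : measurable_fun setT s by exact: measurable_funPT.
  have /funext sE := fimfunEord s.
  have mA r : measurable (s @^-1` [set r]) by rewrite -[X in measurable X]setTI; exact: ms.
  under eq_integral => x _ do rewrite sE -sumEFin.
  under [in RHS]eq_integral => x _ do rewrite sE -EFinM mulr_suml -sumEFin.
  have s'0 r x : 0 <= r * \1_(s @^-1` [set r]) x.
    rewrite indicE; case: (boolP (x \in _)) => [/set_mem <-|_]; last by rewrite mulr0.
    by rewrite mulr1.
  rewrite !ge0_integral_sum//; first last.
  - by move=> i x _; rewrite lee_fin.
  - by move=> i; apply/measurable_EFinP; apply: measurable_funM.
  - by move=> i x _; rewrite lee_fin mulr_ge0.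
  - move=> i; apply/measurable_EFinP; apply: measurable_funM => //.
    exact: measurable_funM.
  apply: eq_bigr => i _; set r := _`_i; set A := _ @^-1` _.
  have mA' : measurable A by exact: mA.
  have r0 : (0 <= r) \/ A = set0.
    have [->|/set0P[x Ax]] := eqVneq A set0; first by right.
    by left; rewrite -Ax.
  case: r0 => [r0|->]; last first.
    by rewrite !integral0_eq// => x _; rewrite indicE in_set0 /= mulr0 ?mul0r.
  under eq_integral do rewrite EFinM.
  rewrite ge0_integralZl ?lee_fin//; try (by apply/measurable_EFinP; exact: measurable_indic).
  rewrite integral_indic// setIT nuE//.
  under [in RHS]eq_integral do rewrite -mulrA EFinM.
  rewrite ge0_integralZl ?lee_fin//; try (by move=> x _; rewrite lee_fin mulr_ge0);
    try (by apply/measurable_EFinP; apply: measurable_funM).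
  congr (_ * _)%E; rewrite integral_mkcond; apply: eq_integral => x _.
  by rewrite patchE indicE; case: (x \in A); rewrite ?mul1r ?mul0r.
have fE x : f x = limn (fun n => (EFin \o h n) x).
  by apply/esym/cvg_lim => //; exact: cvg_nnsfun_approx.
have fgE x : (f x * (g x)%:E = limn (fun n => (EFin \o h n) x * (g x)%:E))%E.
  apply/esym/cvg_lim => //; apply: cvgeZr => //.
  exact: cvg_nnsfun_approx.
transitivity (\int[nu]_x limn (fun n => (EFin \o h n) x))%E.
  by apply: eq_integral => x _; exact: fE.
transitivity (\int[mu]_x limn (fun n => (EFin \o h n) x * (g x)%:E))%E; last first.
  by apply: eq_integral => x _; rewrite -fgE.
rewrite !monotone_convergence//.
- by under eq_fun do rewrite simple.
- by move=> n; apply: emeasurable_funM.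
- by move=> n x _; rewrite mule_ge0 ?lee_fin.
- by move=> x _ a b ab; rewrite lee_wpmul2r ?lee_fin//; exact/lefP/nd_nnsfun_approx.
- by move=> x _ a b ab; rewrite lee_fin; exact/lefP/nd_nnsfun_approx.
Qed.

Lemma is_derive_continuous (R : realType) (F f : R -> R) :
  (forall x : R, is_derive x 1 F (f x)) -> continuous F.
Proof.
by move=> dF x; apply/differentiable_continuous/derivable1_diffP; apply: ex_derive.
Qed.

(** The fundamental theorem on growing symmetric intervals: dominated convergence handles the
    integrals, and the boundary terms vanish. *)
Lemma Rint_derivative_eq0 (R : realType) (F f : R -> R) :
  (forall x : R, is_derive x 1 F (f x)) -> continuous f ->
  L1 (@lebesgue_measure R) f ->
  F n%:R @[n --> \oo] --> 0 -> F (- n%:R) @[n --> \oo] --> 0 ->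
  \int[@lebesgue_measure R]_x f x = 0.
Proof.
move=> dF cf lf Fp Fm.
have Fc : continuous F := is_derive_continuous dF.
have ftc n : \int[@lebesgue_measure R]_(x in `[- n.+1%:R, n.+1%:R]) f x =
    F n.+1%:R - F (- n.+1%:R).
  rewrite /Rintegral (@continuous_FTC2 _ f F)//.
  - by rewrite gtrN// ltr0n.
  - exact: continuous_subspaceT.
  - split.
    + by move=> x _; exact: ex_derive.
    + by apply: cvg_at_right_filter; exact: Fc.
    + by apply: cvg_at_left_filter; exact: Fc.
  - by move=> x _; rewrite derive1E; exact: derive_val.
have mf := L1_measurable lf.
pose g n x := (f \_ `[- n.+1%:R, n.+1%:R]) x.
have mI n : measurable (`[- n.+1%:R, n.+1%:R] : set R) by exact: measurable_itv.
have mg n : measurable_fun setT (EFin \o g n).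
  by apply/measurable_EFinP; apply/(measurable_restrictT _ _).1 => //; exact: measurable_funTS.
have gf : {ae (@lebesgue_measure R), forall x, setT x ->
    (EFin \o g n) x @[n --> \oo] --> (EFin \o f) x}.
  apply/aeW => x _; apply: cvg_near_cst.
  near=> n; rewrite /g /= patchE ifT// inE /= in_itv /=.
  have xn : `|x| <= n.+1%:R.
    apply: (@le_trans _ _ n%:R); last by rewrite ler_nat.
    by near: n; exact: nbhs_infty_ger.
  by rewrite -ler_norml.
have gle : {ae (@lebesgue_measure R), forall x n, setT x ->
    (`|(EFin \o g n) x| <= (`|f x|)%:E)%E}.
  apply/aeW => x n _; rewrite /= lee_fin /g patchE; case: ifP => // _.
  by rewrite normr0.
have mEf : measurable_fun setT (EFin \o f) by exact/measurable_EFinP.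
have [_ _ h] := @dominated_convergence _ _ R (@lebesgue_measure R) setT measurableT
  (fun n => EFin \o g n) (EFin \o f) (fun x => (`|f x|)%:E) mg mEf gf (L1_norm lf) gle.
have {h}h : \int[@lebesgue_measure R]_x g n x @[n --> \oo] --> \int[@lebesgue_measure R]_x f x.
  by apply: fine_cvg; rewrite -integral_Rint.
have h0 : \int[@lebesgue_measure R]_x g n x @[n --> \oo] --> (0 : R).
  rewrite (_ : (fun n => _) = (fun n => F n.+1%:R - F (- n.+1%:R))); last first.
    by apply/funext => n; rewrite -ftc [RHS]Rintegral_mkcond.
  rewrite -(subr0 (0 : R)); apply: cvgB.
    by rewrite (cvg_shiftS (fun n => F n%:R)).
  by rewrite (cvg_shiftS (fun n => F (- n%:R))).
exact: (cvg_unique (@Rhausdorff R) h h0).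
Unshelve. all: end_near. Qed.

Lemma expR_pow_le (R : realType) (y : R) p : 0 <= y -> y ^+ p <= p`!%:R * expR y.
Proof.
move=> y0; case: p => [|p]; first by rewrite expr0 mul1r -[leLHS]expR0 ler_expR.
rewrite -ler_pdivrMl ?ltr0n ?fact_gt0//.
by apply: le_trans (expR_ge1Dxn p y0); rewrite mulrC lerDr.
Qed.

(** * Moments, tails and integration by parts for the normal density *)

Section NormalDensity.
Variables (R : realType) (s : R).
Hypothesis s0 : s != 0.
Local Notation leb := (@lebesgue_measure R).
Local Notation pdf := (normal_pdf 0 s).

Let s2 : 0 < s ^+ 2. Proof. by rewrite lt_neqAle eq_sym sqrf_eq0 s0 sqr_ge0. Qed.

Lemma normal_pdf0E x : pdf x = normal_peak s * expR (- x ^+ 2 / (s ^+ 2 *+ 2)).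
Proof. by rewrite normal_pdfE// /normal_fun subr0. Qed.

Lemma is_derive_normal_pdf (x : R) : is_derive x 1 pdf (- (x / s ^+ 2) * pdf x).
Proof.
have -> : pdf = normal_peak s *: (expR \o (fun y : R => - (s ^+ 2 *+ 2)^-1 * (y * y))).
  apply/funext => y; rewrite normal_pdf0E; congr (_ * expR _).
  by rewrite mulrC mulrN mulNr expr2.
have h1 : is_derive x 1 (fun y : R => y * y) (x *: 1 + x *: 1).
  exact: (is_deriveM (is_derive_id x 1) (is_derive_id x 1)).
have h2 := is_deriveZ (- (s ^+ 2 *+ 2)^-1) h1.
have h3 := @is_derive1_comp R expR (fun y : R => - (s ^+ 2 *+ 2)^-1 * (y * y)) x _ _
  (is_derive_expR _) h2.
apply: (is_derive_eq (is_deriveZ (normal_peak s) h3)).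
rewrite /= -[x *: 1]/(x * 1) mulr1.
rewrite -[LHS]/(normal_peak s * (expR (- (s ^+ 2 *+ 2)^-1 * (x * x)) * (- (s ^+ 2 *+ 2)^-1 * (x + x)))).
rewrite -[RHS]/(- (x / s ^+ 2) * (normal_peak s * expR (- (s ^+ 2 *+ 2)^-1 * (x * x)))).
by field; rewrite ?s0.
Qed.

(** Even powers are dominated by a normal density of doubled variance: with y = x^2 / (4 s^2) the
    two exponentials are e^(-2y) and e^(-y), and y^q e^(-y) <= q!. Other powers follow from |x|^p <=
    1 + x^(2p). *)
Lemma normal_pow_L1 p : L1 leb (fun x => `|x| ^+ p * pdf x).
Proof.
have mp : measurable_fun setT pdf by exact: measurable_normal_pdf.
have even q : L1 leb (fun x => (x ^+ 2) ^+ q * pdf x).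
  pose s' := Num.sqrt 2 * s.
  have s'0 : s' != 0 by rewrite mulf_neq0// gt_eqF// sqrtr_gt0.
  have s'2 : s' ^+ 2 = 2 * s ^+ 2 by rewrite exprMn sqr_sqrtr.
  pose C := (4 * s ^+ 2) ^+ q * q`!%:R * normal_peak s / normal_peak s'.
  have pk := normal_peak_gt0 s0; have pk' := normal_peak_gt0 s'0.
  apply: (L1_le _ (L1Z C (integrable_normal_pdf 0 s'))).
    by apply: measurable_funM => //; apply: measurable_funX; apply: measurable_funX.
  move=> x; rewrite ger0_norm; last by rewrite mulr_ge0 ?normal_pdf_ge0// exprn_ge0// sqr_ge0.
  rewrite normal_pdf0E normal_pdfE// /normal_fun subr0 s'2.
  pose y := x ^+ 2 / (4 * s ^+ 2).
  have y0 : 0 <= y by rewrite divr_ge0 ?sqr_ge0// mulr_ge0 ?sqr_ge0.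
  have -> : x ^+ 2 = (4 * s ^+ 2) * y by rewrite /y; field; rewrite ?s0.
  have -> : - (4 * s ^+ 2 * y) / (s ^+ 2 *+ 2) = - y + - y by field; rewrite ?s0.
  have -> : - (4 * s ^+ 2 * y) / (2 * s ^+ 2 *+ 2) = - y by field; rewrite ?s0.
  rewrite expRD exprMn.
  have -> : C * (normal_peak s' * expR (- y)) =
      (4 * s ^+ 2) ^+ q * q`!%:R * normal_peak s * expR (- y).
    by rewrite /C; field; rewrite gt_eqF.
  have h := expR_pow_le q y0.
  have h' : y ^+ q * expR (- y) <= q`!%:R.
    have -> : q`!%:R = q`!%:R * expR y * expR (- y) :> R.
      by rewrite -mulrA -expRD subrr expR0 mulr1.
    by rewrite ler_pM2r// expR_gt0.
  have -> : (4 * s ^+ 2) ^+ q * y ^+ q * (normal_peak s * (expR (- y) * expR (- y))) =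
    (4 * s ^+ 2) ^+ q * normal_peak s * expR (- y) * (y ^+ q * expR (- y)) by ring.
  have -> : (4 * s ^+ 2) ^+ q * q`!%:R * normal_peak s * expR (- y) =
    (4 * s ^+ 2) ^+ q * normal_peak s * expR (- y) * q`!%:R by ring.
  apply: ler_wpM2l h'.
  by rewrite !mulr_ge0 ?expR_ge0 ?exprn_ge0 ?(ltW pk)// mulr_ge0// ltW.
apply: (L1_le _ (L1D (even 0%N) (even p))).
  apply: measurable_funM => //; apply: measurable_funX.
  exact: normr_measurable.
move=> x; rewrite expr0 mul1r ger0_norm ?mulr_ge0 ?exprn_ge0 ?normal_pdf_ge0//.
have -> : pdf x + (x ^+ 2) ^+ p * pdf x = (1 + (`|x| ^+ p) ^+ 2) * pdf x.
  by rewrite mulrDl mul1r [X in _ = _ + X * _]exprAC real_normK ?num_real.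
apply: ler_wpM2r; first exact: normal_pdf_ge0.
by set a := `|x| ^+ p; have := sqr_ge0 (a - 1); have := sqr_ge0 a; nra.
Qed.

(** With y = n^2 / (2 s^2), the bound e^(-y) <= 1 / (1 + y) is combined with n + 1 <= 2 + n^2 = 2 +
    2 s^2 y <= (2 + 2 s^2) (1 + y). *)
Lemma normal_pdf_tail (x : R) n : `|x| = n%:R -> pdf x <= (2 + 2 * s ^+ 2) * normal_peak s * n.+1%:R^-1.
Proof.
move=> xn; rewrite normal_pdf0E.
have -> : x ^+ 2 = n%:R ^+ 2 by rewrite -xn real_normK ?num_real.
have pk := normal_peak_gt0 s0.
pose y : R := n%:R ^+ 2 / (s ^+ 2 *+ 2).
have y0 : 0 <= y by rewrite divr_ge0 ?sqr_ge0// mulrn_wge0// sqr_ge0.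
have -> : - n%:R ^+ 2 / (s ^+ 2 *+ 2) = - y by rewrite mulNr.
rewrite expRN; have e1 := expR_ge1Dx y.
have ep : 0 < expR y by exact: expR_gt0.
rewrite -(mulrC (normal_peak s)) -mulrA ler_pM2l//.
rewrite ler_pdivlMr ?ltr0n// mulrC ler_pdivrMr//.
have ny : n%:R ^+ 2 = 2 * s ^+ 2 * y by rewrite /y; field; rewrite ?s0.
have nn : (0 : R) <= n%:R by [].
have n1 : n.+1%:R <= 2 + n%:R ^+ 2 :> R.
  by rewrite -natr1; have := sqr_ge0 (n%:R - 1 : R); nra.
apply: (le_trans n1); rewrite ny.
apply: (@le_trans _ _ ((2 + 2 * s ^+ 2) * (1 + y))); last first.
  by rewrite ler_pM2l//; rewrite addr_gt0// mulr_gt0.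
have := s2; nra.
Qed.

Lemma stein_normal (a t : R) :
  \int[leb]_x (x * cos (a + t * x) * pdf x) =
  s ^+ 2 * t * \int[leb]_x (cos (a + t * x + pi / 2) * pdf x).
Proof.
have maff (b : R) : measurable_fun setT (fun x : R => a + t * x + b).
  by apply: measurable_funD => //; apply: measurable_funD => //; apply: measurable_funM.
have L := normal_pow_L1.
have La : L1 leb (fun x => x * pdf x).
  apply: (L1_le _ (L 1%N)).
    by apply: measurable_funM => //; exact: measurable_normal_pdf.
  by move=> x; rewrite expr1 normrM [`|pdf x|]ger0_norm ?normal_pdf_ge0.
have Lb : L1 leb pdf by apply: (eq_L1 _ (L 0%N)) => x; rewrite expr0 mul1r.
have L1' : L1 leb (fun x => x * cos (a + t * x) * pdf x).
  apply: (eq_L1 _ (L1_mul_cos La (maff 0))) => x; rewrite addr0; ring.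
have L2' : L1 leb (fun x => cos (a + t * x + pi / 2) * pdf x).
  by apply: (eq_L1 _ (L1_mul_cos Lb (maff (pi / 2)))) => x; ring.
apply/eqP; rewrite -subr_eq0 -RintZ// -RintB//; last exact: L1Z.
have dcos (b x : R) : is_derive x 1 (fun x : R => cos (a + t * x + b))
    (t * cos (a + t * x + b + pi / 2)).
  have := is_derive_cos_affine (a + b) t 1 x; rewrite (_ : (fun _ => _) = (fun y => cos (a + t * y + b))).
    by move=> h; apply: (is_derive_eq h); rewrite mul1r; congr (_ * cos _); ring.
  by apply/funext => y /=; rewrite mul1r; congr cos; ring.
(* An antiderivative of the difference of the two integrands, because the derivative of [pdf] is -
   (x / s^2) [pdf]. *)
apply/eqP; pose F x := - s ^+ 2 * (cos (a + t * x) * pdf x).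
have tail (u : nat -> R) : (forall n, `|u n| = n%:R) -> F (u n) @[n --> \oo] --> 0.
  move=> un; apply: norm_cvg0.
  pose K := s ^+ 2 * ((2 + 2 * s ^+ 2) * normal_peak s).
  have hK : K * n.+1%:R^-1 @[n --> \oo] --> (0 : R).
    by rewrite -(mulr0 K); apply: cvgMl_tmp; exact: cvg_harmonic.
  apply: (squeeze_cvgr _ (cvg_cst (0 : R)) hK).
  apply: nearW => n; rewrite normr_ge0 /= /F normrM normrN (ger0_norm (ltW s2)).
  rewrite /K -mulrA ler_pM2l// normrM [`|pdf _|]ger0_norm ?normal_pdf_ge0//.
  apply: le_trans (normal_pdf_tail (un n)).
  by rewrite ler_piMl ?normal_pdf_ge0// cos_max.
apply: (@Rint_derivative_eq0 R F (fun x => x * cos (a + t * x) * pdf x -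
  s ^+ 2 * t * (cos (a + t * x + pi / 2) * pdf x))).
- move=> x; have hm := is_deriveM (dcos 0 x) (is_derive_normal_pdf x).
  have FE : F = - s ^+ 2 *: ((fun y : R => cos (a + t * y + 0)) * pdf).
    by apply/funext => y; rewrite /F -[in LHS](addr0 (a + t * y)).
  rewrite FE; apply: (is_derive_eq (is_deriveZ (- s ^+ 2) hm)).
  rewrite -[LHS]/(- s ^+ 2 * (cos (a + t * x + 0) * (- (x / s ^+ 2) * pdf x) +
    pdf x * (t * cos (a + t * x + 0 + pi / 2)))) !addr0.
  by field; rewrite ?s0.
- have cpdf : continuous pdf := is_derive_continuous is_derive_normal_pdf.
  have c1 : continuous (fun x => cos (a + t * x)).
    rewrite (_ : (fun x => _) = (fun x => cos (a + t * x + 0))).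
      exact: (is_derive_continuous (dcos 0)).
    by apply/funext => y; rewrite addr0.
  have c2 : continuous (fun x => cos (a + t * x + pi / 2)) := is_derive_continuous (dcos (pi / 2)).
  move=> x; apply: cvgB.
    by apply: cvgM (cpdf x); apply: cvgM (c1 x); exact: cvg_id.
  by apply: cvgM; [exact: cvg_cst|apply: cvgM (cpdf x); exact: c2].
- by apply: L1B => //; exact: L1Z.
- by apply: tail => n; rewrite normr_nat.
- by apply: tail => n; rewrite normrN normr_nat.
Qed.

End NormalDensity.

(** * Variables with a normal law *)

Section GaussianVariable.
Context d (T : measurableType d) (R : realType) (P : probability T R).
Variable X : T -> R.
Hypothesis mX : measurable_fun setT X.

Lemma L1_cst (c : R) : L1 P (fun=> c).
Proof. exact: finite_measure_integrable_cst. Qed.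

Lemma Rint_cst (c : R) : \int[P]_w c = c.
Proof. by rewrite Rintegral_cst//= probability_setT mulr1. Qed.

Section NonDegenerate.
Variable s : R.
Hypothesis s0 : s != 0.
Hypothesis law : forall A, measurable A -> P (X @^-1` A) = normal_prob 0 s A.
Local Notation leb := (@lebesgue_measure R).
Local Notation pdf := (normal_pdf 0 s).

Lemma ge0_integral_normal_law (G : R -> \bar R) : measurable_fun setT G ->
  (forall x, 0 <= G x)%E -> (\int[P]_w G (X w) = \int[leb]_x (G x * (pdf x)%:E))%E.
Proof.
move=> mG G0.
have mp : measurable_fun setT pdf by exact: measurable_normal_pdf.
rewrite -(@ge0_integral_density _ _ R leb (normal_prob 0 s) pdf mp)//; last first.
  by move=> x; exact: normal_pdf_ge0.
rewrite [RHS](eq_measure_integral (pushforward P (X : T -> measurableTypeR R))); last by move=> A mA _; exact: (esym (law mA)).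
by rewrite ge0_integral_pushforward.
Qed.

Lemma normal_law_integral (g : R -> R) : measurable_fun setT g ->
  L1 leb (fun x => g x * pdf x) ->
  L1 P (fun w => g (X w)) /\ \int[P]_w g (X w) = \int[leb]_x (g x * pdf x).
Proof.
move=> mg /[dup] L /integrableP[_ Loo].
have p0 x : 0 <= pdf x by exact: normal_pdf_ge0.
have mEg : measurable_fun setT (EFin \o g) by exact/measurable_EFinP.
split.
  apply/integrableP; split.
    by apply/measurable_EFinP; exact: measurableT_comp.
  rewrite (@ge0_integral_normal_law (fun x => `|g x|%:E))//.
    apply: le_lt_trans Loo; rewrite le_eqVlt; apply/orP; left; apply/eqP.
    by apply: eq_integral => x _; rewrite /= normrM (ger0_norm (p0 x)) EFinM.
  by apply/measurable_EFinP; exact: measurableT_comp.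
rewrite /Rintegral integralE [in RHS]integralE; congr (fine (_ - _)%E).
- transitivity (\int[P]_w ((EFin \o g)^\+%E (X w)))%E.
    by apply: eq_integral => w _; rewrite !funeposE.
  rewrite ge0_integral_normal_law//; last exact: measurable_funepos.
  apply: eq_integral => x _; rewrite !funeposE /= -EFin_max -EFinM -EFin_max.
  by rewrite maxr_pMl// mul0r.
- transitivity (\int[P]_w ((EFin \o g)^\-%E (X w)))%E.
    by apply: eq_integral => w _; rewrite !funenegE.
  rewrite ge0_integral_normal_law//; last exact: measurable_funeneg.
  apply: eq_integral => x _; rewrite !funenegE /= -?EFin_max -EFinM -?EFin_max.
  by rewrite maxr_pMl// mul0r mulNr.
Qed.

Lemma normal_law_moments p : L1 P (fun w => `|X w| ^+ p).
Proof.
apply: (normal_law_integral (g := fun x => `|x| ^+ p) _ (normal_pow_L1 s0 p)).1.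
by apply: measurable_funX; exact: normr_measurable.
Qed.

Let LX : L1 P X.
Proof. by apply: (L1_le _ (normal_law_moments 1)) => // w; rewrite expr1. Qed.

Let LXX : L1 P (fun w => X w * X w).
Proof.
apply: (eq_L1 _ (normal_law_moments 2)) => w; rewrite real_normK ?num_real//.
Qed.

Lemma stein_normal_law (a t : R) :
  \int[P]_w (X w * cos (a + t * X w)) = s ^+ 2 * t * \int[P]_w cos (a + t * X w + pi / 2).
Proof.
have L := normal_pow_L1 s0.
have mid : measurable_fun setT (fun x : R => x) by exact: measurable_id.
have maff (b : R) : measurable_fun setT (fun x : R => cos (a + t * x + b)).
  apply: measurable_cos; apply: measurable_funD; last exact: measurable_cst.
  apply: measurable_funD; first exact: measurable_cst.
  apply: measurable_funM; [exact: measurable_cst|exact: measurable_id].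
have maff0 : measurable_fun setT (fun x : R => cos (a + t * x)).
  by apply: (eq_measurable_fun _ _ (maff 0)) => x _; rewrite addr0.
rewrite (normal_law_integral (g := fun x => x * cos (a + t * x)) _ _).2; first last.
- apply: (L1_le _ (L 1%N)).
    apply: measurable_funM; first exact: measurable_funM.
    exact: measurable_normal_pdf.
  move=> x; rewrite expr1 !normrM [`|pdf x|]ger0_norm ?normal_pdf_ge0//.
  by rewrite ler_wpM2r ?normal_pdf_ge0// ler_piMr// cos_max.
- exact: measurable_funM.
rewrite (normal_law_integral (g := fun x => cos (a + t * x + pi / 2)) _ _).2; first last.
- apply: (L1_le _ (L 0%N)).
    by apply: measurable_funM; [exact: maff|exact: measurable_normal_pdf].
  move=> x; rewrite expr0 mul1r normrM [`|pdf x|]ger0_norm ?normal_pdf_ge0//.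
  by rewrite ler_piMl ?normal_pdf_ge0// cos_max.
- exact: maff.
exact: stein_normal.
Qed.

(** At phase -pi/2 the integration by parts reads E[X sin(tX)] = s^2 t E[cos(tX)]; both sides are
    differentiated at t = 0. *)
Lemma normal_law_variance : \int[P]_w (X w ^+ 2) = s ^+ 2.
Proof.
have h1 := @is_derive_int_cos _ T R P X (fun=> - (pi / 2)) X 0
  (measurable_cst _) mX LX LXX.
have h2 := @is_derive_int_cos _ T R P (fun=> 1) (fun=> - (pi / 2) + pi / 2) X 0
  (measurable_cst _) mX (L1_cst 1) (eq_L1 (fun w => esym (mul1r (X w))) LX).
have h3 : is_derive (0 : R) 1 (fun t : R => s ^+ 2 * t) (s ^+ 2).
  have h := is_deriveZ (s ^+ 2) (is_derive_id (0 : R^o) (1 : R^o)).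
  rewrite (_ : (fun t : R => s ^+ 2 * t) = s ^+ 2 *: (id : R^o -> R^o)) //.
  by apply: (is_derive_eq h); exact: mulr1.
have h4 := is_deriveM h3 h2.
have e1 : (fun t : R => \int[P]_w (X w * cos (- (pi / 2) + t * X w))) =
   ((fun t : R => s ^+ 2 * t) * (fun t : R => \int[P]_w (1 * cos (- (pi / 2) + pi / 2 + t * X w)))).
  apply/funext => t; rewrite stein_normal_law; congr (_ * _).
  by apply: eq_Rintegral => w _; rewrite mul1r; congr cos; ring.
rewrite e1 in h1.
have d1 := @derive_val _ _ _ _ _ _ _ h1; have d2 := @derive_val _ _ _ _ _ _ _ h4.
move: d2; rewrite d1.
have -> : \int[P]_w (X w * X w * cos (- (pi / 2) + 0 * X w + pi / 2)) = \int[P]_w (X w ^+ 2).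
  apply: eq_Rintegral => w _.
  by rewrite (_ : _ + pi / 2 = 0) ?cos0 ?mulr1 ?expr2//; ring.
move=> ->; rewrite mulr0 scale0r add0r.
have -> : \int[P]_w (1 * cos (- (pi / 2) + pi / 2 + 0 * X w)) = 1.
  rewrite -[RHS](Rint_cst 1); apply: eq_Rintegral => w _.
  by rewrite (_ : _ + 0 * X w = 0) ?cos0 ?mulr1//; ring.
by rewrite scale1r.
Qed.

(** w(t) = E[cos(a + tX)] satisfies w' = - s^2 t w, so w(t) exp(s^2 t^2 / 2) is constant; its values
    at 0 and 1 are compared. *)
Lemma normal_law_char (a : R) : \int[P]_w cos (a + X w) = cos a * expR (- (s ^+ 2 / 2)).
Proof.
pose w t := \int[P]_v (1 * cos (a + t * X v)).
have dw (t : R) : is_derive t 1 w (- (s ^+ 2 * t * w t)).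
  have h := @is_derive_int_cos _ T R P (fun=> 1) (fun=> a) X t
    (measurable_cst _) mX (L1_cst 1) (eq_L1 (fun w => esym (mul1r (X w))) LX).
  apply: (is_derive_eq h).
  transitivity (\int[P]_v (X v * cos (a + pi / 2 + t * X v))).
    by apply: eq_Rintegral => v _; rewrite mul1r; congr (_ * cos _); ring.
  rewrite stein_normal_law -mulrN; congr (_ * _).
  rewrite /w -mulN1r -RintZ; last first.
    apply: L1_mul_cos; first exact: L1_cst.
    by apply: measurable_funD => //; exact: measurable_funM.
  apply: eq_Rintegral => v _; rewrite mul1r mulN1r -cosDpi; congr cos.
  by rewrite [in RHS](_ : pi = pi / 2 + pi / 2); [ring|field].
have de (t : R) : is_derive t 1 (fun t : R => expR (s ^+ 2 / 2 * (t * t)))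
    (expR (s ^+ 2 / 2 * (t * t)) * (s ^+ 2 * t)).
  have h1 : is_derive t 1 (fun y : R => y * y) (t *: 1 + t *: 1).
    exact: (is_deriveM (is_derive_id t 1) (is_derive_id t 1)).
  have h2 := is_deriveZ (s ^+ 2 / 2) h1.
  have h3 := @is_derive1_comp R expR (fun y : R => s ^+ 2 / 2 * (y * y)) t _ _
    (is_derive_expR _) h2.
  apply: (is_derive_eq h3); congr (_ * _).
  by rewrite -[LHS]/(s ^+ 2 / 2 * (t * 1 + t * 1)); field.
have df (t : R) : is_derive t 1 (w * (fun t : R => expR (s ^+ 2 / 2 * (t * t)))) 0.
  apply: (is_derive_eq (is_deriveM (dw t) (de t))).
  rewrite -[LHS]/(w t * (expR (s ^+ 2 / 2 * (t * t)) * (s ^+ 2 * t)) +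
    expR (s ^+ 2 / 2 * (t * t)) * - (s ^+ 2 * t * w t)); ring.
have := is_derive_0_is_cst 1 0 df.
rewrite -[LHS]/(w 1 * expR (s ^+ 2 / 2 * (1 * 1))) -[RHS]/(w 0 * expR (s ^+ 2 / 2 * (0 * 0))).
rewrite !mulr0 expR0 !mulr1.
have -> : w 0 = cos a.
  rewrite /w -[RHS]Rint_cst; apply: eq_Rintegral => v _.
  by rewrite mul1r mul0r addr0.
move=> <-; rewrite -mulrA -expRD subrr expR0 mulr1.
by apply: eq_Rintegral => v _; rewrite !mul1r.
Qed.

End NonDegenerate.
End GaussianVariable.

(** The parameter of the law is eliminated in favour of E[X^2], which for a linear combination of
    the family is computed from the covariances. A zero parameter means X = 0 almost surely. *)
Theorem centered_gaussian_char d (T : measurableType d) (R : realType)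
    (P : probability T R) (X : T -> R) : centered_gaussian P X ->
  [/\ measurable_fun setT X, forall p, L1 P (fun w => `|X w| ^+ p)
    & forall a, \int[P]_w cos (a + X w) = cos a * expR (- (\int[P]_w (X w ^+ 2) / 2))].
Proof.
move=> [mX [s s_ge0 law]].
have [sz|s0] := eqVneq s 0; last first.
  have law' A : measurable A -> P (X @^-1` A) = normal_prob 0 s A.
    by move=> /law; rewrite /gaussian_law (negbTE s0).
  split=> //; first exact: (normal_law_moments mX s0 law').
  by move=> a; rewrite (normal_law_variance mX s0 law'); exact: (normal_law_char mX s0 law').
have X0 : X = (fun=> 0) %[ae P].
  have m0 : measurable ([set~ 0] : set R) by apply: measurableC.
  have : P (X @^-1` [set~ 0]) = 0%E.
    rewrite law// /gaussian_law sz eqxx diracE memNset//.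
    by move=> /=; apply.
  move=> PX; exists (X @^-1` [set~ 0]); split => //.
    by rewrite -[X in measurable X]setTI; exact: mX.
  by move=> w /= h; contradict h => _.
have mXp p : measurable_fun setT (fun w => `|X w| ^+ p).
  by apply: measurable_funX; exact: measurableT_comp.
split=> //.
  move=> p; apply: (ae_eq_L1 (f := fun=> `|0 : R| ^+ p)) => //; last exact: L1_cst.
  by apply: filterS X0 => w h _; rewrite h.
move=> a.
have -> : \int[P]_w (X w ^+ 2) = 0.
  rewrite -[RHS](Rint_cst P 0); apply: ae_eq_Rint => //; first exact: measurable_funX.
  by apply: filterS X0 => w h _; rewrite h// expr0n.
rewrite mul0r oppr0 expR0 mulr1 -[RHS](Rint_cst P (cos a)); apply: ae_eq_Rint => //.
  by apply: measurable_cos; exact: measurable_funD.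
by apply: filterS X0 => w h _; rewrite h// addr0.
Qed.

(** * Differentiation of the characteristic function *)

(** A derivative along [v] is the derivative at 0 of the restriction to a line; partial derivatives
    thus reduce to one-variable rules. *)
Lemma is_derive_line (R : realType) (V : normedModType R) (f : V -> R^o) (z v : V) (df : R) :
  is_derive (0 : R) 1 (fun h : R => f (h *: v + z)) df -> is_derive z v f df.
Proof.
move=> [dg <-].
have e : (fun h : R => h^-1 *: ((((fun h => f (h *: v + z)) : R -> R^o) \o shift 0) (h *: 1) -
    f (0 *: v + z))) = (fun h : R => h^-1 *: ((f \o shift z) (h *: v) - f z)).
  by apply/funext => h /=; rewrite scale0r add0r addr0 [h *: 1]mulr1.
by apply: DeriveDef; [move: dg; rewrite /derivable e|rewrite /derive e].
Qed.

Lemma is_derive_unique (R : realType) (V W : normedModType R) (f : V -> W) (x v : V) (a b : W) :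
  is_derive x v f a -> is_derive x v f b -> a = b.
Proof. by move=> [_ <-] [_ <-]. Qed.

Section RealDerivatives.
Variables (R : realType) (x : R).
Implicit Types (f g : R -> R) (c : R).

Lemma is_deriveDR f g df dg : is_derive x 1 f df -> is_derive x 1 g dg ->
  is_derive x 1 (fun h => f h + g h) (df + dg).
Proof. move=> Df Dg; exact: is_deriveD. Qed.

Lemma is_deriveMR f g df dg : is_derive x 1 f df -> is_derive x 1 g dg ->
  is_derive x 1 (fun h => f h * g h) (df * g x + f x * dg).
Proof.
move=> Df Dg; apply: (is_derive_eq (is_deriveM Df Dg)).
by rewrite addrC [df * _]mulrC.
Qed.

Lemma is_deriveZR c f df : is_derive x 1 f df -> is_derive x 1 (fun h => c * f h) (c * df).
Proof.
by move=> Df; have := is_deriveMR (is_derive_cst c x 1) Df; rewrite mul0r add0r.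
Qed.

Lemma is_derive_compR (f g : R -> R) df dg : is_derive (g x) 1 f df -> is_derive x 1 g dg ->
  is_derive x 1 (fun h => f (g h)) (df * dg).
Proof. move=> Df Dg; exact: (@is_derive1_comp R f g x _ _ Df Dg). Qed.

Lemma is_derive_sumR (J : Type) (r : seq J) (p : pred J) (f : J -> R -> R) (df : J -> R) :
  (forall i, p i -> is_derive x 1 (f i) (df i)) ->
  is_derive x 1 (fun h => \sum_(i <- r | p i) f i h) (\sum_(i <- r | p i) df i).
Proof.
move=> D; rewrite (_ : (fun h => _) = \sum_(i <- r | p i) f i); last first.
  by apply/funext => h; rewrite fct_sumE.
elim/big_ind2 : _ => //; first exact: is_derive_cst.
by move=> f1 d1 f2 d2; exact: is_deriveDR.
Qed.
End RealDerivatives.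

Lemma is_derive_quadratic (R : realType) (a b c : R) :
  is_derive (0 : R) 1 (fun h : R => a + (b * h + c * (h * h))) b.
Proof.
have Did := is_derive_id (0 : R) (1 : R).
have := is_deriveDR (is_derive_cst a (0 : R) 1)
  (is_deriveDR (is_deriveZR b Did) (is_deriveZR c (is_deriveMR Did Did))).
by rewrite add0r mulr0 mul0r !addr0 mulr0 mulr1 addr0.
Qed.

(** * Wick's formula by differentiation *)

Section TrigonometricMoments.
Context d (T : measurableType d) (R : realType) (P : probability T R).
Variables (k : nat) (X : 'I_k -> T -> R).
Hypothesis mX : forall j, measurable_fun setT (X j).
Hypothesis LX : forall B : {set 'I_k}, L1 P (fun w => \prod_(j in B) X j w).
Implicit Types (B A : {set 'I_k}) (z : 'rV[R]_k) (j l : 'I_k).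

Definition moment B := \int[P]_w \prod_(j in B) X j w.

(* The phase a stands for sines as well, since cos' x = cos (x + pi / 2). *)
Definition cosmom (a : R) B z :=
  \int[P]_w (\prod_(j in B) X j w * cos (a + \sum_l z 0 l * X l w)).

Local Notation shifted j z h := (h *: delta_mx 0 j + z).

Lemma measurable_lin (a : R) z : measurable_fun setT (fun w => a + \sum_l z 0 l * X l w).
Proof.
apply: measurable_funD => //; apply: measurable_sum => l.
exact: measurable_funM.
Qed.

(** Differentiating along [j] brings down the factor [X j]; since [j] is not in [B], the product
    remains one over a set of indices. *)
Lemma is_derive_cosmom (a : R) B z j : j \notin B ->
  is_derive (0 : R) 1 (fun h => cosmom a B (shifted j z h)) (cosmom (a + pi / 2) (j |: B) z).
Proof.
move=> jB; have := @is_derive_int_cos _ T R P (fun w => \prod_(j in B) X j w)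
  (fun w => a + \sum_l z 0 l * X l w) (X j) 0 (measurable_lin a z) (mX j) (LX B) _.
have -> : (fun t : R => \int[P]_w (\prod_(j in B) X j w *
     cos (a + \sum_l z 0 l * X l w + t * X j w))) =
    (fun h => cosmom a B (shifted j z h)).
  apply/funext => h; apply: eq_Rintegral => w _; congr (_ * cos _).
  rewrite -addrA; congr (a + _); under [in RHS]eq_bigr do rewrite !mxE mulrDl.
  rewrite big_split /= addrC; congr (_ + _).
  rewrite (bigD1 j)//= eqxx mulr1 big1 ?addr0// => l lj.
  by rewrite (negbTE lj) mulr0 mul0r.
have -> : \int[P]_w (\prod_(j in B) X j w * X j w *
     cos (a + \sum_l z 0 l * X l w + 0 * X j w + pi / 2)) = cosmom (a + pi / 2) (j |: B) z.
  apply: eq_Rintegral => w _; rewrite big_setU1//= [X j w * _]mulrC.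
  by rewrite mul0r addr0 (addrAC a).
apply; apply: (eq_L1 _ (LX (j |: B))) => w.
by rewrite big_setU1//= mulrC.
Qed.

Lemma cosmom0 B : cosmom 0 B 0 = moment B.
Proof.
apply: eq_Rintegral => w _; rewrite [X in cos (0 + X)]big1 ?addr0 ?cos0 ?mulr1// => l _.
by rewrite mxE mul0r.
Qed.

Lemma cosmomDpi a B z : cosmom (a + pi) B z = - cosmom a B z.
Proof.
rewrite -mulN1r -RintZ; last by apply: L1_mul_cos => //; exact: measurable_lin.
by apply: eq_Rintegral => w _; rewrite addrAC cosDpi; ring.
Qed.

Section Wick.
Variable K : 'I_k -> 'I_k -> R.
Hypothesis K_sym : forall l j, K l j = K j l.
Local Notation u l z := (\sum_j z 0 j * K l j).
Local Notation Q z := (\sum_l z 0 l * u l z).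
Hypothesis charX : forall (a : R) z,
  \int[P]_w cos (a + \sum_l z 0 l * X l w) = cos a * expR (- (Q z / 2)).

Let delta_sum j (F : 'I_k -> R) : \sum_l (l == j)%:R * F l = F j.
Proof.
rewrite (bigD1 j)//= eqxx mul1r big1 ?addr0// => l lj.
by rewrite (negbTE lj) mul0r.
Qed.

Let u_shift l j z h : u l (shifted j z h) = u l z + h * K l j.
Proof.
have -> : u l (shifted j z h) = \sum_i (z 0 i * K l i + (i == j)%:R * (h * K l i)).
  by apply: eq_bigr => i _; rewrite !mxE eqxx; ring.
by rewrite big_split /= delta_sum.
Qed.

Let Q_shift j z h : Q (shifted j z h) = Q z + (2 * u j z * h + K j j * (h * h)).
Proof.
have -> : Q (shifted j z h) = \sum_l ((l == j)%:R * (h * (u l z + h * K l j)) +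
    (z 0 l * u l z + h * (z 0 l * K j l))).
  by apply: eq_bigr => l _; rewrite u_shift !mxE eqxx (K_sym j l); ring.
rewrite !big_split /= delta_sum -mulr_sumr; ring.
Qed.

(** For empty [A] this is the derivative along [l] of the explicit characteristic function, [u l]
    being half the partial derivative of [Q]. An index [j] is added by differentiating the identity
    along [j]: the product rule applied to [u l] creates the new term with [K l j]. *)
Lemma wick_cosmom (b : R) z l A : l \notin A ->
  cosmom (b + pi / 2) (l |: A) z = u l z * cosmom (b + pi) A z +
    \sum_(j in A) K l j * cosmom (b + pi / 2) (A :\ j) z.
Proof.
elim/card_ind: A b z => A IH b z lA.
have [A0|/finset.set0Pn[j jA]] := eqVneq A finset.set0.
  rewrite A0 big_set0 addr0.
  have l0 : l \notin (finset.set0 : {set 'I_k}) by rewrite finset.in_set0.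
  apply: (is_derive_unique (is_derive_cosmom b z l0)).
  have cE y : cosmom b finset.set0 y = cos b * expR (- (Q y / 2)).
    by rewrite -charX; apply: eq_Rintegral => w _; rewrite big_set0 mul1r.
  rewrite cosmomDpi cE.
  have -> : (fun h : R => cosmom b finset.set0 (shifted l z h)) =
      (fun h : R => cos b * expR (- (Q z / 2) + (- u l z * h + (- K l l / 2) * (h * h)))).
    apply/funext => h; rewrite cE; congr (_ * expR _); by rewrite Q_shift; field.
  have h1 := is_derive_quadratic (- (Q z / 2)) (- u l z) (- K l l / 2).
  have := is_deriveZR (cos b) (is_derive_compR (is_derive_expR _) h1).
  rewrite !mulr0 !addr0.
  suff -> : u l z * - (cos b * expR (- (Q z / 2))) = cos b * (expR (- (Q z / 2)) * - u l z) by [].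
  by ring.
pose A' := A :\ j.
have AE : A = j |: A' by rewrite finset.setD1K.
have jA' : j \notin A' by rewrite !inE eqxx.
have lj : l != j by apply: contraNneq lA => ->.
have lA' : l \notin A' by rewrite !inE negb_and lA orbT.
have AA : A' \proper A by exact: properD1.
have -> : l |: A = j |: (l |: A') by rewrite AE finset.setUCA.
have jlA : j \notin l |: A' by rewrite !inE eq_sym (negbTE lj) eqxx.
apply: (is_derive_unique (is_derive_cosmom b z jlA)).
have -> : (fun h => cosmom b (l |: A') (shifted j z h)) =
    (fun h : R => (u l z + (K l j * h + 0 * (h * h))) * cosmom (b + pi / 2) A' (shifted j z h)
      + \sum_(i in A') K l i * cosmom b (A' :\ i) (shifted j z h)).
  apply/funext => h.
  (* Each derivative advances the phase by pi / 2, so the induction hypothesis is taken a quarter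
     turn earlier. *)
  have := IH A' AA (b - pi / 2) (shifted j z h) lA'.
  rewrite subrK u_shift => ->; congr (_ * cosmom _ _ _ + _); first by ring.
  by field.
have d1 := is_deriveMR (is_derive_quadratic (u l z) (K l j) 0)
  (is_derive_cosmom (b + pi / 2) z jA').
have d2 : is_derive (0 : R) 1 (fun h : R => \sum_(i in A') K l i * cosmom b (A' :\ i) (shifted j z h))
    (\sum_(i in A') K l i * cosmom (b + pi / 2) (j |: (A' :\ i)) z).
  apply: is_derive_sumR => i iA; apply/is_deriveZR/is_derive_cosmom.
  by rewrite !inE negb_and eqxx orbT.
apply: (is_derive_eq (is_deriveDR d1 d2)).
rewrite !mulr0 !addr0 scale0r add0r -AE (_ : b + pi / 2 + pi / 2 = b + pi); last by field.
rewrite [X in X + _ = _]addrC -addrA; congr (_ + _).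
rewrite [RHS](big_setD1 j)//=; congr (_ + _).
apply: eq_bigr => i iA'; congr (_ * cosmom _ _ _).
move: iA'; rewrite !inE => /andP[ij iA]; apply/finset.setP => x; rewrite !inE.
have [->|xj] := eqVneq x j; first by rewrite eq_sym ij jA.
by [].
Qed.

Lemma wick_moment l A : l \notin A ->
  moment (l |: A) = \sum_(j in A) K l j * moment (A :\ j).
Proof.
move=> lA; have := wick_cosmom (- (pi / 2)) 0 lA.
rewrite addNr cosmom0 => ->; rewrite big1 ?mul0r ?add0r; last first.
  by move=> j _; rewrite mxE mul0r.
by apply: eq_bigr => j _; rewrite cosmom0.
Qed.

End Wick.

End TrigonometricMoments.

Local Open Scope complex_scope.

(** * Derivatives of complex curves and the principal logarithm *)

Section ComplexCurves.
Variable R : realType.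
Implicit Types (g h : R -> R[i]) (a b c : R[i]).

(** Componentwise because [partial] is, and at 0 only: curves are parametrised by the displacement
    from the point of interest. *)
Definition cderiv g a := is_derive (0 : R) 1 (fun t => complex.Re (g t)) (complex.Re a) /\
  is_derive (0 : R) 1 (fun t => complex.Im (g t)) (complex.Im a).

Lemma complexE_pair c : c = complex.Re c +i* complex.Im c.
Proof. by case: c. Qed.

Lemma ReM a b : complex.Re (a * b) =
  complex.Re a * complex.Re b - complex.Im a * complex.Im b.
Proof. by case: a => ? ?; case: b => ? ?. Qed.

Lemma ImM a b : complex.Im (a * b) =
  complex.Re a * complex.Im b + complex.Im a * complex.Re b.
Proof. by case: a => ? ?; case: b => ? ?. Qed.

Lemma ReD a b : complex.Re (a + b) = complex.Re a + complex.Re b.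
Proof. by case: a => ? ?; case: b => ? ?. Qed.

Lemma ImD a b : complex.Im (a + b) = complex.Im a + complex.Im b.
Proof. by case: a => ? ?; case: b => ? ?. Qed.

Lemma cderiv_cst a : cderiv (fun=> a) 0.
Proof. by split; exact: is_derive_cst. Qed.

Lemma cderivD g h a b : cderiv g a -> cderiv h b -> cderiv (fun t => g t + h t) (a + b).
Proof.
move=> [ga gb] [ha hb]; split.
  rewrite ReD (_ : (fun t => _) = (fun t => complex.Re (g t) + complex.Re (h t))).
    exact: is_deriveDR.
  by apply/funext => t; rewrite ReD.
rewrite ImD (_ : (fun t => _) = (fun t => complex.Im (g t) + complex.Im (h t))).
  exact: is_deriveDR.
by apply/funext => t; rewrite ImD.
Qed.

Lemma cderivM g h a b : cderiv g a -> cderiv h b ->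
  cderiv (fun t => g t * h t) (a * h 0 + g 0 * b).
Proof.
move=> [ga gb] [ha hb]; split.
  have := is_deriveDR (is_deriveMR ga ha) (is_deriveZR (-1) (is_deriveMR gb hb)).
  rewrite (_ : (fun t => _) = (fun t => complex.Re (g t * h t))); last first.
    by apply/funext => t; rewrite ReM mulN1r.
  by move=> H; apply: (is_derive_eq H); rewrite ReD !ReM; ring.
have := is_deriveDR (is_deriveMR ga hb) (is_deriveMR gb ha).
rewrite (_ : (fun t => _) = (fun t => complex.Im (g t * h t))); last first.
  by apply/funext => t; rewrite ImM.
by move=> H; apply: (is_derive_eq H); rewrite ImD !ImM; ring.
Qed.

Lemma cderivZ c g a : cderiv g a -> cderiv (fun t => c * g t) (c * a).
Proof. by move=> ga; have := cderivM (cderiv_cst c) ga; rewrite mul0r add0r. Qed.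

Lemma cderivB g h a b : cderiv g a -> cderiv h b -> cderiv (fun t => g t - h t) (a - b).
Proof.
move=> ga hb; have := cderivD ga (cderivZ (-1) hb); rewrite mulN1r.
by rewrite (_ : (fun t => g t + -1 * h t) = (fun t => g t - h t))//; apply/funext => t; rewrite mulN1r.
Qed.

Lemma cderiv_sum (J : Type) (r : seq J) (p : pred J) (g : J -> R -> R[i]) (a : J -> R[i]) :
  (forall i, p i -> cderiv (g i) (a i)) ->
  cderiv (fun t => \sum_(i <- r | p i) g i t) (\sum_(i <- r | p i) a i).
Proof.
move=> D; elim: r => [|x r IH].
  rewrite big_nil (_ : (fun t => _) = fun=> 0); first exact: cderiv_cst.
  by apply/funext => t; rewrite big_nil.
rewrite big_cons (_ : (fun t => _) = (fun t => (if p x then g x t else 0) +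
    \sum_(i <- r | p i) g i t)); last first.
  by apply/funext => t; rewrite big_cons; case: ifP => // _; rewrite add0r.
case: ifP => px; first exact: cderivD (D _ px) IH.
rewrite (_ : (fun t => _) = (fun t => \sum_(i <- r | p i) g i t))//.
by apply/funext => t; rewrite add0r.
Qed.

Lemma complexVE c : c^-1 = (complex.Re c / (complex.Re c ^+ 2 + complex.Im c ^+ 2)) +i*
  (- complex.Im c / (complex.Re c ^+ 2 + complex.Im c ^+ 2)).
Proof. by case: c => x y; rewrite /GRing.inv /= mulNr. Qed.

Lemma cderivV g a : 0 < complex.Re (g 0) -> cderiv g a ->
  cderiv (fun t => (g t)^-1) (- a / g 0 ^+ 2).
Proof.
move=> g0 [ga gb].
pose r t := complex.Re (g t) ^+ 2 + complex.Im (g t) ^+ 2.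
have r0 : 0 < r 0 by rewrite ltr_wpDr ?sqr_ge0// exprn_gt0.
have rn : r 0 != 0 by rewrite gt_eqF.
have Dr : is_derive (0 : R) 1 r
    (2 * (complex.Re (g 0) * complex.Re a + complex.Im (g 0) * complex.Im a)).
  have := is_deriveDR (is_deriveMR ga ga) (is_deriveMR gb gb).
  rewrite (_ : (fun t => _) = r); last by apply/funext.
  by move=> H; apply: (is_derive_eq H); ring.
have DV := is_deriveV rn Dr.
have Da := is_deriveMR ga DV.
have Db := is_deriveMR (is_deriveZR (-1) gb) DV.
have gV t : (g t)^-1 = (complex.Re (g t) * (r t)^-1) +i* (-1 * complex.Im (g t) * (r t)^-1).
  by rewrite complexVE mulN1r.
rewrite /cderiv (_ : (fun t => complex.Re _) = (fun t => complex.Re (g t) * (r t)^-1)); last first.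
  by apply/funext => t; rewrite gV.
rewrite (_ : (fun t => complex.Im _) = (fun t => -1 * complex.Im (g t) * (r t)^-1)); last first.
  by apply/funext => t; rewrite gV.
move: Da Db; set b1 := (X in is_derive _ _ _ X -> _); set b2 := (X in _ -> is_derive _ _ _ X -> _).
suff -> : - a / g 0 ^+ 2 = b1 +i* b2 by [].
have gn : g 0 != 0 by apply: contraTneq g0 => ->; rewrite ltxx.
apply/eqP; rewrite eq_sym -(inj_eq (mulIf (expf_neq0 2 gn))) divfK ?expf_neq0//.
rewrite /b1 /b2 -![_ *: _]/(_ * _); move: rn; rewrite /r.
case: (g 0) => x y; case: (a) => u v /= rn.
rewrite expr2 eq_complex /=; apply/andP; split; apply/eqP; field; exact: rn.
Qed.

Lemma cderiv_Re_gt0 g a : cderiv g a -> 0 < complex.Re (g 0) ->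
  \forall t \near (0 : R), 0 < complex.Re (g t).
Proof.
move=> [[dg _] _] g0.
have c : {for 0, continuous (fun t => complex.Re (g t))}.
  by apply: differentiable_continuous; exact/derivable1_diffP.
exact: (cvgr_gt _ c).
Qed.

(** In the right half-plane the logarithm is ln(x^2 + y^2) / 2 + i atan(y / x), and a differentiable
    curve that starts there stays there for small times, so only this branch is differentiated. *)
Lemma cderiv_clog g a : 0 < complex.Re (g 0) -> cderiv g a ->
  cderiv (fun t => clog (g t)) (a / g 0).
Proof.
move=> g0 Dg; have near0 := cderiv_Re_gt0 Dg g0; case: (Dg) => ga gb.
pose r t := complex.Re (g t) ^+ 2 + complex.Im (g t) ^+ 2.
have r0 : 0 < r 0 by rewrite ltr_wpDr ?sqr_ge0// exprn_gt0.
have Dr : is_derive (0 : R) 1 r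
    (2 * (complex.Re (g 0) * complex.Re a + complex.Im (g 0) * complex.Im a)).
  have := is_deriveDR (is_deriveMR ga ga) (is_deriveMR gb gb).
  rewrite (_ : (fun t => _) = r); last by apply/funext.
  by move=> H; apply: (is_derive_eq H); ring.
have rn : r 0 != 0 by rewrite gt_eqF.
have xn : complex.Re (g 0) != 0 by rewrite gt_eqF.
have aE : a / g 0 =
    ((complex.Re a * complex.Re (g 0) + complex.Im a * complex.Im (g 0)) / r 0) +i*
    ((complex.Im a * complex.Re (g 0) - complex.Re a * complex.Im (g 0)) / r 0).
  rewrite complexVE; move: rn; rewrite /r; case: (g 0) => x y; case: (a) => u v /= rn.
  by apply/eqP; rewrite eq_complex /=; apply/andP; split; apply/eqP; field; exact: rn.
rewrite aE; split => /=.
  have := is_deriveZR (2^-1) (is_derive_compR (is_derive1_ln r0) Dr).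
  have -> : 2^-1 * ((r 0)^-1 *
      (2 * (complex.Re (g 0) * complex.Re a + complex.Im (g 0) * complex.Im a))) =
      (complex.Re a * complex.Re (g 0) + complex.Im a * complex.Im (g 0)) / r 0.
    by field; exact: rn.
  apply: near_eq_is_derive; near=> t.
  have gt : 0 < complex.Re (g t) by near: t.
  have rt : 0 < r t by rewrite ltr_wpDr ?sqr_ge0// exprn_gt0.
  rewrite [RHS]/(ln (complex.Re `|g t|)) normc_def /= -/(r t) -{1}[r t]sqr_sqrtr ?(ltW rt)//.
  by rewrite lnXn ?sqrtr_gt0// -[ln _ *+ 2]mulr_natl mulrA mulVf ?mul1r// pnatr_eq0.
have Dq := is_deriveMR gb (is_deriveV xn ga).
have := is_derive_compR (is_derive1_atan _) Dq.
set q := (X in is_derive _ _ _ X -> _).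
have -> : (complex.Im a * complex.Re (g 0) - complex.Re a * complex.Im (g 0)) / r 0 = q.
  rewrite /q -![_ *: _]/(_ * _); move: rn xn; rewrite /r; case: (g 0) => x y; case: (a) => u v /= rn xn.
  have e : 1 + (y * x^-1) ^+ 2 = (x ^+ 2 + y ^+ 2) / x ^+ 2 by field.
  by rewrite e invf_div; field; rewrite ?rn ?xn.
apply: near_eq_is_derive; near=> t.
have gt : 0 < complex.Re (g t) by near: t.
by case: (g t) gt => x y /= ->.
Unshelve. all: by end_near.
Qed.

Lemma partial_cderiv k (l : 'I_k) (F : 'rV[R]_k -> R[i]) z a :
  cderiv (fun t => F (t *: delta_mx 0 l + z)) a -> partial l F z = a.
Proof.
move=> [D1 D2]; rewrite /partial (complexE_pair a); congr (_ +i* _).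
  by case: (is_derive_line (f := fun x => complex.Re (F x) : R^o) (v := delta_mx 0 l) D1).
by case: (is_derive_line (f := fun x => complex.Im (F x) : R^o) (v := delta_mx 0 l) D2).
Qed.

End ComplexCurves.

(** * Iterated derivatives of the logarithm of the characteristic function *)

Section JointCumulant.
Context d (T : measurableType d) (R : realType) (P : probability T R).
Variables (k : nat) (X : 'I_k -> T -> R).
Hypothesis mX : forall j, measurable_fun setT (X j).
Hypothesis LX : forall B : {set 'I_k}, L1 P (fun w => \prod_(j in B) X j w).
Implicit Types (B A : {set 'I_k}) (z : 'rV[R]_k) (j l : 'I_k).

Local Notation shifted j z h := (h *: delta_mx 0 j + z).
Local Notation cosm := (cosmom P X).

(** E[X_B exp(i z.X)]: the sine is the cosine at phase -pi/2. *)
Definition expmom B z : R[i] := cosm 0 B z +i* cosm (- (pi / 2)) B z.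

Lemma cderiv_expmom B z j : j \notin B ->
  cderiv (fun t => expmom B (shifted j z t)) ('i%C * expmom (j |: B) z).
Proof.
move=> jB; split => /=.
  have := is_derive_cosmom mX LX 0 z jB.
  have -> // : cosm (0 + pi / 2) (j |: B) z =
    0 * cosm 0 (j |: B) z - 1 * cosm (- (pi / 2)) (j |: B) z.
  rewrite mul0r sub0r mul1r -cosmomDpi//; congr (cosmom _ _ _ _ _); by field.
have := is_derive_cosmom mX LX (- (pi / 2)) z jB. rewrite addNr.
by rewrite mul0r mul1r add0r.
Qed.

(* The moments of the complex measure exp(i z.X) dP / E[exp(i z.X)], with the
   power of i that makes them stable under differentiation. *)
Definition tilted B z : R[i] := 'i%C ^+ #|B| * (expmom B z * (expmom finset.set0 z)^-1).

(** The quotient rule; differentiating the normalisation is what subtracts the product with [tilted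
    [set j]]. *)
Lemma cderiv_tilted B z j : j \notin B -> 0 < cosm 0 finset.set0 z ->
  cderiv (fun t => tilted B (shifted j z t)) (tilted (j |: B) z - tilted B z * tilted [set j] z).
Proof.
move=> jB z0.
have g0 : 0 < complex.Re (expmom finset.set0 (shifted j z 0)) by rewrite scale0r add0r.
have j0 : j \notin (finset.set0 : {set 'I_k}) by rewrite finset.in_set0.
have := cderivZ ('i%C ^+ #|B|) (cderivM (cderiv_expmom z jB) (cderivV g0 (cderiv_expmom z j0))).
rewrite scale0r add0r finset.setU0.
set a := (X in cderiv _ X -> _); suff -> : a = tilted (j |: B) z - tilted B z * tilted [set j] z by [].
rewrite /a /tilted cardsU1 jB cards1 exprD !expr1 /=.
have n0 : expmom finset.set0 z != 0 by apply: contraTneq z0 => /(congr1 (@complex.Re R)) /= ->; rewrite ltxx.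
by field.
Qed.

(** Differentiating a cumulant along a new variable adds this variable to it. The derivative of the
    recursion for [A] is the expansion of [cum_setU1]: the terms multiplied by [tilted [set j]]
    combine, by the recursion for [A], into [cum A] times [tilted [set j]]. *)
Lemma cderiv_cum l A z j : l \in A -> j \notin A -> 0 < cosm 0 finset.set0 z ->
  cderiv (fun t => cum l (fun B => tilted B (shifted j z t)) A)
    (cum l (fun B => tilted B z) (j |: A)).
Proof.
elim/card_ind: A => A IH lA jA z0.
have -> : (fun t => cum l (fun B => tilted B (shifted j z t)) A) =
  (fun t => tilted A (shifted j z t) - \sum_(B : {set 'I_k} | (l \in B) && (B \proper A))
     cum l (fun B => tilted B (shifted j z t)) B * tilted (A :\: B) (shifted j z t)).
  by apply/funext => t; rewrite cumE.
have DA := cderiv_tilted jA z0.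
have DB (B : {set 'I_k}) : (l \in B) && (B \proper A) ->
    cderiv (fun t => cum l (fun B => tilted B (shifted j z t)) B *
      tilted (A :\: B) (shifted j z t)) 
    (cum l (fun B => tilted B z) (j |: B) * tilted (A :\: B) z + cum l (fun B => tilted B z) B *
       (tilted (j |: A :\: B) z - tilted (A :\: B) z * tilted [set j] z)).
  move=> /andP[lB BA].
  have jB : j \notin B by apply: contra jA; exact: (fintype.subsetP (proper_sub BA)).
  have jAB : j \notin A :\: B by rewrite inE negb_and jA orbT.
  have := cderivM (IH B BA lB jB z0) (cderiv_tilted jAB z0).
  by rewrite scale0r add0r.
have := cderivB DA (cderiv_sum (index_enum _) DB).
set a := (X in cderiv _ X -> _); suff -> : a = cum l (fun B => tilted B z) (j |: A) by [].
rewrite /a cum_setU1// [X in _ = _ - X * _ - _]cumE.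
rewrite (eq_bigr (fun B : {set 'I_k} => (cum l (tilted^~ z) (j |: B) * tilted (A :\: B) z +
    cum l (tilted^~ z) B * tilted (j |: A :\: B) z) -
    (cum l (tilted^~ z) B * tilted (A :\: B) z) * tilted [set j] z)); last first.
  by move=> B _; ring.
rewrite sumrB -mulr_suml; ring.
Qed.

Lemma expmom0 B : expmom B 0 = (moment P X B)%:C.
Proof.
rewrite /expmom cosmom0; congr (_ +i* _).
rewrite -[RHS](Rint_cst P 0); apply: eq_Rintegral => w _.
rewrite [X in cos (_ + X)]big1; first by rewrite addr0 cosN cos_pihalf mulr0.
by move=> l _; rewrite mxE mul0r.
Qed.

Lemma cosm0 z : cosm 0 finset.set0 z = complex.Re (char_fun P X z).
Proof.
rewrite /char_fun /= unlock /cosm /Rintegral; congr fine.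
by apply: eq_integral => w _; rewrite big_set0 mul1r add0r.
Qed.

Lemma char_funE z : char_fun P X z = expmom finset.set0 z.
Proof.
rewrite /expmom cosm0 (complexE_pair (char_fun P X z)); congr (_ +i* _).
rewrite /char_fun /= unlock /cosm /Rintegral; congr fine.
apply: eq_integral => w _; rewrite big_set0 mul1r.
by rewrite [- _ + _]addrC cosBpihalf.
Qed.

(** The derivative taken first is along the last entry [l]; it turns the logarithm into the cumulant
    of [[set l]], and [cderiv_cum] adds each further entry. *)
Lemma iter_partial_cum s l z : uniq (rcons s l) -> 0 < cosm 0 finset.set0 z ->
  foldr (@partial R k) (fun z => clog (char_fun P X z)) (rcons s l) z =
  cum l (tilted^~ z) [set x in rcons s l].
Proof.
elim: s z => [|j s IH] z.
  move=> _ z0 /=; apply: partial_cderiv.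
  have l0 : l \notin (finset.set0 : {set 'I_k}) by rewrite finset.in_set0.
  have -> : (fun t => clog (char_fun P X (shifted l z t))) =
     (fun t => clog (expmom finset.set0 (shifted l z t))).
    by apply/funext => t; rewrite char_funE.
  have := cderiv_clog _ (cderiv_expmom z l0).
  rewrite scale0r add0r finset.setU0 => /(_ z0).
  set a := (X in cderiv _ X -> _).
  have -> // : [set x in [:: l]] = [set l]%SET by apply/finset.setP => x; rewrite !inE.
  by rewrite cum1 /tilted cards1 expr1 mulrA.
rewrite rcons_cons /= => /andP[js us] z0; apply: partial_cderiv.
pose A := [set x in rcons s l]%SET.
have lA : l \in A by rewrite inE mem_rcons in_cons eqxx.
have jA : j \notin A by rewrite inE.
have -> : [set x in j :: rcons s l]%SET = j |: A by apply/finset.setP => x; rewrite !inE.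
have [D1 D2] := cderiv_cum lA jA z0.
have l0 : j \notin (finset.set0 : {set 'I_k}) by rewrite finset.in_set0.
(* The induction hypothesis asks for a characteristic function with positive real part; this
   persists near [z], which suffices for a derivative. *)
have near0 := cderiv_Re_gt0 (cderiv_expmom z l0).
rewrite scale0r add0r in near0; have {}near0 := near0 z0.
split; [move: D1|move: D2]; apply: near_eq_is_derive; near=> t; rewrite IH//;
  by near: t.
Unshelve. all: by end_near.
Qed.

End JointCumulant.

(** At the origin the tilted moments are the moments times i to the power #|B|; these powers leave
    the cumulant by [cum_scale] and cancel the (-i)^k of the definition. The distinguished variable
    is [ord_max] because the enumeration ends with it. *)
Theorem joint_cumulantE d (T : measurableType d) (R : realType) (P : probability T R)
    k (X : 'I_k.+1 -> T -> R) :
  (forall j, measurable_fun setT (X j)) ->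
  (forall B : {set 'I_k.+1}, L1 P (fun w => \prod_(j in B) X j w)) ->
  joint_cumulant P X = (cum ord_max (moment P X) finset.setT)%:C.
Proof.
move=> mX LX.
have m0 : moment P X finset.set0 = 1.
  rewrite -[RHS](Rint_cst P); apply: eq_Rintegral => w _; exact: big_set0.
rewrite /joint_cumulant.
set s := enum 'I_k.+1.
have sE : s = rcons [seq widen_ord (leqnSn k) i | i <- enum 'I_k] ord_max by exact: enum_ordSr.
rewrite sE iter_partial_cum//; last first.
- by rewrite cosmom0 m0.
- by rewrite -sE enum_uniq.
have -> : [set x in rcons [seq widen_ord (leqnSn k) i | i <- enum 'I_k] ord_max]%SET = finset.setT.
  by apply/finset.setP => x; rewrite -sE !inE mem_enum.
rewrite (@eq_cum _ _ _ _ (fun B : {set 'I_k.+1} => 'i%C ^+ #|B| * (real_complex R \o moment P X) B)).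
  rewrite (@cum_scale _ _ _ _ (fun B : {set 'I_k.+1} => 'i%C ^+ #|B|)).
    by rewrite cum_morph cardsT card_ord mulrA -exprMn mulNr -expr2 sqr_i opprK expr1n mul1r.
  by move=> B C BC; rewrite -exprD cardsD (finset.setIidPr BC) subnKC// subset_leq_card.
by move=> B _; rewrite /tilted !expmom0 m0 invr1 mulr1.
Qed.

(** * Contractions along a pairing *)

Lemma prod_dfwith (R : comNzRingType) (I : finType) (V : I -> Type)
    (phi : forall i, V i -> R) (f : forall i, V i) j (g : V j) (B : {set I}) : j \in B ->
  \prod_(i in B) phi i (dfwith f j g i) = phi j g * \prod_(i in B :\ j) phi i (f i).
Proof.
move=> jB; rewrite (big_setD1 j)//= dfwithin; congr (_ * _); apply: eq_bigr => i.
by rewrite !inE => /andP[ij _]; rewrite dfwithout// eq_sym.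
Qed.

Lemma prod_dfwith_notin (R : comNzRingType) (I : finType) (V : I -> Type)
    (phi : forall i, V i -> R) (f : forall i, V i) j (g : V j) (B : {set I}) : j \notin B ->
  \prod_(i in B) phi i (dfwith f j g i) = \prod_(i in B) phi i (f i).
Proof.
move=> jB; apply: eq_bigr => i iB; rewrite dfwithout//.
by apply: contraNneq jB => ->.
Qed.

Lemma cvg_le_sqrt (R : realType) (a b : nat -> R) (l C : R) :
  (forall p, `|a p - l| <= Num.sqrt (b p) * C) -> b p @[p --> \oo] --> 0 -> a p @[p --> \oo] --> l.
Proof.
move=> h b0.
have {}b0 : Num.sqrt (b p) * C @[p --> \oo] --> 0.
  rewrite -[X in _ --> X](mul0r C); apply: cvgM; last exact: cvg_cst.
  by rewrite -(sqrtr0 R); apply: (cvg_comp _ _ b0); exact: sqrt_continuous.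
apply/cvgrPdist_lt => e e0; near=> p.
rewrite distrC; apply: le_lt_trans (h p) _; apply: le_lt_trans (ler_norm _) _.
by near: p; exact: cvgr0_norm_lt.
Unshelve. all: by end_near.
Qed.

Section MeetMeasure.
Context d (T : measurableType d) (R : realType).
Variables (nu : {measure set T -> \bar R}) (I : finType) (D : I -> set T).

(** Defined on all subsets so as to be a kernel for [pair_sum]; on a pair it is the covariance of
    the two Gaussian variables. *)
Definition meet_measure (b : {set I}) : R := fine (nu (\bigcap_(t in [set` b]) D t)).

Lemma meet_measure2 p q : meet_measure [set p; q] = fine (nu (D p `&` D q)).
Proof.
congr (fine (nu _)); apply/seteqP; split=> x /= h.
  by split; apply: h; rewrite /= !inE eqxx ?orbT.
by case: h => hp hq t /=; rewrite !inE => /orP[]/eqP ->.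
Qed.

End MeetMeasure.

Section Contractions.
Context d (T : measurableType d) (R : realType).
Variables (nu : {sigma_finite_measure set T -> \bar R}) (k : nat) (n_ : 'I_k -> nat).
Local Notation n := (\sum_(j < k) n_ j)%N.
Local Notation mu j := (power_measure nu (n_ j)).
Implicit Types (s : {set {set 'I_n}}) (f : forall j, (n_ j).-tuple T -> R).

Definition pair_integral f s := \int[power_measure nu n./2]_y f_sigma f s y.

Section OnePairing.
Variable s : {set {set 'I_n}}.
Hypothesis sP : s \in pairings finset.setT.

Lemma pblockP t : finset.pblock s t \in s /\ t \in finset.pblock s t.
Proof.
move: sP; rewrite inE => /andP[/and3P[/eqP cs _ _] _].
have tc : t \in finset.cover s by rewrite cs finset.in_setT.
by rewrite mem_pblock tc pblock_mem.
Qed.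

Lemma size_pairing : size (enum s) = n./2.
Proof. by rewrite [in RHS](card_pairing sP) muln2 doubleK -cardE. Qed.

Lemma slot_lt t : (index (finset.pblock s t) (enum s) < n./2)%N.
Proof. by rewrite -size_pairing index_mem mem_enum; case: (pblockP t). Qed.

Definition slot t := Ordinal (slot_lt t).

Definition slot_block (q : nat) := nth finset.set0 (enum s) q.

Lemma slot_block_mem q : (q < n./2)%N -> slot_block q \in s.
Proof. by move=> qn; rewrite -mem_enum mem_nth// size_pairing. Qed.

Lemma slotE t (q : 'I_(n./2)) : (slot t == q) = (t \in slot_block q).
Proof.
have := sP; rewrite inE => /andP[/and3P[_ ts _] _].
apply/eqP/idP => [<-|tq].
  by rewrite /slot_block /= nth_index ?mem_enum; case: (pblockP t).
apply/val_inj => /=; rewrite (def_pblock ts _ tq) ?slot_block_mem//.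
by rewrite /slot_block index_uniq ?enum_uniq// size_pairing.
Qed.

Lemma f_sigmaE f y : f_sigma f s y =
  \prod_(j < k) f j (pull (fun i => slot (tagnat.Rank j i)) y).
Proof.
apply: eq_bigr => j _; congr (f j _); apply: eq_from_tnth => i.
by rewrite !tnth_mktuple (tnth_nth point).
Qed.

Lemma prod_slot (F : {set 'I_n} -> R) : \prod_(q < n./2) F (slot_block q) = \prod_(b in s) F b.
Proof.
rewrite -(big_mkord xpredT (fun q => F (slot_block q))) -size_pairing.
by rewrite -(big_nth finset.set0 xpredT F) big_enum.
Qed.

(** The two positions of a pair lie over distinct blocks because [s] is crossing; this supplies the
    hypothesis on shared variables in [contraction_bound]. *)
Lemma slot_covered : crossing s -> forall q : 'I_(n./2), exists a b,
  [/\ a != b, q \in codom (fun i => slot (tagnat.Rank a i)),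
     q \in codom (fun i => slot (tagnat.Rank b i))
   & forall j, j != a -> j != b -> q \notin codom (fun i => slot (tagnat.Rank j i))].
Proof.
move=> /crossingP st q; have bs := slot_block_mem (ltn_ord q).
have /pairingsP[_ /(_ _ bs)/eqP/cards2P[t [u [tu be]]] _ _] := sP.
have tb : t \in slot_block q by rewrite be !inE eqxx.
have ub : u \in slot_block q by rewrite be !inE eqxx orbT.
have cod v : v \in slot_block q ->
    q \in codom (fun i => slot (tagnat.Rank (block_of v) i)).
  rewrite -slotE => /eqP <-; apply/codomP; exists (tagnat.sig2 v).
  by rewrite tagnat.sig2K.
exists (block_of t), (block_of u); split; [|exact: cod|exact: cod|].
  by apply: contraNneq tu => /(st _ _ _ bs tb ub) ->.
move=> j jt ju; apply/codomP => -[i /esym/eqP]; rewrite slotE be !inE => /orP[]/eqP e.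
  by rewrite -e block_of_Rank eqxx in jt.
by rewrite -e block_of_Rank eqxx in ju.
Qed.

Lemma slot_inj : crossing s -> forall j, injective (fun i => slot (@tagnat.Rank k n_ j i)).
Proof.
move=> /crossingP st j i i' /eqP; rewrite slotE => e.
have bs := slot_block_mem (ltn_ord (slot (tagnat.Rank j i'))).
have e' : tagnat.Rank j i' \in slot_block (slot (tagnat.Rank j i')) by rewrite -slotE.
by apply: (@Rank_inj _ n_ j); apply: (st _ _ _ bs e e'); rewrite !block_of_Rank.
Qed.

End OnePairing.

Lemma pair_integral_le f s : s \in M2_0 (pi_star n_) -> (forall j, L2 (mu j) (f j)) ->
  L1 (power_measure nu n./2) (f_sigma f s) /\
  `|pair_integral f s| <= \prod_(j < k) Num.sqrt (nrm2 (mu j) (f j)).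
Proof.
rewrite M2_0E => /andP[sP st] fL2.
have fE : f_sigma f s = fun y => \prod_(j < k) f j (pull (fun i => slot sP (tagnat.Rank j i)) y).
  by apply/funext => y; rewrite (f_sigmaE sP).
rewrite /pair_integral fE.
exact: (contraction_bound (slot_inj (sP := sP) st) (slot_covered sP st) fL2 point).
Qed.

Lemma f_sigma_dfwith (f : forall j, (n_ j).-tuple T -> R) j a g h s y :
  f_sigma (dfwith f j (fun x => a * g x + h x)) s y =
  a * f_sigma (dfwith f j g) s y + f_sigma (dfwith f j h) s y.
Proof.
pose phi i (u : (n_ i).-tuple T -> R) :=
  u [tuple tnth (identify s y) (@tagnat.Rank k n_ i l) | l < n_ i].
have E u : f_sigma (dfwith f j u) s y =
    phi j u * \prod_(i in finset.setT :\ j) phi i (f i).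
  rewrite -(prod_dfwith phi f u (finset.in_setT j)).
  by apply: eq_bigl => i; rewrite inE.
by rewrite !E /phi mulrDl mulrA.
Qed.

Lemma pair_integral_lin (f : forall j, (n_ j).-tuple T -> R) j a g h s :
  s \in M2_0 (pi_star n_) -> (forall j, L2 (mu j) (f j)) -> L2 (mu j) g -> L2 (mu j) h ->
  pair_integral (dfwith f j (fun x => a * g x + h x)) s =
  a * pair_integral (dfwith f j g) s + pair_integral (dfwith f j h) s.
Proof.
move=> sM fL2 gL2 hL2.
have L u : L2 (mu j) u -> forall i, L2 (mu i) (dfwith f j u i).
  by move=> uL2 i; case: dfwithP.
have [Lg _] := pair_integral_le sM (L _ gL2).
have [Lh _] := pair_integral_le sM (L _ hL2).
rewrite /pair_integral -RintZ// -RintD//; last exact: L1Z.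
by apply: eq_Rintegral => y _; exact: f_sigma_dfwith.
Qed.

(** By linearity the difference is a contraction with [u p - g] in coordinate [j], hence at most a
    constant times the L2 norm of that entry. *)
Lemma pair_integral_cvg (f : forall j, (n_ j).-tuple T -> R) j (u : nat -> (n_ j).-tuple T -> R) g s :
  s \in M2_0 (pi_star n_) -> (forall j, L2 (mu j) (f j)) -> (forall p, L2 (mu j) (u p)) ->
  L2 (mu j) g -> nrm2 (mu j) (fun x => u p x - g x) @[p --> \oo] --> (0 : R) ->
  pair_integral (dfwith f j (u p)) s @[p --> \oo] --> pair_integral (dfwith f j g) s.
Proof.
move=> sM fL2 uL2 gL2 ug.
have dL2 p : L2 (mu j) (fun x => u p x - g x) by exact: L2B.
pose C := \prod_(i in finset.setT :\ j) Num.sqrt (nrm2 (mu i) (f i)).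
have bnd p : `|pair_integral (dfwith f j (u p)) s - pair_integral (dfwith f j g) s| <=
    Num.sqrt (nrm2 (mu j) (fun x => u p x - g x)) * C.
  pose w x := u p x - g x; have wL2 : L2 (mu j) w by exact: dL2.
  have uE : u p = (fun x => 1 * w x + g x).
    by apply/funext => x; rewrite mul1r subrK.
  rewrite {1}uE pair_integral_lin// mul1r addrK.
  rewrite -(prod_dfwith (fun i v => Num.sqrt (nrm2 (mu i) v)) f w (finset.in_setT j)).
  rewrite (eq_bigl xpredT) => [|i]; last by rewrite inE.
  by apply: (pair_integral_le sM _).2 => i; case: dfwithP.
exact: (cvg_le_sqrt bnd).
Qed.

Section Boxes.
Variable C : forall j, 'I_(n_ j) -> set T.
Hypothesis C_fin : forall j i, finite_sets nu (@C j i).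

Local Notation box_kernel := (meet_measure nu (ragged C)).

(** Identifying the two variables of each pair turns the product of box indicators into the
    indicator of a box in dimension n/2, whose sides are the intersections of the paired sides. *)
Lemma pair_integral_box s : s \in pairings finset.setT ->
  pair_integral (fun j => \1_(box (@C j))) s = \prod_(b in s) box_kernel b.
Proof.
move=> sP.
pose D (q : 'I_(n./2)) := \bigcap_(t in [set` slot_block s q]) ragged C t.
have mC t : measurable (ragged C t) by case: (C_fin (tagged (tagnat.sig t))).
have mD q : measurable (D q).
  apply: fin_bigcap_measurable => [|t _]; last exact: mC.
  exact: finite_finset.
have finD q : (nu (D q) < +oo)%E.
  have [t tb] := pairing_neq0 sP (slot_block_mem sP (ltn_ord q)).
  apply: (@le_lt_trans _ _ (nu (ragged C t))); last by case: (C_fin (tagged (tagnat.sig t))).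
  by apply: le_measure; rewrite ?inE//; exact: bigcap_inf.
rewrite -(prod_slot sP) /pair_integral.
transitivity (\int[power_measure nu n./2]_y \1_(box D) y : R).
  apply: eq_Rintegral => y _; rewrite (f_sigmaE sP).
  have [yD|yD] := boolP (y \in box D).
    rewrite [RHS]indicE yD big1// => j _; rewrite indicE.
    suff -> : pull (fun i => slot sP (tagnat.Rank j i)) y \in box (@C j) by [].
    apply/mem_set => i; rewrite tnth_mktuple -[C i]ragged_Rank.
    by move/set_mem : yD => /(_ (slot sP (tagnat.Rank j i))); apply; rewrite /mkset -slotE.
  rewrite [RHS]indicE (negbTE yD); apply/eqP; apply: contraNT yD => P0.
  apply/mem_set => q t /= tq; move: tq; rewrite -(slotE sP) => /eqP <-.
  move: P0; rewrite prodf_seq_neq0 => /allP/(_ (block_of t)).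
  rewrite mem_index_enum => /(_ isT)/=; rewrite indicE pnatr_eq0 eqb0 negbK => /set_mem.
  move=> /(_ (tagnat.sig2 t)); rewrite tnth_mktuple tagnat.sig2K.
  by rewrite /ragged.
rewrite /Rintegral integral_indic//; last exact: measurable_box.
rewrite setIT [X in fine X](power_measureE nu mD).
rewrite (eq_bigr (fun q => (fine (nu (D q)))%:E)) ?prodEFin//.
by move=> q _; rewrite fineK// ge0_fin_numE.
Qed.

(** Distinct sides of one box are disjoint. This is where the restriction to crossing pairings
    originates. *)
Lemma meet_measure_diag p q : (forall j, trivIset setT (@C j)) ->
  p != q -> block_of p = block_of q -> box_kernel [set p; q] = 0.
Proof.
move=> dC pq; rewrite meet_measure2.
have [j [i pE]] := RankP p; have [j' [i' qE]] := RankP q; move: pq; rewrite {}pE qE.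
rewrite !ragged_Rank !block_of_Rank => pq jj; case: _ / jj i' {qE} pq => i' pq.
have ii' : i != i' by apply: contraNneq pq => ->.
rewrite (_ : _ `&` _ = set0) ?measure0//.
by move/trivIsetP : (dC j) => /(_ i i' I I ii').
Qed.

End Boxes.
Lemma sum_box_perm m (C : 'I_m -> set T) : trivIset setT C ->
  (fun x => \sum_(w : 'S_m) \1_(box (C \o w)) x) = \1_(sym_box C) :> (m.-tuple T -> R).
Proof.
move=> tC; apply/funext => x; rewrite -sum_box_permute//.
rewrite (reindex_inj invg_inj) /=; apply: eq_bigr => w _; rewrite !indicE.
congr (nat_of_bool _)%:R; apply/idP/idP => /set_mem h; apply/mem_set => i.
  by have := h (w i); rewrite tnth_mktuple /= permK.
by have := h ((w^-1)%g i); rewrite tnth_mktuple /= permKV.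
Qed.

End Contractions.

(** * Gaussian families *)

Section AllMoments.
Context d (T : measurableType d) (R : realType) (P : probability T R).
Implicit Types X Y : T -> R.

(** L2 is not stable under products; this class is an algebra of integrable functions, so all joint
    moments of its members exist. *)
Definition all_moments X := measurable_fun setT X /\ forall p, L1 P (fun w => `|X w| ^+ p).

Lemma all_moments_cst c : all_moments (fun=> c).
Proof. by split=> [|p]; [exact: measurable_cst|exact: L1_cst]. Qed.

Lemma all_moments_L1 X : all_moments X -> L1 P X.
Proof.
move=> [mX hX]; apply: (L1_le mX (hX 1)) => w; by rewrite expr1.
Qed.

Lemma all_momentsM X Y : all_moments X -> all_moments Y -> all_moments (fun w => X w * Y w).
Proof.
move=> [mX hX] [mY hY]; split=> [|p]; first exact: measurable_funM.
apply: (L1_le _ (L1D (hX (p * 2)%N) (hY (p * 2)%N))) => [|w].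
  by apply: measurable_funX; apply: measurableT_comp => //; exact: measurable_funM.
rewrite normrX normr_id normrM exprMn !exprM.
set a := _ ^+ p; set b := _ ^+ p; have := sqr_ge0 (a - b); have := sqr_ge0 (a + b).
lra.
Qed.

Lemma all_momentsD X Y : all_moments X -> all_moments Y -> all_moments (fun w => X w + Y w).
Proof.
move=> [mX hX] [mY hY]; split=> [|p]; first exact: measurable_funD.
apply: (L1_le _ (L1Z (2 ^+ p) (L1D (hX p) (hY p)))) => [|w].
  by apply: measurable_funX; apply: measurableT_comp => //; exact: measurable_funD.
rewrite normrX normr_id; apply: (@le_trans _ _ ((`|X w| + `|Y w|) ^+ p)).
  by apply: lerXn2r; rewrite ?nnegrE ?addr_ge0// ler_normD.
wlog XY : X Y {mX hX mY hY} / `|X w| <= `|Y w|.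
  move=> W; have [/W//|/ltW/W] := leP `|X w| `|Y w|.
  by rewrite [X in X ^+ p]addrC [_ ^+ p + _]addrC.
apply: (@le_trans _ _ ((2 * `|Y w|) ^+ p)).
  by apply: lerXn2r; rewrite ?nnegrE ?addr_ge0 ?mulr_ge0// mulr_natl mulr2n lerD2r.
by rewrite exprMn ler_wpM2l ?exprn_ge0// lerDr exprn_ge0.
Qed.

Lemma all_moments_lin a X Y : all_moments X -> all_moments Y ->
  all_moments (fun w => a * X w + Y w).
Proof. by move=> hX hY; apply: all_momentsD => //; apply: all_momentsM => //; exact: all_moments_cst. Qed.

Lemma all_moments_prod (I : Type) (r : seq I) (p : pred I) (X : I -> T -> R) :
  (forall i, p i -> all_moments (X i)) -> all_moments (fun w => \prod_(i <- r | p i) X i w).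
Proof.
move=> h; elim: r => [|i r IH].
  under eq_fun do rewrite big_nil; exact: all_moments_cst.
under eq_fun do rewrite big_cons.
by case pi: (p i); [apply: all_momentsM => //; exact: (h i pi)|exact: IH].
Qed.

Lemma all_moments_L2 X : all_moments X -> L2 P X.
Proof.
move=> [mX hX]; split => //; apply: (eq_L1 _ (hX 2)) => w.
by rewrite -normrX ger0_norm ?sqr_ge0.
Qed.

Lemma all_moments_ae X Y : measurable_fun setT Y -> X = Y %[ae P] -> all_moments X -> all_moments Y.
Proof.
move=> mY XY [mX hX]; split => // p; apply: (ae_eq_L1 _ _ (hX p)).
  by apply: measurable_funX; exact: measurableT_comp.
by apply: filterS XY => w /[apply] ->.
Qed.

End AllMoments.

Section GaussianFamily.
Context d (T : measurableType d) (R : realType) (P : probability T R).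
Context d' (Z : measurableType d') (nu : {measure set Z -> \bar R}) (G : set Z -> T -> R).
Hypothesis G_gaussian : gaussian_measure P nu G.

Lemma gaussian_all_moments B : finite_sets nu B -> all_moments P (G B).
Proof.
move=> fB; have [/(_ 1%N (fun=> B) (fun=> 1) (fun=> fB)) + _] := G_gaussian.
rewrite (_ : (fun w => _) = G B); last by apply/funext => w; rewrite big_ord1 mul1r.
by move=> /centered_gaussian_char[mX hX _].
Qed.

Lemma covariance_G B C : finite_sets nu B -> finite_sets nu C ->
  \int[P]_w (G B w * G C w) = fine (nu (B `&` C)).
Proof.
move=> fB fC; have [_ <-//] := G_gaussian.
by rewrite unlock.
Qed.

Variables (n : nat) (D : 'I_n -> set Z).
Hypothesis D_fin : forall t, finite_sets nu (D t).
Local Notation X := (fun t w => G (D t) w).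

Lemma gaussian_vector_char (a : R) (z : 'rV[R]_n) :
  \int[P]_w cos (a + \sum_l z 0 l * X l w) = cos a *
    expR (- ((\sum_l z 0 l * \sum_j z 0 j * fine (nu (D l `&` D j))) / 2)).
Proof.
have [/(_ n D (z 0) D_fin)/centered_gaussian_char[mS _ ->] _] := G_gaussian.
congr (_ * expR (- (_ / 2))).
have L l j : L1 P (fun w => X l w * X j w).
  by apply/all_moments_L1/all_momentsM; exact: gaussian_all_moments.
transitivity (\int[P]_w \sum_l z 0 l * (\sum_j z 0 j * (X l w * X j w))).
  apply: eq_Rintegral => w _; rewrite expr2 mulr_suml; apply: eq_bigr => l _.
  by rewrite -mulrA; congr (_ * _); rewrite mulr_sumr; apply: eq_bigr => j _; ring.
have L' l : L1 P (fun w => \sum_j z 0 j * (X l w * X j w)).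
  by apply: L1_sum => j _; exact: L1Z.
rewrite Rint_sum => [|l _]; last exact: L1Z.
apply: eq_bigr => l _; rewrite RintZ// Rint_sum => [|j _]; last exact: L1Z.
by congr (_ * _); apply: eq_bigr => j _; rewrite RintZ// covariance_G.
Qed.

(** Both sides equal 1 on the empty set and obey the same expansion along an element [l]: Wick's
    formula on the left, [pair_sumU1] on the right. *)
Lemma gaussian_moment A : moment P X A = pair_sum (meet_measure nu D) A.
Proof.
have mX t : measurable_fun setT (X t) by have [] := gaussian_all_moments (D_fin t).
have LX (B : {set 'I_n}) : L1 P (fun w => \prod_(j in B) X j w).
  by apply/all_moments_L1/all_moments_prod => j _; exact: gaussian_all_moments.
elim/card_ind: A => A IH; have [->|/finset.set0Pn[l lA]] := eqVneq A finset.set0.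
  rewrite pair_sum0 -[RHS](Rint_cst P); apply: eq_Rintegral => w _; exact: big_set0.
have lA' : l \notin A :\ l by rewrite !inE eqxx.
rewrite -(finset.setD1K lA) pair_sumU1// (wick_moment mX LX (K := fun l j => fine (nu (D l `&` D j))))//.
- apply: eq_bigr => j jA; rewrite meet_measure2 IH//.
  by apply: (fintype.sub_proper_trans (finset.subD1set _ _)); exact: properD1.
- by move=> i j; rewrite setIC.
- exact: gaussian_vector_char.
Qed.

End GaussianFamily.

(** * The diagram formula *)

Lemma dfwith_id (I : eqType) (V : I -> Type) (F : forall i, V i) j : dfwith F j (F j) = F.
Proof. by apply: functional_extensionality_dep => i; case: dfwithP. Qed.

(** Passes from entries in [A] to entries in [B] one coordinate at a time; [D] contains the
    coordinates not yet known to be in [A]. Used from generators to their span, and from the span to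
    all symmetric L2 functions. *)
Lemma dfwith_induction (I : finType) (V : I -> Type) (A B : forall i, V i -> Prop)
    (Q : (forall i, V i) -> Prop) :
  (forall i x, A i x -> B i x) ->
  (forall F, (forall i, A i (F i)) -> Q F) ->
  (forall F j, (forall i, B i (F i)) -> (forall g, A j g -> Q (dfwith F j g)) -> Q F) ->
  forall F, (forall i, B i (F i)) -> Q F.
Proof.
move=> AB base step.
suff H (D : {set I}) : forall F, (forall i, B i (F i)) -> (forall i, i \notin D -> A i (F i)) -> Q F.
  by move=> F BF; apply: (H finset.setT) => // i; rewrite finset.in_setT.
elim/card_ind: D => D IH F BF AF.
have [D0|/finset.set0Pn[j jD]] := eqVneq D finset.set0.
  by apply: base => i; apply: AF; rewrite D0 finset.in_set0.
apply: (step F j) => // g Ag; apply: (IH (D :\ j)) => [|i|i].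
- exact: properD1.
- by case: dfwithP => [|i' _]; [exact: AB|exact: BF].
- case: dfwithP => // i' ji'; rewrite !inE eq_sym (negbTE ji') /=; exact: AF.
Qed.

Lemma cvg_sumR (R : realType) (I : Type) (r : seq I) (q : pred I) (u : nat -> I -> R) (a : I -> R) :
  (forall i, q i -> u p i @[p --> \oo] --> a i) ->
  \sum_(i <- r | q i) u p i @[p --> \oo] --> \sum_(i <- r | q i) a i.
Proof.
move=> h; elim: r => [|i r IH].
  by under eq_fun do rewrite big_nil; rewrite big_nil; exact: cvg_cst.
under eq_fun do rewrite big_cons; rewrite big_cons.
case qi: (q i) => //; apply: cvgD => //; exact: h.
Qed.

Section MomentFunctionals.
Variables (R : realType) (k : nat) (n_ : 'I_k -> nat).
Local Notation n := (\sum_(j < k) n_ j)%N.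

(* Satisfied both by the moment and by the cumulant of the full set of variables. *)
Definition moment_functional (L : ({set 'I_k} -> R) -> R) (S : {set {set {set 'I_n}}}) : Prop :=
  [/\ forall c m, L (fun B => \prod_(j in B) c j * m B) = \prod_j c j * L m,
      forall a (m1 m2 m3 : {set 'I_k} -> R) j,
        (forall B : {set 'I_k}, j \notin B -> m1 B = m3 B) -> (forall B : {set 'I_k}, j \notin B -> m2 B = m3 B) ->
        (forall B : {set 'I_k}, j \in B -> m3 B = a * m1 B + m2 B) -> L m3 = a * L m1 + L m2,
      forall (u : nat -> {set 'I_k} -> R) m,
        (forall B, u p B @[p --> \oo] --> m B) -> L (u p) @[p --> \oo] --> L m,
      {subset S <= M2_0 (pi_star n_)}
    & forall K : {set 'I_n} -> R,
        (forall p q, p != q -> block_of p = block_of q -> K [set p; q]%SET = 0) ->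
        L (fun B => pair_sum K (blocks (@block_of k n_) B)) = \sum_(s in S) \prod_(b in s) K b].

Lemma moment_functional_eval :
  moment_functional (fun m => m finset.setT) (M2_0 (pi_star n_)).
Proof.
split => // [c m|a m1 m2 m3 j _ _ ->//|K K0]; last first.
  rewrite -pair_sum_M2_0//; congr (pair_sum K _).
  by apply/finset.setP => t; rewrite !inE.
by congr (_ * _); apply: eq_bigl => j; rewrite inE.
Qed.

Lemma cvg_cum l (u : nat -> {set 'I_k} -> R) (m : {set 'I_k} -> R) A :
  (forall B, u p B @[p --> \oo] --> m B) -> cum l (u p) A @[p --> \oo] --> cum l m A.
Proof.
move=> um; elim/card_ind: A => A IH.
rewrite cumE (_ : (fun p => _) = (fun p => u p A - \sum_(B : {set 'I_k} | (l \in B) && (B \proper A))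
   cum l (u p) B * u p (A :\: B))); last by apply/funext => p; rewrite cumE.
apply: cvgB => //; apply: cvg_sumR => B /andP[_ BA].
by apply: cvgM => //; exact: IH.
Qed.

Lemma moment_functional_cum l : (forall j, (0 < n_ j)%N) ->
  moment_functional (fun m => cum l m finset.setT) (M2 (pi_star n_)).
Proof.
move=> n0; split => [c m|a m1 m2 m3 j h1 h2 h3|u m um|s|K K0].
- rewrite (@cum_scale _ _ _ _ (fun B : {set 'I_k} => \prod_(j in B) c j)).
    by congr (_ * _); apply: eq_bigl => j; rewrite inE.
  move=> B C BC; rewrite -bigU/=; last by rewrite finset.disjoints_subset finset.subsetC finset.subsetDr.
  by apply: eq_bigl => j; rewrite !inE; have := fintype.subsetP BC j; case: (j \in B) => //= ->.
- have H := cum_linear l h1 h2 h3; exact: (H _ (finset.in_setT j)).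
- exact: cvg_cum.
- by rewrite (M2E l s n0) M2_0E => /and3P[-> ->].
- exact: cum_pair_sum_M2.
Qed.

End MomentFunctionals.

Section SymmetricFunctions.
Context d (Z : measurableType d) (R : realType).
Variables (nu : {sigma_finite_measure set Z -> \bar R}) (m : nat).
Local Notation mu := (power_measure nu m).
Implicit Types f g : m.-tuple Z -> R.

Lemma sym_L2_L2 f : sym_L2 nu f -> L2 mu f.
Proof. by move=> /sym_L2P[]. Qed.

Lemma sym_L2_lin a f g : sym_L2 nu f -> sym_L2 nu g -> sym_L2 nu (fun x => a * f x + g x).
Proof.
move=> /sym_L2P[hf sf] /sym_L2P[hg sg]; apply/sym_L2P; split; first exact: L2_lin.
by apply: filterS2 sf sg => x fx gx w; rewrite fx gx.
Qed.

Lemma sym_box_indics_sym_L2 f : sym_box_indics nu f -> @sym_L2 _ _ _ nu m f.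
Proof.
move=> [C [fC tC] ->]; apply/sym_L2P; split; last first.
  apply/aeW => x w; rewrite !indicE; congr (nat_of_bool _)%:R.
  apply/idP/idP => /set_mem/sym_boxP[w' h]; apply/mem_set/sym_boxP.
    by exists (w' * w)%g => i; rewrite permM; have := h i; rewrite tnth_mktuple.
  by exists (w' * w^-1)%g => i; have := h i; rewrite tnth_mktuple permM permKV.
rewrite -(sum_box_perm R tC); apply: L2_sum => w _; apply: (@box_indics_L2 _ _ _ nu).
exists (C \o w) => //; split => [i|]; first exact: fC.
apply/trivIsetP => i j _ _ ij /=; move/trivIsetP: tC; apply => //.
by rewrite (inj_eq perm_inj).
Qed.

Lemma lspan_sym_L2 f : lspan (@sym_box_indics _ _ _ nu m) f -> sym_L2 nu f.
Proof.
elim=> [|a g h /sym_box_indics_sym_L2 hg _]; last exact: sym_L2_lin.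
by apply/sym_L2P; split; [exact: L2_0|exact: aeW].
Qed.

End SymmetricFunctions.

(** * The formula on symmetrized boxes and their span *)

Section DiagramFormula.
Context d (T : measurableType d) (R : realType) (P : probability T R).
Context d' (Z : measurableType d') (nu : {sigma_finite_measure set Z -> \bar R}).
Variable G : set Z -> T -> R.
Hypothesis G_gaussian : gaussian_measure P nu G.
Variables (k : nat) (n_ : 'I_k -> nat).
Variable J : forall j : 'I_k, ((n_ j).-tuple Z -> R) -> T -> R.
Hypothesis J_integral : forall j, multiple_integral P nu G (@J j).
Local Notation n := (\sum_(j < k) n_ j)%N.
Local Notation mu j := (power_measure nu (n_ j)).
Implicit Types (F : forall j : 'I_k, (n_ j).-tuple Z -> R).

(** All moments are required here because outside the span of the boxes they are established only
    later, from the formula on that span. *)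
Definition integrand j (f : (n_ j).-tuple Z -> R) := sym_L2 nu f /\ all_moments P (J f).

Lemma integral_L2 j (f : (n_ j).-tuple Z -> R) : sym_L2 nu f -> L2 P (J f).
Proof. by have [h _ _ _] := J_integral j => /h/Lfun2P. Qed.

Lemma integral_lin j a (f g : (n_ j).-tuple Z -> R) : sym_L2 nu f -> sym_L2 nu g ->
  (fun w => a * J f w + J g w) = J (fun x => a * f x + g x) %[ae P].
Proof.
have [_ h _ _] := J_integral j => hf hg.
by apply: filterS (h a f g hf hg) => w /[apply] ->.
Qed.

Lemma integrand_lin j a (f g : (n_ j).-tuple Z -> R) : integrand f -> integrand g ->
  integrand (fun x => a * f x + g x).
Proof.
move=> [sf mf] [sg mg]; split; first exact: sym_L2_lin.
apply: (all_moments_ae _ (integral_lin a sf sg)); last exact: all_moments_lin.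
by apply: L2_measurable; apply: integral_L2; exact: sym_L2_lin.
Qed.

Lemma integral_box j (C : 'I_(n_ j) -> set Z) : disjoint_box nu C ->
  (fun w => (n_ j)`!%:R * \prod_i G (C i) w) = J \1_(sym_box C) %[ae P].
Proof.
have [_ _ _ h] := J_integral j => -[fC tC].
by apply: filterS (h C fC tC) => w /[apply] ->.
Qed.

Lemma integrand_box j (f : (n_ j).-tuple Z -> R) : sym_box_indics nu f -> integrand f.
Proof.
move=> [C dC ->]; have sC : sym_L2 nu (\1_(sym_box C) : (n_ j).-tuple Z -> R).
  by apply: sym_box_indics_sym_L2; exists C.
split => //; apply: (all_moments_ae _ (integral_box dC)).
  exact/L2_measurable/integral_L2.
apply: all_momentsM; first exact: all_moments_cst.
by apply: all_moments_prod => i _; apply: (gaussian_all_moments G_gaussian); case: dC.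
Qed.

Lemma integrand_lspan j (f : (n_ j).-tuple Z -> R) :
  lspan (@sym_box_indics _ _ _ nu (n_ j)) f -> integrand f.
Proof.
elim=> [|a g h /integrand_box hg _]; last exact: integrand_lin.
have s0 : sym_L2 nu ((fun=> 0) : (n_ j).-tuple Z -> R) by apply: lspan_sym_L2; exact: lspan0.
split => //; apply: (all_moments_ae _ _ (all_moments_cst P 0)).
  exact/L2_measurable/integral_L2.
apply: filterS (integral_lin (-1) s0 s0) => w /(_ I); rewrite mulN1r addNr => e _; rewrite [LHS]e.
by congr (J _ w); apply/funext => x; rewrite mulr0 addr0.
Qed.

Definition joint_moment F := moment P (fun j => J (F j)).

Lemma joint_moment_dfwith_notin F j (g : (n_ j).-tuple Z -> R) (B : {set 'I_k}) : j \notin B ->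
  joint_moment (dfwith F j g) B = joint_moment F B.
Proof.
move=> jB; apply: eq_Rintegral => w _.
exact: (prod_dfwith_notin (fun i f => J f w)).
Qed.

Lemma joint_moment_dfwith F j (g : (n_ j).-tuple Z -> R) (B : {set 'I_k}) : j \in B ->
  joint_moment (dfwith F j g) B = \int[P]_w (J g w * \prod_(i in B :\ j) J (F i) w).
Proof.
move=> jB; apply: eq_Rintegral => w _.
exact: (prod_dfwith (fun i f => J f w)).
Qed.

Lemma all_moments_integrands F (B : {set 'I_k}) : (forall i, integrand (F i)) ->
  all_moments P (fun w => \prod_(i in B) J (F i) w).
Proof. by move=> h; apply: all_moments_prod => i _; case: (h i). Qed.

Lemma joint_moment_lin F j a (g h : (n_ j).-tuple Z -> R) (B : {set 'I_k}) :
  (forall i, integrand (F i)) -> integrand g -> integrand h -> j \in B ->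
  joint_moment (dfwith F j (fun x => a * g x + h x)) B =
  a * joint_moment (dfwith F j g) B + joint_moment (dfwith F j h) B.
Proof.
move=> hF hg hh jB; rewrite !joint_moment_dfwith//.
have [[sg mg] [sh mh]] := (hg, hh).
have mY := all_moments_integrands (B :\ j) hF.
have LM X : all_moments P X -> L1 P (fun w => X w * \prod_(i in B :\ j) J (F i) w).
  by move=> mX; apply/all_moments_L1/all_momentsM.
rewrite -RintZ ?LM// -RintD ?LM//; last exact: L1Z (LM _ _).
have [_ [mgh _]] := integrand_lin a hg hh.
have [mYm _] := mY.
apply: ae_eq_Rint; first exact: measurable_funM.
  apply: measurable_funD; last by apply: measurable_funM => //; case: mh.
  by apply: measurable_funM => //; apply: measurable_funM => //; case: mg.
by apply: filterS (integral_lin a sg sh) => w /[apply] <-; rewrite mulrDl mulrA.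
Qed.

Variables (L : ({set 'I_k} -> R) -> R) (S : {set {set {set 'I_n}}}).
Hypothesis LS : moment_functional L S.

Definition contraction_sum F := \sum_(s in S) pair_integral nu F s.

Definition discrepancy F := L (joint_moment F) - contraction_sum F.

Lemma contraction_sum_lin F j a (g h : (n_ j).-tuple Z -> R) :
  (forall i, L2 (mu i) (F i)) -> L2 (mu j) g -> L2 (mu j) h ->
  contraction_sum (dfwith F j (fun x => a * g x + h x)) =
  a * contraction_sum (dfwith F j g) + contraction_sum (dfwith F j h).
Proof.
move=> hF hg hh; have [_ _ _ SM _] := LS.
rewrite /contraction_sum mulr_sumr -big_split; apply: eq_bigr => s /SM sS.
exact: pair_integral_lin.
Qed.

Lemma discrepancy_lin F j a (g h : (n_ j).-tuple Z -> R) :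
  (forall i, integrand (F i)) -> integrand g -> integrand h ->
  discrepancy (dfwith F j (fun x => a * g x + h x)) =
  a * discrepancy (dfwith F j g) + discrepancy (dfwith F j h).
Proof.
move=> hF hg hh; have [_ Llin _ _ _] := LS.
have L2i i (f : (n_ i).-tuple Z -> R) : integrand f -> L2 (mu i) f by move=> [/sym_L2_L2].
rewrite /discrepancy contraction_sum_lin//; [|by move=> i; apply: L2i|exact: L2i|exact: L2i].
rewrite (Llin a (joint_moment (dfwith F j g)) (joint_moment (dfwith F j h)) _ j).
- by ring.
- by move=> B jB; rewrite !joint_moment_dfwith_notin.
- by move=> B jB; rewrite !joint_moment_dfwith_notin.
- by move=> B jB; exact: joint_moment_lin.
Qed.

Section SymmetricBoxes.
Variable C : forall j, 'I_(n_ j) -> set Z.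
Hypothesis C_disj : forall j, disjoint_box nu (@C j).

Definition permuted (w : forall j, 'S_(n_ j)) j := @C j \o w j.

Lemma permuted_disjoint w j : disjoint_box nu (permuted w (j := j)).
Proof.
have [fC tC] := C_disj j; split=> [i|]; first exact: fC.
apply/trivIsetP => i i' _ _ ii' /=; move/trivIsetP: tC; apply => //.
by rewrite (inj_eq perm_inj).
Qed.

(** Permuting the sides of a box only reorders the product of its Gaussian variables, so the value
    is the same for all [w]. *)
Lemma permuted_moment w B :
  pair_sum (meet_measure nu (ragged (permuted w))) (blocks (@block_of k n_) B) =
  \int[P]_t \prod_(j in B) \prod_i G (@C j i) t.
Proof.
rewrite -(gaussian_moment G_gaussian) => [|u]; last first.
  by case: (permuted_disjoint w (tag (tagnat.sig u))) => + _; apply.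
apply: eq_Rintegral => t _.
rewrite -[LHS]/(\prod_(u in blocks (@block_of k n_) B) ragged (fun j i => G (permuted w i) t) u).
rewrite prod_ragged; apply: eq_bigr => j _.
by rewrite [RHS](reindex_perm (w j)).
Qed.

(* Symmetrizing one coordinate at a time avoids expanding a product of sums over
   dependent families of permutations. *)
Definition half_symmetrized (D : {set 'I_k}) (w : forall j, 'S_(n_ j)) j : (n_ j).-tuple Z -> R :=
  if j \in D then \1_(sym_box (@C j)) else \1_(box (permuted w (j := j))).

Local Notation value := (L (fun B => \int[P]_t \prod_(j in B) \prod_i G (@C j i) t)).

Lemma half_symmetrized_L2 D w j : L2 (mu j) (half_symmetrized D w (j := j)).
Proof.
rewrite /half_symmetrized; case: ifP => _.
  by apply/sym_L2_L2/sym_box_indics_sym_L2; exists (@C j).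
by apply: (@box_indics_L2 _ _ _ nu); exists (permuted w (j := j)) => //; exact: permuted_disjoint.
Qed.

Lemma contraction_sum_sum F j (I : Type) (r : seq I) (g : I -> (n_ j).-tuple Z -> R) :
  (forall i, L2 (mu i) (F i)) -> (forall i, L2 (mu j) (g i)) ->
  contraction_sum (dfwith F j (fun x => \sum_(i <- r) g i x)) =
  \sum_(i <- r) contraction_sum (dfwith F j (g i)).
Proof.
move=> hF hg; elim: r => [|i r IH].
  (* Linearity with coefficient -1 on zero entries shows that a zero entry gives the value zero. *)
  have := contraction_sum_lin (j := j) (-1) hF (L2_0 (mu j)) (L2_0 (mu j)).
  rewrite [-1 * contraction_sum _]mulN1r addNr big_nil => E; rewrite -[RHS]E; congr (contraction_sum (dfwith F j _)).
  by apply/funext => x; rewrite big_nil mulr0 addr0.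
rewrite big_cons -IH -[X in _ = X + _]mul1r -contraction_sum_lin//; last exact: L2_sum.
congr (contraction_sum (dfwith F j _)); apply/funext => x.
by rewrite big_cons mul1r.
Qed.

(** A symmetrized box in coordinate j is a sum of (n_j)! boxes with permuted sides, all giving the
    same value; each symmetrized coordinate thus contributes one factorial. *)
Lemma contraction_sum_half_symmetrized D w :
  contraction_sum (half_symmetrized D w) = \prod_(j in D) (n_ j)`!%:R * value.
Proof.
have [_ _ _ SM Lpair] := LS.
elim/card_ind: D w => D IH w; have [->|/finset.set0Pn[j jD]] := eqVneq D finset.set0.
  rewrite big_set0 mul1r.
  have -> : half_symmetrized finset.set0 w = fun j => \1_(box (permuted w (j := j))).
    by apply: functional_extensionality_dep => j; rewrite /half_symmetrized inE.
  have fin j i : finite_sets nu (permuted w (j := j) i) by case: (permuted_disjoint w j).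
  rewrite /contraction_sum (eq_bigr (fun s : {set {set 'I_n}} =>
      \prod_(b in s) meet_measure nu (ragged (permuted w)) b)); last first.
    move=> s /SM; rewrite M2_0E => /andP[sP _]; exact: pair_integral_box.
  rewrite -Lpair; last first.
    by move=> p q; apply: meet_measure_diag => j; case: (permuted_disjoint w j).
  by congr L; apply/funext => B; exact: permuted_moment.
pose D' := D :\ j.
have fE (w' : 'S_(n_ j)) : dfwith (half_symmetrized D' w) j (\1_(box (@C j \o w'))) =
    half_symmetrized D' (dfwith w j w').
  apply: functional_extensionality_dep => i; rewrite /half_symmetrized.
  case: dfwithP => [|i' ji']; first by rewrite !inE eqxx /= /permuted dfwithin.
  by case: ifP => // _; rewrite /permuted dfwithout.
have -> : half_symmetrized D w = dfwith (half_symmetrized D' w) j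
    (fun x => \sum_(w' <- index_enum 'S_(n_ j)) \1_(box (@C j \o w')) x).
  apply: functional_extensionality_dep => i; case: dfwithP => [|i' ji'].
    by rewrite sum_box_perm ?/half_symmetrized ?jD//; case: (C_disj j).
  by rewrite /half_symmetrized !inE eq_sym ji'.
rewrite contraction_sum_sum; last first.
- move=> w'; apply: (@box_indics_L2 _ _ _ nu); exists (@C j \o w') => //.
  by have := permuted_disjoint (dfwith w j w') j; rewrite /permuted dfwithin.
- by move=> i; exact: half_symmetrized_L2.
rewrite [LHS](eq_bigr (fun=> \prod_(i in D') (n_ i)`!%:R * value)) => [|w' _]; last first.
  rewrite -(IH D' (properD1 jD) (dfwith w j w')); congr contraction_sum; exact: fE.
rewrite sumr_const card_Sn (big_setD1 j jD) /= -mulrA [RHS]mulr_natl; congr (_ *+ _).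
Qed.

(** The normalisation of the integral on symmetrized boxes puts the same factorials into the
    moments, and [L] is homogeneous in each variable. *)
Lemma discrepancy_sym_boxes : discrepancy (fun j => \1_(sym_box (@C j))) = 0.
Proof.
have [Lscale _ _ _ _] := LS.
have := contraction_sum_half_symmetrized finset.setT (fun j => 1%g).
have -> : half_symmetrized finset.setT (fun j => 1%g) = fun j => \1_(sym_box (@C j)).
  by apply: functional_extensionality_dep => j; rewrite /half_symmetrized inE.
rewrite /discrepancy => ->; apply/eqP; rewrite subr_eq0; apply/eqP.
rewrite (eq_bigl xpredT) => [|j]; last by rewrite inE.
rewrite -Lscale; congr L; apply/funext => B.
have mG j i : all_moments P (G (@C j i)).
  by apply: (gaussian_all_moments G_gaussian); case: (C_disj j).
have mB : all_moments P (fun t => \prod_(j in B) \prod_i G (@C j i) t).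
  by do 2! apply: all_moments_prod => ? _.
rewrite -RintZ; last exact: all_moments_L1.
have mbox j : integrand (\1_(sym_box (@C j)) : (n_ j).-tuple Z -> R).
  by apply: integrand_box; exists (@C j).
apply: ae_eq_Rint.
- by have [] := all_moments_integrands B mbox.
- by apply: measurable_funM => //; case: mB.
have : {ae P, forall t, forall j, J (\1_(sym_box (@C j)) : (n_ j).-tuple Z -> R) t =
    (n_ j)`!%:R * \prod_i G (@C j i) t}.
  by apply: ae_forall_count => j; apply: filterS (integral_box (C_disj j)) => t /(_ I) ->.
apply: filterS => t h _.
by rewrite -big_split; apply: eq_bigr => j _; rewrite h.
Qed.

End SymmetricBoxes.

(** The discrepancy is linear in each entry, so vanishing on the generators suffices. *)
Lemma discrepancy_lspan F : (forall j, lspan (@sym_box_indics _ _ _ nu (n_ j)) (F j)) ->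
  discrepancy F = 0.
Proof.
move: F; apply: (@dfwith_induction _ (fun j => (n_ j).-tuple Z -> R) (fun j => @sym_box_indics _ _ _ nu (n_ j))
  (fun j => lspan (@sym_box_indics _ _ _ nu (n_ j))) (fun F => discrepancy F = 0)).
- by move=> j f; exact: lspan_gen.
- move=> F hF.
  have [C hC] : exists C : forall j, 'I_(n_ j) -> set Z,
      forall j, disjoint_box nu (C j) /\ F j = \1_(sym_box (C j)).
    exists (fun j => projT1 (cid2 (hF j))) => j; by case: cid2.
  have -> : F = fun j => \1_(sym_box (C j)).
    by apply: functional_extensionality_dep => j; case: (hC j).
  by apply: discrepancy_sym_boxes => j; case: (hC j).
move=> F j hF h; rewrite -(dfwith_id F j).
have hF' i : integrand (F i) by exact: integrand_lspan.
elim: (hF j) => [|a g g' hg hg' IH].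
  have i0 : integrand ((fun=> 0) : (n_ j).-tuple Z -> R) by apply: integrand_lspan; exact: lspan0.
  have := discrepancy_lin (-1) hF' i0 i0; rewrite [-1 * discrepancy _]mulN1r addNr => E; rewrite -[RHS]E.
  by congr (discrepancy (dfwith F j _)); apply/funext => x; rewrite mulr0 addr0.
have ig := integrand_box hg; have ig' := integrand_lspan hg'.
by rewrite discrepancy_lin// h// IH mulr0 addr0.
Qed.

End DiagramFormula.

(* Convexity, applied below to a truncation b of |X|, replaces an almost surely
   convergent subsequence and Fatou's lemma. *)
Lemma pow_tangent (R : realFieldType) (a b : R) n : 0 <= a -> 0 <= b ->
  b ^+ n.+1 + n.+1%:R * b ^+ n * (a - b) <= a ^+ n.+1.
Proof.
move=> a0 b0; elim: n => [|n IH]; first by rewrite !expr1 expr0 mulr1 mul1r addrC subrK.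
have h := ler_wpM2l a0 IH; rewrite -exprS in h; apply: le_trans h.
have h2 : 0 <= n.+1%:R * b ^+ n * (a - b) ^+ 2.
  by apply: mulr_ge0; [apply: mulr_ge0; rewrite ?ler0n ?exprn_ge0|exact: sqr_ge0].
rewrite -subr_ge0; apply: le_trans h2 _; rewrite le_eqVlt; apply/orP; left; apply/eqP.
rewrite !exprS -[n.+2%:R]natr1; ring.
Qed.

(** * Bounded powers pass to L2 limits *)

Section BoundedPowers.
Context d (T : measurableType d) (R : realType) (P : probability T R).
Variables (X : T -> R) (u : nat -> T -> R) (C : R) (n : nat).
Hypotheses (X_L2 : L2 P X) (u_L2 : forall q, L2 P (u q)).
Hypothesis u_L1 : forall q, L1 P (fun w => `|u q w| ^+ n.+1).
Hypothesis u_le : forall q, \int[P]_w (`|u q w| ^+ n.+1) <= C.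
Hypothesis u_cvg : nrm2 P (fun w => u q w - X w) @[q --> \oo] --> (0 : R).

Let b (M : nat) w := if `|X w| <= M%:R then `|X w| else 0.

Let b_ge0 M w : 0 <= b M w.
Proof. by rewrite /b; case: ifP. Qed.

Let b_le M w : b M w <= M%:R.
Proof. by rewrite /b; case: ifP => // _; rewrite ler0n. Qed.

Let mX : measurable_fun setT (fun w => `|X w|).
Proof. by apply: measurableT_comp => //; exact: L2_measurable X_L2. Qed.

Let mb M : measurable_fun setT (b M).
Proof.
apply: measurable_fun_ifT => //; first by apply: measurable_fun_ler.
Qed.

Let bL1 M : L1 P (fun w => b M w ^+ n.+1).
Proof.
apply: (L1_le _ (L1_cst P (M%:R ^+ n.+1))) => [|w]; first exact: measurable_funX.
by rewrite ger0_norm ?exprn_ge0//; apply: lerXn2r; rewrite ?nnegrE.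
Qed.

(** The tangent inequality at [b M w], whose slope is at most (n+1) M^n, together with b <= |X|.
    With [M] fixed, the error term vanishes in mean as [q] grows. *)
Let truncated_le M w q :
  b M w ^+ n.+1 <= `|u q w| ^+ n.+1 + n.+1%:R * M%:R ^+ n * `|u q w - X w|.
Proof.
have h := pow_tangent n (normr_ge0 (u q w)) (b_ge0 M w).
rewrite -lerBlDr; apply: le_trans h; rewrite lerD2l -mulrN -!mulrA ler_wpM2l//.
apply: (@le_trans _ _ (b M w ^+ n * - `|u q w - X w|)).
  rewrite !mulrN lerN2 ler_wpM2r//; apply: lerXn2r; rewrite ?nnegrE//.
have bX : b M w <= `|X w| by rewrite /b; case: ifP.
apply: ler_wpM2l; first exact: exprn_ge0.
have := ler_normB (u q w) (u q w - X w); rewrite opprB addrCA subrr addr0; lra.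
Qed.

Let int_dist q : \int[P]_w `|u q w - X w| <= Num.sqrt (nrm2 P (fun w => u q w - X w)).
Proof.
have L2d : L2 P (fun w => `|u q w - X w|).
  have [md hd] := L2B (u_L2 q) X_L2; split; first exact: measurableT_comp.
  by apply: (eq_L1 _ hd) => w; rewrite real_normK ?num_real.
have L2c : L2 P (fun=> 1 : R) by split; [exact: measurable_cst|exact: L1_cst].
have := cauchy_schwarz L2d L2c.
rewrite (_ : nrm2 P (fun=> 1) = 1) ?mulr1; last by rewrite /nrm2 Rint_cst expr1n.
rewrite (_ : \int[P]_w (`|u q w - X w| * 1) = \int[P]_w `|u q w - X w|); last first.
  by apply: eq_Rintegral => w _; rewrite mulr1.
rewrite (_ : nrm2 P (fun w => `|u q w - X w|) = nrm2 P (fun w => u q w - X w)); last first.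
  by apply: eq_Rintegral => w _; rewrite real_normK ?num_real.
move=> h; rewrite -(ler_pXn2r (n := 2)) ?nnegrE ?sqrtr_ge0//; last exact: Rint_ge0.
by rewrite sqr_sqrtr// nrm2_ge0.
Qed.

Let int_truncated_le M : \int[P]_w (b M w ^+ n.+1) <= C.
Proof.
pose c : R := n.+1%:R * M%:R ^+ n.
have bound q : \int[P]_w (b M w ^+ n.+1) <=
    C + c * Num.sqrt (nrm2 P (fun w => u q w - X w)).
  have Ld : L1 P (fun w => `|u q w - X w|).
    apply/L1_norm; rewrite -[X in L1 _ X]/(fun w => u q w - X w).
    have L2c : L2 P (fun=> 1 : R) by split; [exact: measurable_cst|exact: L1_cst].
    by apply: (eq_L1 _ (L2M (L2B (u_L2 q) X_L2) L2c)) => w; rewrite mulr1.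
  apply: (@le_trans _ _ (\int[P]_w (`|u q w| ^+ n.+1 + c * `|u q w - X w|))).
    by apply: (le_Rint (bL1 M) (L1D (u_L1 q) (L1Z c Ld))) => w; exact: truncated_le.
  rewrite RintD//; last exact: L1Z.
  by rewrite RintZ// lerD// ler_wpM2l// mulr_ge0// exprn_ge0.
have lim : C + c * Num.sqrt (nrm2 P (fun w => u q w - X w)) @[q --> \oo] --> C.
  apply: (@cvg_le_sqrt _ _ (fun q => nrm2 P (fun w => u q w - X w)) _ c) => [q|]; last exact: u_cvg.
  by rewrite addrAC subrr add0r normrM ger0_norm ?mulr_ge0 ?exprn_ge0// ger0_norm ?sqrtr_ge0// mulrC.
rewrite leNgt; apply/negP => lt.
have {}lt : 0 < \int[P]_w (b M w ^+ n.+1) - C by rewrite subr_gt0.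
have [N /(_ N (leqnn N))] := cvg_dist_lt lim lt.
by have := bound N; set I := \int[P]_w _; set e := C + _; rewrite ltr_distlC; lra.
Qed.

(** Monotone convergence in the truncation level, the bound [C] being uniform. *)
Lemma bounded_pow_L1 : L1 P (fun w => `|X w| ^+ n.+1).
Proof.
pose g M w : \bar R := (b M w ^+ n.+1)%:E.
have mg M : measurable_fun setT (g M) by apply/measurable_EFinP; exact: measurable_funX.
have g0 M w : setT w -> (0 <= g M w)%E by move=> _; rewrite lee_fin exprn_ge0.
have ndg w : setT w -> {homo g^~ w : M N / (M <= N)%N >-> (M <= N)%E}.
  move=> _ M N MN; rewrite lee_fin; apply: lerXn2r; rewrite ?nnegrE// /b.
  case: ifP => XM; last by case: ifP.
  by rewrite (le_trans XM) ?ler_nat.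
have /(_ P) := cvg_monotone_convergence measurableT mg g0 ndg.
have limg w : limn (g^~ w) = (`|X w| ^+ n.+1)%:E.
  apply/cvg_lim => //; apply: cvg_near_cst; exists (Num.truncn `|X w|).+1 => // M /= XM.
  rewrite /g /b ifT//; apply/ltW/(lt_le_trans (truncnS_gt _)); by rewrite ler_nat.
move=> cvg_int; apply/integrableP; split; first by apply/measurable_EFinP; exact: measurable_funX.
apply: (@le_lt_trans _ _ C%:E); last exact: ltry.
rewrite (_ : (\int[P]_x _)%E = (\int[P]_x limn (g^~ x))%E); last first.
  by apply: eq_integral => w _; rewrite limg /= ger0_norm ?exprn_ge0.
rewrite -(cvg_lim _ cvg_int)//; apply: lime_le; first by apply/cvg_ex; eexists; exact: cvg_int.
apply: nearW => M; rewrite integral_Rint ?lee_fin//.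
Qed.

End BoundedPowers.

(** * All moments of a multiple integral *)

Section Isometry.
Context d (T : measurableType d) (R : realType) (P : probability T R).
Context d' (Z : measurableType d') (nu : {sigma_finite_measure set Z -> \bar R}).
Variable G : set Z -> T -> R.
Hypothesis G_gaussian : gaussian_measure P nu G.
Hypothesis density : forall m (f : m.-tuple Z -> R), sym_L2 nu f ->
  forall e, 0 < e -> exists2 u, lspan (@sym_box_indics _ _ _ nu m) u & dist2 (power_measure nu m) u f < e.

Lemma lspan_approx m (f : m.-tuple Z -> R) : sym_L2 nu f ->
  exists u : nat -> m.-tuple Z -> R,
    [/\ forall q, lspan (@sym_box_indics _ _ _ nu m) (u q),
        forall q, nrm2 (power_measure nu m) (fun x => u q x - f x) <= 1
      & nrm2 (power_measure nu m) (fun x => u q x - f x) @[q --> \oo] --> (0 : R)].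
Proof.
move=> sf; pose e (q : nat) : R := q.+1%:R^-1.
have e0 q : 0 < e q by rewrite invr_gt0.
pose u q := projT1 (cid2 (density sf (e0 q))).
have uP q : lspan (@sym_box_indics _ _ _ nu m) (u q) /\
    nrm2 (power_measure nu m) (fun x => u q x - f x) < e q.
  by rewrite /u; case: cid2.
exists u; split=> [q|q|]; first by case: (uP q).
  by apply/ltW/(lt_le_trans (uP q).2); rewrite invf_le1 ?ler1n.
apply: (@squeeze_cvgr _ _ _ _ (fun=> 0) (@harmonic R)); last 2 first.
- exact: cvg_cst.
- exact: cvg_harmonic.
by apply: nearW => q; rewrite nrm2_ge0/=; apply/ltW; case: (uP q).
Qed.

Variables (m : nat) (J : (m.-tuple Z -> R) -> T -> R).
Hypothesis J_integral : multiple_integral P nu G J.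

Lemma integral_cvg (u : nat -> m.-tuple Z -> R) f : (forall q, sym_L2 nu (u q)) -> sym_L2 nu f ->
  nrm2 (power_measure nu m) (fun x => u q x - f x) @[q --> \oo] --> (0 : R) ->
  nrm2 P (fun w => J (u q) w - J f w) @[q --> \oo] --> (0 : R).
Proof.
move=> su sf; have [JL2 _ Jcvg _] := J_integral.
have L2J g : sym_L2 nu g -> L2 P (J g) by move=> /JL2/Lfun2P.
move=> uf; apply/(@Lnorm2_cvg0 _ _ _ _ (fun q w => J (u q) w - J f w)).
  by move=> q; apply: L2B; exact: L2J.
apply: (Jcvg u f) => //.
by apply/(@Lnorm2_cvg0 _ _ _ _ (fun q x => u q x - f x)) => // q; apply: L2B; exact: sym_L2_L2.
Qed.

(** [C] is the number of pairings in the moment formula for [p] copies of [f]; each contraction is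
    at most the p-th power of the L2 norm. *)
Lemma lspan_moment_le p : exists2 C, 0 <= C &
  forall f, lspan (@sym_box_indics _ _ _ nu m) f ->
    \int[P]_w (J f w ^+ p) <= C * Num.sqrt (nrm2 (power_measure nu m) f) ^+ p.
Proof.
pose S := M2_0 (pi_star (fun _ : 'I_p => m)).
exists #|S|%:R => // f hf.
have := discrepancy_lspan G_gaussian (J := fun=> J) (fun=> J_integral)
  (moment_functional_eval R (fun _ : 'I_p => m)) (fun=> hf).
move/eqP; rewrite subr_eq0 => /eqP e.
rewrite (_ : \int[P]_w _ = joint_moment P (fun=> J) (fun _ : 'I_p => f) finset.setT); last first.
  apply: eq_Rintegral => w _; rewrite (eq_bigl xpredT) => [|j]; last by rewrite inE.
  by rewrite prodr_const card_ord.
rewrite e mulr_natl -sumr_const; apply: ler_sum => s sS.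
apply: le_trans (ler_norm _) _.
have fL2 : L2 (power_measure nu m) f by exact/sym_L2_L2/lspan_sym_L2.
have [_] := pair_integral_le (nu := nu) sS (fun _ : 'I_p => fL2).
by rewrite prodr_const card_ord.
Qed.

(** Approximants from the span have bounded L2 norms, hence bounded even moments, and
    [bounded_pow_L1] carries the bound to the limit. *)
Lemma sym_L2_integrand f : sym_L2 nu f -> all_moments P (J f).
Proof.
move=> sf; have [JL2 _ _ _] := J_integral.
have L2J g : sym_L2 nu g -> L2 P (J g) by move=> /JL2/Lfun2P.
have mJ := L2_measurable (L2J _ sf).
(* Even powers are moments without absolute values, hence within reach of the formula; t <= 1 + t^2
   gives the others. *)
suff even p : L1 P (fun w => `|J f w| ^+ (p * 2)).
  split => // p; apply: (L1_le _ (L1D (L1_cst P 1) (even p))) => [|w].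
    by apply: measurable_funX; exact: measurableT_comp.
  rewrite normrX normr_id exprM; set t := _ ^+ p.
  have := sqr_ge0 (t - 1); have := sqr_ge0 (t + 1); lra.
case: p => [|p]; first by apply: (eq_L1 _ (L1_cst P 1)) => w; rewrite expr0.
have [u [hu u1 uf]] := lspan_approx sf.
have su q : sym_L2 nu (u q) by exact: lspan_sym_L2.
have mu q : all_moments P (J (u q)).
  by case: (integrand_lspan G_gaussian (J := fun _ : 'I_1 => J) (fun=> J_integral) (hu q) (j := ord0)).
have [C C0 hC] := lspan_moment_le (p.+1 * 2).
(* The approximants satisfy |u|^2 <= 2 |u - f|^2 + 2 |f|^2 <= 2 + 2 |f|^2 in L2 norm. *)
pose B := C * (2 + 2 * nrm2 (power_measure nu m) f) ^+ p.+1.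
have E : (p.+1 * 2)%N = (p * 2).+1.+1 by [].
rewrite E; apply: (@bounded_pow_L1 _ _ _ _ _ (fun q => J (u q)) B).
- exact: L2J.
- by move=> q; exact: L2J.
- by move=> q; case: (mu q).
- move=> q; rewrite -E; apply: le_trans (_ : C * Num.sqrt (nrm2 (power_measure nu m) (u q)) ^+ (p.+1 * 2) <= _).
    apply: le_trans (hC _ (hu q)); rewrite le_eqVlt; apply/orP; left; apply/eqP.
    by apply: eq_Rintegral => w _; rewrite mulnC !exprM real_normK ?num_real.
  rewrite ler_wpM2l// mulnC exprM sqr_sqrtr ?nrm2_ge0//.
  apply: lerXn2r; rewrite ?nnegrE ?addr_ge0 ?mulr_ge0 ?nrm2_ge0//.
  have fL2 := sym_L2_L2 sf; have uL2 := sym_L2_L2 (su q).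
  have := nrm2D_le (L2B uL2 fL2) fL2.
  rewrite (_ : (fun x => _) = u q); last by apply/funext => x; rewrite subrK.
  by have := u1 q; lra.
- exact: integral_cvg.
Qed.

End Isometry.

(** * Extension to all symmetric square-integrable functions *)

Section Extension.
Context d (T : measurableType d) (R : realType) (P : probability T R).
Context d' (Z : measurableType d') (nu : {sigma_finite_measure set Z -> \bar R}).
Variable G : set Z -> T -> R.
Hypothesis G_gaussian : gaussian_measure P nu G.
Hypothesis density : forall m (f : m.-tuple Z -> R), sym_L2 nu f ->
  forall e, 0 < e -> exists2 u, lspan (@sym_box_indics _ _ _ nu m) u & dist2 (power_measure nu m) u f < e.
Variables (k : nat) (n_ : 'I_k -> nat).
Variable J : forall j : 'I_k, ((n_ j).-tuple Z -> R) -> T -> R.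
Hypothesis J_integral : forall j, multiple_integral P nu G (@J j).
Local Notation n := (\sum_(j < k) n_ j)%N.
Variables (L : ({set 'I_k} -> R) -> R) (S : {set {set {set 'I_n}}}).
Hypothesis LS : moment_functional L S.

(** The other factors have all moments, so their product is in L2, and the change of one entry is
    controlled by Cauchy-Schwarz. *)
Lemma joint_moment_cvg (F : forall j : 'I_k, (n_ j).-tuple Z -> R) j
    (u : nat -> (n_ j).-tuple Z -> R) B :
  (forall i, sym_L2 nu (F i)) -> (forall q, sym_L2 nu (u q)) ->
  nrm2 (power_measure nu (n_ j)) (fun x => u q x - F j x) @[q --> \oo] --> (0 : R) ->
  joint_moment P J (dfwith F j (u q)) B @[q --> \oo] --> joint_moment P J F B.
Proof.
move=> sF su uF; have [jB|jB] := boolP (j \in B); last first.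
  under eq_fun do rewrite joint_moment_dfwith_notin//.
  exact: cvg_cst.
rewrite -{2}(dfwith_id F j) joint_moment_dfwith//.
under eq_fun do rewrite joint_moment_dfwith//.
pose Y w := \prod_(i in B :\ j) J (F i) w.
have mY : all_moments P Y.
  by apply: all_moments_prod => i _; exact: (sym_L2_integrand G_gaussian density (J_integral i)).
have mJ f : sym_L2 nu f -> all_moments P (@J j f).
  by move=> sf; exact: (sym_L2_integrand G_gaussian density (J_integral j)).
apply: (@cvg_le_sqrt _ _ (fun q => nrm2 P (fun w => J (u q) w - J (F j) w)) _ (Num.sqrt (nrm2 P Y))); last first.
  exact: (integral_cvg (J_integral j)).
move=> q; have d2 : L2 P (fun w => J (u q) w - J (F j) w).
  by apply: L2B; apply/all_moments_L2/mJ.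
rewrite -RintB; try by apply/all_moments_L1/all_momentsM => //; exact: mJ.
rewrite (_ : \int[P]_w _ = \int[P]_w ((J (u q) w - J (F j) w) * Y w)); last first.
  by apply: eq_Rintegral => w _; rewrite mulrBl.
rewrite -sqrtrM ?nrm2_ge0// -sqrtr_sqr ler_wsqrtr//.
exact: cauchy_schwarz (all_moments_L2 mY).
Qed.

(** Each entry in turn is the limit of elements of the span, and both sides are continuous in that
    entry. *)
Theorem diagram_formula (F : forall j : 'I_k, (n_ j).-tuple Z -> R) :
  (forall j, sym_L2 nu (F j)) ->
  L (joint_moment P J F) = \sum_(s in S) pair_integral nu F s.
Proof.
move=> sF; apply/eqP; rewrite -subr_eq0; apply/eqP.
move: F sF; apply: (@dfwith_induction _ (fun j => (n_ j).-tuple Z -> R)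
  (fun j => lspan (@sym_box_indics _ _ _ nu (n_ j))) (fun j => @sym_L2 _ _ _ nu (n_ j))
  (fun F => L (joint_moment P J F) - \sum_(s in S) pair_integral nu F s = 0)).
- by move=> j f; exact: lspan_sym_L2.
- move=> F hF; exact: (discrepancy_lspan G_gaussian J_integral LS hF).
move=> F j sF h; have [u [hu _ uF]] := lspan_approx density (sF j).
have su q : sym_L2 nu (u q) by exact: lspan_sym_L2.
have [_ _ Lcvg SM _] := LS.
have c1 : L (joint_moment P J (dfwith F j (u q))) @[q --> \oo] --> L (joint_moment P J F).
  by apply: Lcvg => B; exact: joint_moment_cvg.
have c2 : \sum_(s in S) pair_integral nu (dfwith F j (u q)) s @[q --> \oo] -->
    \sum_(s in S) pair_integral nu F s.
  apply: cvg_sumR => s /SM sS; rewrite -{2}(dfwith_id F j).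
  by apply: pair_integral_cvg => // [i|q|]; exact: sym_L2_L2.
have c : L (joint_moment P J (dfwith F j (u q))) - \sum_(s in S) pair_integral nu (dfwith F j (u q)) s
    @[q --> \oo] --> L (joint_moment P J F) - \sum_(s in S) pair_integral nu F s by exact: cvgB c1 c2.
move: c; under eq_fun do rewrite (h _ (hu _)).
by move=> c; apply/esym; apply: (cvg_unique _ (cvg_cst 0) c).
Qed.

End Extension.

(** The only nonempty subset of a point is the point, so a point of positive mass would be an
    atom. *)
Lemma nonatomic_set1 d (T : measurableType d) (R : realType)
    (mu : {sigma_finite_measure set T -> \bar R}) x :
  nonatomic mu -> measurable [set x] -> mu [set x] = 0%E.
Proof.
move=> na mx; apply/eqP; rewrite eq_le measure_ge0 andbT leNgt; apply/negP => x0.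
apply: (na [set x]); split => // B mB Bx; have [->|Bn] := eqVneq B set0; first by rewrite measure0.
suff -> : B = [set x] by rewrite ltxx.
by move/set0P: Bn => [y By]; have := Bx _ By => /= yx; apply/seteqP; split => // z ->; rewrite -yx.
Qed.

Theorem corollary7p1
    (R : realType)
    (Z : ptopologicalType) (Z_polish : polish R Z)
    (nu : {sigma_finite_measure set (borel Z) -> \bar R})
    (nu_nonatomic : nonatomic nu)
    (d : measure_display) (Omega : measurableType d) (P : probability Omega R)
    (G : set (borel Z) -> Omega -> R) (G_gaussian : gaussian_measure P nu G)
    (I : forall m : nat, (m.-tuple (borel Z) -> R) -> Omega -> R)
    (I_integral : forall m, (0 < m)%N -> multiple_integral P nu G (I m))
    (k : nat) (k_gt0 : (0 < k)%N)
    (n_ : 'I_k -> nat) (n_gt0 : forall j, (0 < n_ j)%N)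
    (f : forall j : 'I_k, (n_ j).-tuple (borel Z) -> R)
    (f_L2s : forall j, sym_L2 nu (f j)) :
  let n := (\sum_(j < k) n_ j)%N in
  let pistar := pi_star n_ in
  let X := fun j : 'I_k => I (n_ j) (f j) in
  let integral := fun s : {set {set 'I_n}} =>
    \int[power_measure nu n./2]_y f_sigma f s y in
  [/\ (odd n -> M2 pistar = finset.set0) /\
      (M2 pistar = finset.set0 -> joint_cumulant P X = 0),
      M2 pistar <> finset.set0 ->
        joint_cumulant P X = (\sum_(s in M2 pistar) integral s)%:C,
      (odd n -> M2_0 pistar = finset.set0) /\
      (M2_0 pistar = finset.set0 -> ('E_P[fun w => (\prod_(j < k) X j w)%R] = 0)%E)
    & M2_0 pistar <> finset.set0 ->
        ('E_P[fun w => (\prod_(j < k) X j w)%R] =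
          (\sum_(s in M2_0 pistar) integral s)%:E)%E].
Proof.
move=> n pistar X integral.
have [U [U_open U_sep]] := polish_separating Z_polish.
have mU i : measurable (U i : set (borel Z)) by apply: sub_sigma_algebra; exact: U_open.
have nu1 x : nu [set x] = 0%E.
  by apply: nonatomic_set1 => //; exact: (separated_set1 mU U_sep).
have density m (g : m.-tuple (borel Z) -> R) : sym_L2 nu g -> forall e, 0 < e ->
    exists2 u, lspan (@sym_box_indics _ _ _ nu m) u & dist2 (power_measure nu m) u g < e.
  by move=> sg e e0; exact: (sym_box_density point mU U_sep nu1 sg e0).
have J_integral j : multiple_integral P nu G (I (n_ j)) by exact: I_integral.
have mX j : all_moments P (X j) by exact: (sym_L2_integrand G_gaussian density (J_integral j)).
have mXB B : all_moments P (fun w => \prod_(j in B) X j w).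
  by apply: all_moments_prod => j _.
(* This formula and [CX] hold whether or not the set of pairings is empty; the vanishing statements
   are the case of an empty sum. *)
have EX : ('E_P[fun w => (\prod_(j < k) X j w)%R] = (\sum_(s in M2_0 pistar) integral s)%:E)%E.
  rewrite -(diagram_formula G_gaussian density J_integral (moment_functional_eval R n_) f_L2s).
  rewrite unlock -integral_Rint.
    by apply: eq_integral => w _; congr EFin; apply: eq_bigl => j; rewrite inE.
  exact: all_moments_L1.
have CX : joint_cumulant P X = (\sum_(s in M2 pistar) integral s)%:C.
  (* [ord_max] exists only for a successor, so [k] is destructed together with everything that
     depends on it. *)
  case: k k_gt0 n_ n_gt0 f f_L2s @n @pistar @X @integral J_integral mX mXB {EX} => // k _ n_ n_gt0 f f_L2s n pistar X integral J_integral mX mXB.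
  rewrite joint_cumulantE => [|j|B]; [|by case: (mX j)|exact: all_moments_L1].
  by rewrite -(diagram_formula G_gaussian density J_integral (moment_functional_cum R ord_max n_gt0) f_L2s).
have odd0 : odd n -> M2_0 pistar = finset.set0.
  by move=> on; apply/finset.setP => s; rewrite M2_0E pairings_odd// !inE.
split; [split|by move=> _|split|by move=> _] => //.
- move=> on; apply/finset.setP => s; rewrite (M2E (Ordinal k_gt0) s n_gt0) pairings_odd//.
  by rewrite !inE.
- by rewrite CX => ->; rewrite big_set0.
- by rewrite EX => ->; rewrite big_set0.
Qed.
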